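(* If $n>1$ is an odd integer then for all $z\in\mathbb{C} \setminus \mathbb{R}_{\le 0}$ \[ \psi_{-n}(z) \ = \ \frac{(2\pi i)^{n}}{\zeta(n)(n+1)!}\sum_{m=0}^{n+1}{n+1 \choose m}B_{m} \, B_{n+1-m} \, z^{m-1} \] and \[ g_{-n}(z) \ = \ \frac{(2\pi i)^{n}}{i(n+1)!}\sum_{m=0}^{n}{n+1 \choose m+1} B_{m+1} \, B_{n-m} \, z^{m} . \]
   Context: For $a\in\mathbb{C}$, let $\sigma_a(n)=\sum_{d|n} d^a$ and let $E_{a+1}(z) = 1 + \frac{2}{\zeta(-a)} \sum_{n\ge 1} \sigma_a(n)\, e^{2\pi i n z}$ be the Eisenstein series of weight $a+1$, where $\zeta$ is the Riemann zeta function. Its period function is $\psi_a(z) = E_{a+1}(z) - \frac{1}{z^{a+1}} E_{a+1}\left(-\frac{1}{z}\right)$, which (by work of Bettin--Conrey) extends analytically to $\mathbb{C}\setminus\mathbb{R}_{\le 0}$ and satisfies \[ \psi_{a}(z) \ = \ \frac{i}{\pi z}\frac{\zeta(1-a)}{\zeta(-a)}-\frac{i}{z^{1+a}}\cot\frac{\pi a}{2}+i\frac{g_{a}(z)}{\zeta(-a)}, \] where \begin{align*} g_{a}(z) \ = \ &-2\sum_{1\leq n\leq M}(-1)^{n}\frac{B_{2n}}{(2n)!}\, \zeta(1-2n-a)(2\pi z)^{2n-1} \\ &\qquad {}+\frac{1}{\pi i}\int_{(-\frac{1}{2}-2M)}\zeta(s) \, \zeta(s-a) \, \Gamma(s)\frac{\cos\frac{\pi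 a}{2}}{\sin\pi \frac{s-a} 2}(2\pi z)^{-s} \, ds \, , \end{align*} with $M$ any integer $\ge -\frac{1}{2}\min(0,\Re(a))$ and the integral taken over the vertical line $\Re(s)=-\frac12-2M$. Here $B_k$ denotes the $k$-th Bernoulli number.
   Formalization: In the definition of g_a the finite sum is taken with coefficient +2 instead of the displayed -2; with -2 the second identity is false (for n=3 the coefficient of z would be +π³/18 rather than -π³/18) and so is the displayed relation between ψ_a and g_a. *)

(* Defs.v *)
From Stdlib Require Import Reals Lra Lia Arith.
From Coquelicot Require Export Coquelicot.

Open Scope C_scope.

(** ** Bernoulli numbers *)

(* [bernoulli_upto n k] is B_k for k <= n; values at k > n are irrelevant. *)
Fixpoint bernoulli_upto (n : nat) : nat -> R :=
  match n with
  | O => fun _ => 1%R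
  | S m => fun k =>
      if Nat.leb k m then bernoulli_upto m k
      else (- / INR (m + 2) *
              sum_f_R0 (fun j => Binomial.C (m + 2) j * bernoulli_upto m j) m)%R
  end.

(* Convention B_1 = -1/2. *)
Definition bernoulli (n : nat) : R := bernoulli_upto n n.

Lemma bernoulli_upto_le (n k : nat) :
  (k <= n)%nat -> bernoulli_upto n k = bernoulli k.
Proof.
  induction n as [|n IH]; intros Hk.
  - now replace k with O by lia.
  - destruct (Nat.eq_dec k (S n)) as [->|Hne]; [reflexivity|].
    simpl. replace (Nat.leb k n) with true by (symmetry; apply Nat.leb_le; lia).
    apply IH; lia.
Qed.

Lemma bernoulli_0 : bernoulli 0 = 1%R.
Proof. reflexivity. Qed.

Lemma bernoulli_S (m : nat) :
  bernoulli (S m) =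
  (- / INR (m + 2) *
     sum_f_R0 (fun j => Binomial.C (m + 2) j * bernoulli j) m)%R.
Proof.
  unfold bernoulli at 1; cbn [bernoulli_upto].
  replace (Nat.leb (S m) m) with false by (symmetry; apply Nat.leb_gt; lia).
  f_equal; apply sum_eq; intros j Hj.
  now rewrite bernoulli_upto_le.
Qed.

(** ** Limits and series in C; junk when they do not converge *)

Definition Clim_seq (u : nat -> C) : C :=
  @iota C_CompleteNormedModule (fun l => filterlim u eventually (locally l)).

Definition Cseries (u : nat -> C) : C :=
  @iota C_CompleteNormedModule (fun l => is_series u l).

(** ** Elementary functions *)

Definition Cexp (z : C) : C := (exp (Re z) * cos (Im z), exp (Re z) * sin (Im z))%R.

Definition Ccos (z : C) : C := (Cexp (Ci * z) + Cexp (- (Ci * z))) / 2.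

Definition Csin (z : C) : C := (Cexp (Ci * z) - Cexp (- (Ci * z))) / (2 * Ci).

(* C minus the closed negative real axis. *)
Definition slit_plane (z : C) : Prop := ~ (Im z = 0%R /\ (Re z <= 0)%R).

(* Half-angle formula for the principal argument in (-PI, PI); it is the
   argument only on [slit_plane]. *)
Definition Carg (z : C) : R := (2 * atan (Im z / (Cmod z + Re z)))%R.

Definition Clog (z : C) : C := (ln (Cmod z), Carg z).

(* Principal value of z^s for z in [slit_plane]; Coquelicot's [z ^ n] has a
   natural exponent. *)
Definition Cpower (z s : C) : C := Cexp (s * Clog z).

(** ** Analytic functions, zeta and Gamma *)

Definition analytic_at (f : C -> C) (z0 : C) : Prop :=
  exists (a : nat -> C) (r : posreal),
    forall z : C, (Cmod (z - z0) < r)%R ->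
      @is_pseries C_AbsRing C_NormedModule a (z - z0) (f z).

(* [zeta] is the analytic continuation of the Dirichlet series to C \ {1}; its
   value at the pole 1 is unconstrained. *)
Definition is_riemann_zeta (zeta : C -> C) : Prop :=
  (forall s : C, s <> 1 -> analytic_at zeta s) /\
  (forall s : C, (1 < Re s)%R ->
     @is_series C_AbsRing C_NormedModule
       (fun k => Cpower (INR (S k)) (- s)) (zeta s)).

Fixpoint Crising (s : C) (n : nat) : C :=
  match n with
  | O => 1
  | S m => Crising s m * (s + INR m)
  end.

(* Gauss's limit n! n^s / (s (s+1) ... (s+n)), valid off the poles. *)
Definition CGamma (s : C) : C :=
  Clim_seq (fun n => INR (fact n) * Cpower (INR n) s / Crising s (S n)).

(** ** Eisenstein series, period functions *)

(* Used for n >= 1 only. *)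
Definition sigma (a : C) (n : nat) : C :=
  sum_n_m (fun d => if Nat.eqb (n mod d) 0 then Cpower (INR d) a else RtoC 0) 1 n.

(* E_{a+1}(z); the index k of the series stands for n = k + 1. *)
Definition eisenstein (zeta : C -> C) (a z : C) : C :=
  1 + 2 / zeta (- a) *
      Cseries (fun k => sigma a (S k) * Cexp (2 * PI * Ci * INR (S k) * z)).

(* [psi] is the analytic extension to the slit plane of
   E_{a+1}(z) - z^{-a-1} E_{a+1}(-1/z), given on the upper half-plane. *)
Definition is_period_function (zeta : C -> C) (a : C) (psi : C -> C) : Prop :=
  (forall z : C, slit_plane z -> analytic_at psi z) /\
  (forall z : C, (0 < Im z)%R ->
     psi z = eisenstein zeta a z
             - 1 / Cpower z (a + 1) * eisenstein zeta a (- (1 / z))).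

(* Integral of f(s) ds upwards along Re s = c. *)
Definition vertical_integral (c : R) (f : C -> C) : C :=
  Ci * @RInt_gen C_R_CompleteNormedModule (fun t : R => f (c, t))
         (Rbar_locally m_infty) (Rbar_locally p_infty).

(* g_a(z) in  psi_a(z) = (i/(pi z)) zeta(1-a)/zeta(-a) - i z^{-1-a} cot(pi a/2)
   + i g_a(z)/zeta(-a),  with the line of integration at Re s = -1/2 - 2M.
   The finite sum carries the sign +2: it collects the residues at s = 1 - 2k,
   where Gamma has residue -1/(2k-1)!, zeta(1-2k) = -B_{2k}/(2k) and
   cos(pi a/2) / sin(pi (1-2k-a)/2) = (-1)^k.  It is sometimes printed with -2,
   which contradicts the relation above. *)
Definition period_g (zeta : C -> C) (a : C) (M : nat) (z : C) : C :=
  2 * sum_n_m (fun k : nat =>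
        (-1) ^ k * (bernoulli (2 * k) / INR (fact (2 * k)))
        * zeta (1 - 2 * INR k - a) * (2 * PI * z) ^ (2 * k - 1)) 1 M
  + 1 / (PI * Ci) *
    vertical_integral (- (1 / 2) - 2 * INR M)
      (fun s => zeta s * zeta (s - a) * CGamma s
                * (Ccos (PI * a / 2) / Csin (PI * (s - a) / 2))
                * Cpower (2 * PI * z) (- s)).

(* Main.v *)
(* On the imaginary axis q^d / (1 - q^d) = (coth(pi d y) - 1) / 2 turns E_{1-n}(iy) into
   sum_d coth(pi d y) / d^n, up to the factor 1 / zeta(n).  Inserting
   coth u = 1/u + sum_k 2u / (u^2 + pi^2 k^2) and interchanging the double series in one of
   the two Eisenstein terms, the period function becomes a finite sum of products
   zeta(2k) zeta(n+1-2k) with powers of z.  The coth expansion also gives the Taylor series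
   of x / (e^x - 1), hence zeta(2k) in terms of B_{2k}; the identity theorem carries the
   formula from the imaginary axis to the slit plane.

   For g_{-n} the factor cos(pi a / 2) annihilates the integrand, so only zeta at even
   integers is needed, including zeta(0) = -1/2 and zeta(-2J) = 0.  These follow from
     sum_i binom(1-s, 2i+1) 4^{-i} zeta(s + 2i) = - 2^(s-1),
   obtained for Re s > 1 by telescoping (k+1/2)^(1-s) - (k-1/2)^(1-s).  Cutting the sum at
   i = n leaves a remainder analytic for Re s >= 1 - 2n, so the relation continues to s = -2J,
   where no argument s + 2i meets the pole and the binomial coefficients with i > J vanish. *)

Require Import Defs.
From Stdlib Require Import Reals Arith Lra Lia ClassicalEpsilon.
From Coquelicot Require Import Coquelicot.
Open Scope R_scope.

(** The partial fractions of coth are obtained by real analysis: the duplication formula, iterated,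
    writes 2^p coth u as a sum of 2^p values on a vertical segment, and elementary bounds squeeze
    the real part of each interior value between multiples of w / (w^2 + t^2), up to an error w,
    with constants tending to 1. In the period function only one of the two double series changes
    its order of summation, and its terms are positive. Analyticity means a local power series; it
    is therefore propagated through [maj], an l^1 bound on the Taylor coefficients on a fixed disc.
    Such bounds survive sums, affine factors and summable families, and binomial coefficients in s
    are products of affine factors. The identity theorem serves twice, for the zeta relation along
    one segment and for psi on the slit plane; a version along segments covers both. *)

Ltac eqR := match goal with |- @eq _ ?x ?y => change (@eq R x y) end.

Lemma is_series_zero {K : AbsRing} {V : NormedModule K} (a : nat -> V) :
  (forall n, a n = zero) -> is_series a zero.
Proof.
  intros Ha. apply filterlim_ext with (fun _ => zero); [|apply filterlim_const].
  intros n. symmetry. rewrite (sum_n_ext _ _ n Ha). apply sum_n_m_const_zero.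
Qed.

(** * Interchange of double series *)

Lemma sum_n_Series (a : nat -> nat -> R) (n : nat) :
  (forall i, ex_series (a i)) ->
  is_series (fun j => sum_n (fun i => a i j) n) (sum_n (fun i => Series (a i)) n).
Proof.
  intros H; induction n as [|n IH].
  - rewrite sum_O. apply is_series_ext with (a O).
    + intros j; now rewrite sum_O.
    + apply Series_correct, H.
  - rewrite sum_Sn.
    apply is_series_ext with (fun j => plus (sum_n (fun i => a i j) n) (a (S n) j)).
    + intros j; now rewrite sum_Sn.
    + apply @is_series_plus; [exact IH | apply Series_correct, H].
Qed.

Lemma sum_n_le_Series (a : nat -> R) (n : nat) :
  (forall i, 0 <= a i) -> ex_series a -> sum_n a n <= Series a.
Proof.
  intros Ha [l Hl]. rewrite (is_series_unique _ _ Hl).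
  apply (is_lim_seq_incr_compare (sum_n a)); [exact Hl|].
  intros k; rewrite sum_Sn. unfold plus; simpl. specialize (Ha (S k)); lra.
Qed.

Lemma ex_series_bounded (a : nat -> R) (M : R) :
  (forall i, 0 <= a i) -> (forall n, sum_n a n <= M) -> ex_series a.
Proof.
  intros Ha HM.
  destruct (ex_finite_lim_seq_incr (sum_n a) M) as [l Hl].
  - intros k; rewrite sum_Sn. unfold plus; simpl. specialize (Ha (S k)); lra.
  - exact HM.
  - now exists l.
Qed.

Lemma Series_le_bound (a : nat -> R) (M : R) :
  ex_series a -> (forall n, sum_n a n <= M) -> Series a <= M.
Proof.
  intros [l Hl] HM. rewrite (is_series_unique _ _ Hl).
  apply (is_lim_seq_le (sum_n a) (fun _ => M) l M HM Hl (is_lim_seq_const M)).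
Qed.

Lemma Series_pos (a : nat -> R) : (forall i, 0 <= a i) -> ex_series a -> 0 <= Series a.
Proof.
  intros Ha He. apply Rle_trans with (sum_n a 0); [rewrite sum_O; auto|].
  now apply sum_n_le_Series.
Qed.

(** The first n column sums add up to a series of truncated rows, each below the full row sum;
    letting n grow gives one inequality. The same statement for the transposed array gives the other
    one, hence equality. *)
Lemma fubini_pos_le (a : nat -> nat -> R) :
  (forall i j, 0 <= a i j) -> (forall i, ex_series (a i)) ->
  ex_series (fun i => Series (a i)) ->
  (forall j, ex_series (fun i => a i j)) /\
  ex_series (fun j => Series (fun i => a i j)) /\
  Series (fun j => Series (fun i => a i j)) <= Series (fun i => Series (a i)).
Proof.
  intros Ha Hr Ht.
  assert (Hs : forall i, 0 <= Series (a i)) by (intros i; apply Series_pos; auto).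
  assert (Hc : forall j, ex_series (fun i => a i j)).
  { intros j. apply (@ex_series_le R_AbsRing R_CompleteNormedModule) with (2 := Ht).
    intros i. unfold norm; simpl. unfold abs; simpl. rewrite Rabs_pos_eq by auto.
    apply Rle_trans with (sum_n (a i) j); [|apply sum_n_le_Series; auto].
    destruct j; [rewrite sum_O; lra|].
    rewrite sum_Sn; unfold plus; simpl.
    enough (0 <= sum_n (a i) j) by lra.
    rewrite sum_n_Reals. apply cond_pos_sum; auto. }
  assert (Hb : forall n, sum_n (fun j => Series (fun i => a i j)) n
                 <= Series (fun i => Series (a i))).
  { intros n.
    pose proof (sum_n_Series (fun j i => a i j) n Hc) as H.
    rewrite <- (is_series_unique _ _ H).
    apply Series_le; [|exact Ht].
    intros i; split; [rewrite sum_n_Reals; apply cond_pos_sum; auto|].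
    apply sum_n_le_Series; auto. }
  assert (He : ex_series (fun j => Series (fun i => a i j))).
  { apply ex_series_bounded with (2 := Hb). intros j; apply Series_pos; auto. }
  split; [exact Hc|split; [exact He|]].
  now apply Series_le_bound.
Qed.

Lemma fubini_pos (a : nat -> nat -> R) :
  (forall i j, 0 <= a i j) -> (forall i, ex_series (a i)) ->
  ex_series (fun i => Series (a i)) ->
  (forall j, ex_series (fun i => a i j)) /\
  is_series (fun j => Series (fun i => a i j)) (Series (fun i => Series (a i))).
Proof.
  intros Ha Hr Ht.
  destruct (fubini_pos_le a Ha Hr Ht) as [H1 [H2 H3]].
  destruct (fubini_pos_le (fun j i => a i j) (fun i j => Ha j i) H1 H2) as [_ [_ H6]].
  split; [exact H1|].
  replace (Series (fun i => Series (a i))) with (Series (fun j => Series (fun i => a i j))).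
  - now apply Series_correct.
  - apply Rle_antisym; assumption.
Qed.

Lemma ex_series_Rle (a b : nat -> R) :
  (forall n, Rabs (a n) <= b n) -> ex_series b -> ex_series a.
Proof. exact (@ex_series_le R_AbsRing R_CompleteNormedModule a b). Qed.

(** Reduction to nonnegative arrays: the positive case is applied to |a| and to |a| + a, and the
    results are subtracted. *)
Lemma fubini (a : nat -> nat -> R) :
  (forall i, ex_series (fun j => Rabs (a i j))) ->
  ex_series (fun i => Series (fun j => Rabs (a i j))) ->
  (forall j, ex_series (fun i => Rabs (a i j))) /\
  ex_series (fun j => Series (fun i => Rabs (a i j))) /\
  ex_series (fun i => Series (a i)) /\
  is_series (fun j => Series (fun i => a i j)) (Series (fun i => Series (a i))).
Proof.
  intros Hr Ht.
  destruct (fubini_pos (fun i j => Rabs (a i j))) as [H1 H2]; auto.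
  { intros; apply Rabs_pos. }
  assert (Hr' : forall i, ex_series (a i)) by (intros i; apply ex_series_Rabs, Hr).
  assert (Hc' : forall j, ex_series (fun i => a i j)).
  { intros j; apply (ex_series_Rabs (fun i => a i j)), H1. }
  assert (Hs : ex_series (fun i => Series (a i))).
  { apply ex_series_Rle with (2 := Ht). intros i. now apply Series_Rabs. }
  assert (E : forall i, Series (fun j => Rabs (a i j) + a i j)
                = Series (fun j => Rabs (a i j)) + Series (a i)).
  { intros i. now apply Series_plus. }
  destruct (fubini_pos (fun i j => Rabs (a i j) + a i j)) as [_ H4].
  - intros i j. generalize (Rle_abs (- a i j)); rewrite Rabs_Ropp; lra.
  - intros i. apply @ex_series_plus; auto.
  - apply ex_series_ext with (fun i => plus (Series (fun j => Rabs (a i j))) (Series (a i))).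
    + intros i; rewrite E; reflexivity.
    + apply @ex_series_plus; auto.
  - split; [exact H1|]. split; [now exists (Series (fun i => Series (fun j => Rabs (a i j))))|].
    split; [exact Hs|].
    rewrite (Series_ext _ _ E), Series_plus in H4 by auto.
    replace (Series (fun i => Series (a i))) with
      (plus (Series (fun i => Series (fun j => Rabs (a i j))) + Series (fun i => Series (a i)))
         (opp (Series (fun i => Series (fun j => Rabs (a i j)))))).
    2:{ unfold plus, opp; simpl; ring. }
    apply is_series_ext with (fun j => plus (Series (fun i => Rabs (a i j) + a i j))
                                 (opp (Series (fun i => Rabs (a i j))))).
    + intros j. rewrite Series_plus by auto. unfold plus, opp; simpl; ring.
    + apply @is_series_plus; [exact H4|]. now apply @is_series_opp.
Qed.

(** * Zeta at integers at least 2, as a real series *)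

Definition zetaR (p : nat) : R := Series (fun k => / INR (S k) ^ p).

Lemma INR_S_pos (k : nat) : 0 < INR (S k).
Proof. apply lt_0_INR; lia. Qed.

Lemma INR_S_ge1 (k : nat) : 1 <= INR (S k).
Proof. rewrite S_INR. generalize (pos_INR k); lra. Qed.

Lemma sum_telescope (n : nat) : sum_n (fun k => / (INR (S k) * INR (S (S k)))) n = 1 - / INR (S (S n)).
Proof.
  induction n as [|n IH]; [rewrite sum_O; simpl; lra|].
  rewrite sum_Sn, IH. unfold plus; simpl AbelianMonoid.sort.
  change (1 - / INR (S (S n)) + / (INR (S (S n)) * INR (S (S (S n)))) = 1 - / INR (S (S (S n)))).
  rewrite (S_INR (S (S n))). field. generalize (INR_S_pos (S n)); lra.
Qed.

Lemma ex_series_inv_sq : ex_series (fun k => / INR (S k) ^ 2).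
Proof.
  apply ex_series_bounded with 2.
  - intros k. left; apply Rinv_0_lt_compat, pow_lt, INR_S_pos.
  - intros n. apply Rle_trans with (1 + sum_n (fun k => / (INR (S k) * INR (S (S k)))) n).
    2:{ rewrite sum_telescope. generalize (Rinv_0_lt_compat _ (INR_S_pos (S n))); lra. }
    apply Rle_trans with (2 - / INR (S n)).
    2:{ rewrite sum_telescope. enough (/ INR (S (S n)) <= / INR (S n)) by lra.
        apply Rinv_le_contravar; [apply INR_S_pos|]. rewrite (S_INR (S n)); lra. }
    induction n as [|n IH]; [rewrite sum_O; simpl; lra|].
    rewrite sum_Sn. unfold plus; simpl AbelianMonoid.sort.
    apply Rle_trans with (2 - / INR (S n) + / INR (S (S n)) ^ 2); [apply Rplus_le_compat_r, IH|].
    pose proof (INR_S_ge1 n). rewrite (S_INR (S n)). set (x := INR (S n)) in *.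
    enough (/ (x + 1) ^ 2 <= / x - / (x + 1)) by lra.
    replace (/ x - / (x + 1)) with (/ (x * (x + 1))) by (field; lra).
    apply Rinv_le_contravar; nra.
Qed.

Lemma inv_pow_le (p q k : nat) : (p <= q)%nat -> / INR (S k) ^ q <= / INR (S k) ^ p.
Proof.
  intros H. apply Rinv_le_contravar; [apply pow_lt, INR_S_pos|].
  apply Rle_pow; [apply INR_S_ge1|exact H].
Qed.

Lemma ex_series_inv_pow (p : nat) : (2 <= p)%nat -> ex_series (fun k => / INR (S k) ^ p).
Proof.
  intros H. apply ex_series_Rle with (2 := ex_series_inv_sq).
  intros k. rewrite Rabs_pos_eq by (left; apply Rinv_0_lt_compat, pow_lt, INR_S_pos).
  now apply inv_pow_le.
Qed.

Lemma zetaR_ge_1 (p : nat) : (2 <= p)%nat -> 1 <= zetaR p.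
Proof.
  intros H. unfold zetaR.
  apply Rle_trans with (sum_n (fun k => / INR (S k) ^ p) 0).
  - rewrite sum_O. change (INR 1) with 1. rewrite pow1; lra.
  - apply sum_n_le_Series; [|now apply ex_series_inv_pow].
    intros k; left; apply Rinv_0_lt_compat, pow_lt, INR_S_pos.
Qed.

(** * Partial fractions of coth *)

Lemma sum_n_m_le_loc (F G : nat -> R) (a b : nat) :
  (forall k, (a <= k <= b)%nat -> F k <= G k) -> sum_n_m F a b <= sum_n_m G a b.
Proof.
  intros H. destruct (le_lt_dec a b) as [Hab|Hab].
  - induction b as [|b IH].
    + replace a with O in * by lia. rewrite !sum_n_n. apply H; lia.
    + destruct (Nat.eq_dec a (S b)) as [->|Hne]; [rewrite !sum_n_n; apply H; lia|].
      rewrite !sum_n_Sm by lia. apply Rplus_le_compat; [apply IH; [intros; apply H|]; lia|apply H; lia].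
  - rewrite !sum_n_m_zero by auto. apply Rle_refl.
Qed.

Lemma sinh_double (w : R) : sinh (2 * w) = 2 * sinh w * cosh w.
Proof.
  unfold sinh, cosh. replace (2 * w) with (w + w) by ring.
  replace (- (w + w)) with (- w + - w) by ring. rewrite !exp_plus. field.
Qed.

Lemma cosh_sq (w : R) : cosh w ^ 2 = 1 + sinh w ^ 2.
Proof.
  unfold sinh, cosh.
  assert (exp w * exp (- w) = 1) by (rewrite <- exp_plus, Rplus_opp_r; apply exp_0).
  nra.
Qed.

Lemma cosh_double (w : R) : cosh (2 * w) = 1 + 2 * sinh w ^ 2.
Proof.
  pose proof (cosh_sq w).
  replace (cosh (2 * w)) with (cosh w ^ 2 + sinh w ^ 2); [lra|].
  unfold sinh, cosh. replace (2 * w) with (w + w) by ring.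
  replace (- (w + w)) with (- w + - w) by ring. rewrite !exp_plus. field.
Qed.

Lemma cosh_ge_1 (w : R) : 1 <= cosh w.
Proof.
  pose proof (cosh_double (w / 2)). replace (2 * (w / 2)) with w in H by field. nra.
Qed.

Lemma sinh_ge (w : R) : 0 <= w -> w <= sinh w.
Proof.
  intros [Hw|<-]; [|rewrite sinh_0; lra].
  destruct (MVT_cor2 sinh cosh 0 w Hw) as [c [Hc _]].
  { intros; apply derivable_pt_lim_sinh. }
  rewrite sinh_0 in Hc. pose proof (cosh_ge_1 c). nra.
Qed.

Lemma sinh_le_cosh (w : R) : 0 <= w -> sinh w <= w * cosh w.
Proof.
  intros [Hw|<-]; [|rewrite sinh_0; lra].
  destruct (MVT_cor2 sinh cosh 0 w Hw) as [c [Hc Hc']].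
  { intros; apply derivable_pt_lim_sinh. }
  rewrite sinh_0 in Hc.
  assert (cosh c <= cosh w).
  { destruct (MVT_cor2 cosh sinh c w) as [d [Hd Hd']]; [lra|intros; apply derivable_pt_lim_cosh|].
    pose proof (sinh_ge d). nra. }
  nra.
Qed.

(* The real part of coth((v + i phi) / 2). *)
Definition coth_re (v phi : R) : R := sinh v / (cosh v - cos phi).

(** Real part of 2 coth(2w) = coth w + coth(w + i pi/2) at w = (v + i phi)/2. *)
Lemma coth_re_double (v phi : R) :
  0 < v -> 2 * coth_re (2 * v) (2 * phi) = coth_re v phi + coth_re v (phi + PI).
Proof.
  intros Hv. unfold coth_re. rewrite neg_cos, sinh_double, cosh_double.
  rewrite cos_2a_cos. pose proof (cosh_sq v). pose proof (sinh_ge v).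
  pose proof (cosh_ge_1 v). pose proof (COS_bound phi).
  assert (1 < cosh v) by nra.
  assert (0 < cosh v - cos phi) by lra. assert (0 < cosh v + cos phi) by lra.
  assert (sinh v ^ 2 = cosh v ^ 2 - 1) as -> by lra.
  assert (0 < cosh v ^ 2 - cos phi ^ 2) by nra.
  field. repeat split; lra.
Qed.

(** Iterated duplication: at each stage the index k splits into k and k + 2^p, whose angles 2 pi k /
    2^(p+1) differ by pi. *)
Lemma coth_re_sum (p : nat) (u : R) :
  0 < u ->
  2 ^ p * coth_re u 0 =
  sum_f_R0 (fun k => coth_re (u / 2 ^ p) (2 * PI * INR k / 2 ^ p)) (2 ^ p - 1).
Proof.
  intros Hu. induction p as [|p IH].
  - simpl. rewrite !Rmult_0_r. unfold Rdiv. rewrite Rmult_0_l, Rinv_1, !Rmult_1_r; ring.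
  - assert (H2 : 0 < 2 ^ p) by (apply pow_lt; lra).
    assert (Hn : (1 <= 2 ^ p)%nat) by (apply Nat.le_succ_l, Nat.neq_0_lt_0, Nat.pow_nonzero; lia).
    replace (2 ^ S p - 1)%nat with (S (2 ^ p - 1) + (2 ^ p - 1))%nat by (simpl; lia).
    simpl (2 ^ S p)%R. rewrite Rmult_assoc, IH.
    rewrite tech2 with (m := (2 ^ p - 1)%nat) (n := (S (2 ^ p - 1) + (2 ^ p - 1))%nat) by lia.
    replace (S (2 ^ p - 1) + (2 ^ p - 1) - S (2 ^ p - 1))%nat with (2 ^ p - 1)%nat by lia.
    rewrite <- plus_sum, scal_sum. apply sum_eq. intros k _.
    rewrite Rmult_comm.
    replace (u / 2 ^ p) with (2 * (u / (2 * 2 ^ p))) by (field; lra).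
    replace (2 * PI * INR k / 2 ^ p) with (2 * (2 * PI * INR k / (2 * 2 ^ p))) by (field; lra).
    rewrite coth_re_double.
    2:{ apply Rdiv_lt_0_compat; lra. }
    f_equal. f_equal.
    replace (S (2 ^ p - 1) + k)%nat with (2 ^ p + k)%nat by lia.
    rewrite plus_INR, pow_INR. change (INR 2) with 2. field; lra.
Qed.

(** Meant for folding the angles beyond pi onto their mirror images: apart from the indices 0 and m,
    only half-angles in (0, pi/2) remain, where the bounds on sine hold. *)
Lemma sum_symmetric (f : nat -> R) (m : nat) :
  (forall k, (1 <= k < m)%nat -> f (2 * m - k)%nat = f k) -> (1 <= m)%nat ->
  sum_f_R0 f (2 * m - 1) = f O + f m + 2 * (sum_f_R0 f (m - 1) - f O).
Proof.
  intros Hf Hm.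
  rewrite tech2 with (m := (m - 1)%nat) by lia.
  replace (2 * m - 1 - S (m - 1))%nat with (m - 1)%nat by lia.
  enough (E : sum_f_R0 (fun i => f (S (m - 1) + i)%nat) (m - 1) = f m + (sum_f_R0 f (m - 1) - f O)) by lra.
  destruct m as [|m]; [lia|]. simpl (S m - 1)%nat. rewrite Nat.sub_0_r.
  destruct m as [|m].
  - simpl. ring.
  - rewrite (decomp_sum f) by lia. simpl Nat.pred.
    rewrite (decomp_sum (fun i => f (S (S m) + i)%nat)) by lia. simpl Nat.pred.
    rewrite Nat.add_0_r.
    enough (E : sum_f_R0 (fun i => f (S (S m) + S i)%nat) m = sum_f_R0 (fun i => f (S i)) m) by (rewrite E; ring).
    rewrite <- (sum_n_Reals (fun i => f (S i))), <- sum_n_Reals.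
    revert Hf. clear. intros Hf.
    transitivity (sum_n (fun i => f (S (m - i))) m).
    + apply sum_n_ext_loc. intros i Hi. rewrite <- (Hf (S (m - i))) by lia. f_equal; lia.
    + rewrite !sum_n_Reals. clear.
      enough (G : forall g : nat -> R, sum_f_R0 (fun i => g (m - i)%nat) m = sum_f_R0 g m)
        by exact (G (fun i => f (S i))).
      intros g. induction m as [|m IH]; [reflexivity|].
      rewrite (decomp_sum (fun i => g (S m - i)%nat)) by lia. simpl Nat.pred.
      rewrite tech5, <- IH. simpl (S m - 0)%nat. simpl (S m - S _)%nat. ring.
Qed.

Lemma sin_bounds (t : R) : 0 < t < PI / 2 -> t * cos t <= sin t <= t /\ 0 < cos t /\ 0 < sin t.
Proof.
  intros Ht. assert (0 < cos t) by (apply cos_gt_0; lra).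
  assert (0 < sin t) by (apply sin_gt_0; pose proof PI_RGT_0; lra).
  repeat split; auto.
  - destruct (MVT_cor2 (fun x => sin x - x * cos x) (fun x => x * sin x) 0 t) as [c [Hc Hc']]; [lra| |].
    + intros c _. apply is_derive_Reals. auto_derive; auto. ring.
    + rewrite sin_0 in Hc. assert (0 < sin c) by (apply sin_gt_0; pose proof PI_RGT_0; lra). assert (0 < c * sin c * (t - 0)) by (repeat apply Rmult_lt_0_compat; lra). lra.
  - destruct (MVT_cor2 (fun x => x - sin x) (fun x => 1 - cos x) 0 t) as [c [Hc Hc']]; [lra| |].
    + intros c _. apply is_derive_Reals. auto_derive; auto. ring.
    + rewrite sin_0 in Hc. pose proof (COS_bound c). nra.
Qed.

Lemma coth_re_sin (w t : R) :
  coth_re (2 * w) (2 * t) = sinh w * cosh w / (sinh w ^ 2 + sin t ^ 2).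
Proof.
  unfold coth_re. rewrite sinh_double, cosh_double, cos_2a_sin.
  replace (1 + 2 * sinh w ^ 2 - (1 - 2 * sin t * sin t)) with (2 * (sinh w ^ 2 + sin t ^ 2)) by ring.
  (* When the denominator vanishes both sides are 0 by the convention on inverses. *)
  destruct (Req_dec (sinh w ^ 2 + sin t ^ 2) 0) as [E|E].
  - rewrite E. unfold Rdiv. rewrite Rmult_0_r, !Rinv_0. ring.
  - field. auto.
Qed.

(** Cleared of denominators, the inequality splits into a part with sinh^2, which follows from sinh
    w <= w cosh w, and a part with sin^2, which follows from sin t <= t and w <= sinh w. The loss 1
    / cosh w does not depend on t. *)
Lemma coth_re_lower (w t : R) :
  0 < w -> 0 < t < PI / 2 -> w / (w ^ 2 + t ^ 2) / cosh w <= coth_re (2 * w) (2 * t).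
Proof.
  intros Hw Ht. rewrite coth_re_sin.
  destruct (sin_bounds t Ht) as [[_ H1] [_ H2]].
  pose proof (sinh_ge w). pose proof (cosh_ge_1 w). pose proof (sinh_le_cosh w).
  assert (0 < sinh w) by lra.
  set (s := sinh w) in *. set (c := cosh w) in *. set (x := sin t) in *.
  assert (0 < w ^ 2 + t ^ 2) by nra. assert (0 < s ^ 2 + x ^ 2) by nra.
  replace (w / (w ^ 2 + t ^ 2) / c) with (w / ((w ^ 2 + t ^ 2) * c)) by (field; lra).
  apply Rle_div_l; [nra|].
  replace (s * c / (s ^ 2 + x ^ 2) * ((w ^ 2 + t ^ 2) * c))
    with ((s * c * ((w ^ 2 + t ^ 2) * c)) / (s ^ 2 + x ^ 2)) by (field; lra).
  apply Rle_div_r; [nra|].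
  assert (x ^ 2 <= t ^ 2) by (apply pow_incr; lra).
  assert (w * s ^ 2 <= s * c * (w ^ 2 * c)).
  { replace (w * s ^ 2) with ((w * s) * s) by ring.
    replace (s * c * (w ^ 2 * c)) with ((w * s) * (w * c * c)) by ring.
    apply Rmult_le_compat_l; nra. }
  assert (w * x ^ 2 <= s * c * (t ^ 2 * c)).
  { apply Rle_trans with (s * t ^ 2); [apply Rmult_le_compat; nra|].
    replace (s * c * (t ^ 2 * c)) with ((s * t ^ 2) * (c * c)) by ring.
    assert (0 <= s * t ^ 2) by (apply Rmult_le_pos; nra). rewrite <- (Rmult_1_r (s * t ^ 2)) at 1. apply Rmult_le_compat_l; nra. }
  lra.
Qed.

(** The additive w bounds tanh w. In the average over all angles it contributes at most a fixed
    multiple of w, which tends to 0. *)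
Lemma coth_re_upper (w t : R) :
  0 < w -> 0 < t < PI / 2 -> coth_re (2 * w) (2 * t) <= w + cosh w * (w / (w ^ 2 + t ^ 2)).
Proof.
  intros Hw Ht. rewrite coth_re_sin.
  destruct (sin_bounds t Ht) as [[H0 H1] [H2 H3]].
  pose proof (sinh_ge w). pose proof (cosh_ge_1 w). pose proof (sinh_le_cosh w).
  pose proof (cosh_sq w) as Hcs. pose proof (sin2_cos2 t) as Hsc. unfold Rsqr in Hsc.
  assert (0 < sinh w) by lra.
  set (s := sinh w) in *. set (c := cosh w) in *. set (x := sin t) in *. set (y := cos t) in *.
  assert (Hd : 0 < s ^ 2 + x ^ 2) by nra.
  assert (Hwt : 0 < w ^ 2 + t ^ 2) by nra.
  (* Subtracting tanh w = s / c leaves a remainder to which t cos t <= sin t applies. *)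
  assert (E : s * c / (s ^ 2 + x ^ 2) = s / c + s * y ^ 2 / (c * (s ^ 2 + x ^ 2))).
  { replace (y ^ 2) with (1 - x ^ 2) by nra.
    replace (s * c / (s ^ 2 + x ^ 2)) with (s * c ^ 2 / (c * (s ^ 2 + x ^ 2))) by (field; split; lra).
    rewrite Hcs. field. split; lra. }
  rewrite E. apply Rplus_le_compat.
  - apply Rle_div_l; nra.
  - apply Rle_div_l; [nra|].
    replace (c * (w / (w ^ 2 + t ^ 2)) * (c * (s ^ 2 + x ^ 2)))
      with (c ^ 2 * w * (s ^ 2 + x ^ 2) / (w ^ 2 + t ^ 2)) by (field; lra).
    apply (proj1 (Rle_div_r _ _ _ Hwt)).
    assert (A : (t * y) ^ 2 <= x ^ 2) by (apply pow_incr; nra).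
    assert (B : s * y ^ 2 * w ^ 2 <= c ^ 2 * w * s ^ 2).
    { replace (s * y ^ 2 * w ^ 2) with ((w * s) * (y ^ 2 * w)) by ring.
      replace (c ^ 2 * w * s ^ 2) with ((w * s) * (c ^ 2 * s)) by ring.
      apply Rmult_le_compat_l; [nra|].
      apply Rle_trans with (1 * w); [apply Rmult_le_compat_r; nra|].
      apply Rmult_le_compat; nra. }
    assert (D : s * y ^ 2 * t ^ 2 <= c ^ 2 * w * x ^ 2).
    { apply Rle_trans with (s * x ^ 2).
      - replace (s * y ^ 2 * t ^ 2) with (s * (t * y) ^ 2) by ring.
        apply Rmult_le_compat_l; lra.
      - apply Rmult_le_compat_r; [nra|]. nra. }
    lra.
Qed.

Definition coth_term (u : R) (k : nat) : R := 2 * u / (u ^ 2 + (PI * INR k) ^ 2).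

Lemma coth_re_0 (w : R) : 0 < w -> coth_re (2 * w) 0 = cosh w / sinh w.
Proof.
  intros Hw. replace 0 with (2 * 0) by ring. rewrite coth_re_sin, sin_0.
  pose proof (sinh_ge w). field. lra.
Qed.

(** After division by N = 2^(p+1), the folded sum has an end term coth w / N close to 1/u, a middle
    term with tanh w <= w, and interior terms whose main part w / (w^2 + t^2) rescales exactly to
    [coth_term u k]. The only losses are factors cosh w and multiples of w, where w = u / N. *)
Lemma coth_squeeze (p : nat) (u : R) :
  0 < u ->
  let w := u / 2 ^ S p in
  let X := sum_n_m (coth_term u) 1 (2 ^ p - 1) + / u in
  X / cosh w <= cosh u / sinh u <= 2 * w + cosh w * X.
Proof.
  intros Hu w X.
  assert (H2 : 0 < 2 ^ p) by (apply pow_lt; lra).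
  assert (HN : 0 < 2 ^ S p) by (apply pow_lt; lra).
  assert (Hw : 0 < w) by (apply Rdiv_lt_0_compat; auto).
  assert (Hn : (1 <= 2 ^ p)%nat) by (apply Nat.le_succ_l, Nat.neq_0_lt_0, Nat.pow_nonzero; lia).
  pose proof (coth_re_sum (S p) (2 * u) ltac:(lra)) as H.
  rewrite coth_re_0 in H by auto.
  set (f := fun k => coth_re (2 * w) (2 * (PI * INR k / 2 ^ S p))).
  rewrite sum_eq with (An := fun k => coth_re (2 * u / 2 ^ S p) (2 * PI * INR k / 2 ^ S p)) (Bn := f) in H.
  2:{ intros k _. unfold f, w. f_equal; field; lra. }
  change (2 ^ S p)%nat with (2 * 2 ^ p)%nat in H.
  rewrite sum_symmetric in H; [|intros k Hk|exact Hn].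
  2:{ unfold f, coth_re. f_equal. f_equal.
      rewrite minus_INR by lia. rewrite mult_INR, pow_INR. change (INR 2) with 2.
      replace (2 * (PI * (2 * 2 ^ p - INR k) / 2 ^ S p)) with (- (2 * (PI * INR k / 2 ^ S p)) + 2 * INR 1 * PI).
      - rewrite cos_period. apply cos_neg.
      - simpl; field; lra. }
  assert (E0 : f O = cosh w / sinh w).
  { unfold f. simpl INR. rewrite <- coth_re_0 by auto. f_equal. unfold Rdiv; ring. }
  assert (Em : f (2 ^ p)%nat = sinh w / cosh w).
  { unfold f. rewrite pow_INR. change (INR 2) with 2.
    replace (PI * 2 ^ p / 2 ^ S p) with (PI / 2) by (simpl; field; lra).
    rewrite coth_re_sin, sin_PI2. replace (sinh w ^ 2 + 1 ^ 2) with (cosh w ^ 2) by (rewrite cosh_sq; ring).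
    pose proof (cosh_ge_1 w). field. lra. }
  assert (Es : sum_f_R0 f (2 ^ p - 1) - f O = sum_n_m f 1 (2 ^ p - 1)).
  { rewrite <- sum_n_Reals. unfold sum_n. rewrite sum_Sn_m by lia. unfold plus; simpl. ring. }
  rewrite Es, E0, Em in H.
  pose proof (sinh_ge w) as S1. pose proof (cosh_ge_1 w) as S2. pose proof (sinh_le_cosh w) as S3.
  set (s := sinh w) in *. set (c := cosh w) in *.
  assert (Hth : 0 < s / c <= w).
  { split; [apply Rdiv_lt_0_compat; lra|]. apply Rle_div_l; lra. }
  assert (Ht : forall k, (1 <= k <= 2 ^ p - 1)%nat -> 0 < PI * INR k / 2 ^ S p < PI / 2).
  { intros k Hk. pose proof PI_RGT_0. split.
    - apply Rdiv_lt_0_compat; auto. apply Rmult_lt_0_compat; auto. apply lt_0_INR; lia.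
    - simpl. replace (PI * INR k / (2 * 2 ^ p)) with (PI / 2 * (INR k / 2 ^ p)) by (field; lra).
      rewrite <- (Rmult_1_r (PI / 2)) at 2. apply Rmult_lt_compat_l; [lra|].
      apply Rlt_div_l; auto. rewrite Rmult_1_l. replace (2 ^ p) with (INR (2 ^ p)) by (rewrite pow_INR; auto).
      apply lt_INR; lia. }
  assert (Eterm : forall k, 2 * (w / (w ^ 2 + (PI * INR k / 2 ^ S p) ^ 2)) = 2 ^ S p * coth_term u k).
  { intros k. unfold coth_term, w. pose proof (pow2_ge_0 (PI * INR k)).
    set (B := PI * INR k) in *. set (D := 2 ^ S p) in *.
    assert (0 < u ^ 2) by (apply pow_lt; lra).
    field. repeat split; try lra.
    }
  assert (HL : sum_n_m (fun k => 2 ^ S p * coth_term u k / (2 * c)) 1 (2 ^ p - 1)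
             <= sum_n_m f 1 (2 ^ p - 1)).
  { apply sum_n_m_le_loc. intros k Hk. unfold f.
    pose proof (coth_re_lower w _ Hw (Ht k Hk)) as L. fold c in L.
    rewrite <- Eterm. set (Q := w / (w ^ 2 + (PI * INR k / 2 ^ S p) ^ 2)) in *.
    replace (2 * Q / (2 * c)) with (Q / c) by (field; lra). exact L. }
  assert (HU : sum_n_m f 1 (2 ^ p - 1)
             <= sum_n_m (fun k => w + c / 2 * (2 ^ S p * coth_term u k)) 1 (2 ^ p - 1)).
  { apply sum_n_m_le_loc. intros k Hk. unfold f.
    pose proof (coth_re_upper w _ Hw (Ht k Hk)) as L. fold c in L.
    rewrite <- Eterm. lra. }
  rewrite sum_n_m_ext with (b := fun k => scal (2 ^ S p / (2 * c)) (coth_term u k)) in HL.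
  2:{ intros k. unfold scal; simpl; unfold mult; simpl. field. lra. }
  rewrite (sum_n_m_ext (fun k => w + c / 2 * (2 ^ S p * coth_term u k))
    (fun k => plus w (scal (c / 2 * 2 ^ S p) (coth_term u k)))) in HU.
  2:{ intros k. change (w + c / 2 * (2 ^ S p * coth_term u k) = w + (c / 2 * 2 ^ S p) * coth_term u k). ring. }
  rewrite sum_n_m_scal_l in HL. rewrite sum_n_m_plus, sum_n_m_const in HU.
  rewrite (sum_n_m_scal_l (c / 2 * 2 ^ S p) (coth_term u)) in HU.
  replace (S (2 ^ p - 1) - 1)%nat with (2 ^ p - 1)%nat in HU by lia.
  rewrite minus_INR, pow_INR in HU by lia. change (INR 2) with 2 in HU. change (INR 1) with 1 in HU.
  unfold scal, plus in HL, HU; simpl in HL, HU; unfold mult in HL, HU; simpl in HL, HU.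
  pose (P := sum_n_m (coth_term u) 1 (2 ^ p - 1) : R).
  pose (F := sum_n_m f 1 (2 ^ p - 1) : R).
  change (2 * 2 ^ p / (2 * c) * P <= F) in HL.
  change (F <= (2 ^ p - 1) * w + c / 2 * (2 * 2 ^ p) * P) in HU.
  change (2 ^ S p * (cosh u / sinh u) = c / s + s / c + 2 * F) in H.
  change X with (P + / u). clearbody P F. clear X.
  assert (Hcs : c / s <= 2 ^ S p / u * c).
  { replace (2 ^ S p / u) with (/ w) by (unfold w; field; lra).
    rewrite Rmult_comm. apply Rmult_le_compat_l; [lra|]. apply Rinv_le_contravar; lra. }
  assert (Hcs' : 2 ^ S p / u / c <= c / s).
  { replace (2 ^ S p / u) with (/ w) by (unfold w; field; lra).
    replace (/ w / c) with (/ (w * c)) by (field; lra).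
    apply Rle_trans with (/ s); [apply Rinv_le_contravar; lra|].
    unfold Rdiv. rewrite <- (Rmult_1_l (/ s)) at 1. apply Rmult_le_compat_r; [|lra].
    left; apply Rinv_0_lt_compat; lra. }
  assert (Heq : cosh u / sinh u = (c / s + s / c + 2 * F) / 2 ^ S p).
  { apply Rmult_eq_reg_l with (2 ^ S p); [|lra]. rewrite H. field. lra. }
  rewrite Heq. simpl in Hcs, Hcs' |- *. split.
  - apply (fun H => proj1 (Rle_div_r _ _ _ H)); [lra|].
    apply Rle_trans with (2 * 2 ^ p / u / c + 0 + 2 * (2 * 2 ^ p / (2 * c) * P)); [|lra].
    right. field. lra.
  - apply Rle_div_l; [lra|].
    apply Rle_trans with (2 * 2 ^ p / u * c + w + 2 * ((2 ^ p - 1) * w + c / 2 * (2 * 2 ^ p) * P)); [lra|].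
    assert (0 < w * 2 ^ p) by nra.
    replace ((2 * w + c * (P + / u)) * (2 * 2 ^ p)) with
      (4 * (w * 2 ^ p) + 2 * 2 ^ p / u * c + 2 * (c / 2 * (2 * 2 ^ p) * P)) by (field; lra).
    lra.
Qed.

(** Comparison with 1/k^2 gives convergence; the value is then read off along the partial sums of
    2^p - 1 terms, to which the squeeze applies. *)
Lemma coth_series (u : R) : 0 < u ->
  is_series (fun k => coth_term u (S k)) (cosh u / sinh u - / u).
Proof.
  intros Hu.
  assert (Hpos : forall k, 0 <= coth_term u k).
  { intros k. unfold coth_term. apply Rlt_le, Rdiv_lt_0_compat; [lra|].
    pose proof (pow2_ge_0 (PI * INR k)). nra. }
  assert (He : ex_series (fun k => coth_term u (S k))).
  { apply ex_series_Rle with (fun k => 2 * u / PI ^ 2 * / INR (S k) ^ 2).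
    - intros k. rewrite Rabs_pos_eq by auto. unfold coth_term.
      pose proof PI_RGT_0. pose proof (INR_S_pos k).
      replace (2 * u / PI ^ 2 * / INR (S k) ^ 2) with (2 * u / (PI * INR (S k)) ^ 2) by (field; lra).
      apply Rmult_le_compat_l; [lra|].
      assert (0 < PI * INR (S k)) by nra. apply Rinv_le_contravar; nra.
    - apply (@ex_series_scal R_AbsRing R_NormedModule (2 * u / PI ^ 2) (fun k => / INR (S k) ^ 2)). apply ex_series_inv_sq. }
  destruct (He : exists L : R, is_series (fun k => coth_term u (S k)) L) as [L HL].
  enough (cosh u / sinh u = L + / u) as -> by (replace (L + / u - / u) with L by ring; exact HL).
  assert (Hw : is_lim_seq (fun p => u / 2 ^ S p) 0).
  { apply is_lim_seq_ext with (fun p => u / 2 * (/ 2) ^ p).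
    - intros p. rewrite pow_inv. simpl. field. apply pow_nonzero; lra.
    - replace (Finite 0) with (Rbar_mult (u / 2) 0) by (simpl; f_equal; ring).
      apply is_lim_seq_scal_l. apply is_lim_seq_geom. rewrite Rabs_pos_eq; lra. }
  assert (Hc : is_lim_seq (fun p => cosh (u / 2 ^ S p)) 1).
  { rewrite <- cosh_0. apply is_lim_seq_continuous; [|exact Hw].
    apply derivable_continuous_pt, derivable_pt_cosh. }
  assert (HX : is_lim_seq (fun p => sum_n_m (coth_term u) 1 (2 ^ p - 1) + / u) (L + / u)).
  { apply is_lim_seq_plus'; [|apply is_lim_seq_const].
    (* The index p = 0 is dropped: there [sum_n_m] runs from 1 to 0 and is empty, whereas [sum_n]
       always has at least one term. *)
    apply is_lim_seq_incr_1.
    apply is_lim_seq_ext with (fun p => sum_n (fun k => coth_term u (S k)) (2 ^ S p - 2)).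
    - intros p. unfold sum_n. rewrite sum_n_m_S. f_equal.
      assert (1 <= 2 ^ p)%nat by (apply Nat.le_succ_l, Nat.neq_0_lt_0, Nat.pow_nonzero; lia).
      simpl; lia.
    - apply (is_lim_seq_subseq _ _ (fun p => 2 ^ S p - 2)%nat); [|exact HL].
      apply eventually_subseq. intros p.
      assert (1 <= 2 ^ p)%nat by (apply Nat.le_succ_l, Nat.neq_0_lt_0, Nat.pow_nonzero; lia).
      simpl. lia. }
  apply Rle_antisym.
  - apply (is_lim_seq_le (fun _ => cosh u / sinh u)
      (fun p => 2 * (u / 2 ^ S p) + cosh (u / 2 ^ S p) * (sum_n_m (coth_term u) 1 (2 ^ p - 1) + / u))
      (cosh u / sinh u) (L + / u)).
    + intros p. apply (coth_squeeze p u Hu).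
    + apply is_lim_seq_const.
    + replace (L + / u) with (2 * 0 + 1 * (L + / u)) by ring.
      apply is_lim_seq_plus'; [apply is_lim_seq_mult'; auto; apply is_lim_seq_const|].
      apply is_lim_seq_mult'; auto.
  - apply (is_lim_seq_le
      (fun p => (sum_n_m (coth_term u) 1 (2 ^ p - 1) + / u) / cosh (u / 2 ^ S p)) (fun _ => cosh u / sinh u)
      (L + / u) (cosh u / sinh u)).
    + intros p. apply (coth_squeeze p u Hu).
    + replace (L + / u) with ((L + / u) / 1) by (field; lra).
      apply is_lim_seq_div'; [exact HX|exact Hc|lra].
    + apply is_lim_seq_const.
Qed.

(** * Values of zeta at even integers and Bernoulli numbers *)

(* [zeta_even k] is zeta(2k), including zeta(0) = -1/2. *)
Definition zeta_even (k : nat) : R := match k with O => - (1 / 2) | S _ => zetaR (2 * k) end.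

Lemma is_series_geom_alternating (q : R) : 0 <= q < 1 ->
  is_series (fun j => 2 * ((-1) ^ j * q ^ S j)) (2 * q / (1 + q)) /\
  is_series (fun j => Rabs (2 * ((-1) ^ j * q ^ S j))) (2 * q / (1 - q)).
Proof.
  intros Hq. split.
  - apply is_series_ext with (fun j => scal (2 * q) ((- q) ^ j)).
    + intros j. change (2 * q * (- q) ^ j = 2 * ((-1) ^ j * q ^ S j)).
      replace (- q) with (-1 * q) by ring. rewrite Rpow_mult_distr. simpl; ring.
    + replace (2 * q / (1 + q)) with (scal (2 * q) (/ (1 - - q))).
      * apply @is_series_scal. apply is_series_geom. rewrite Rabs_Ropp, Rabs_pos_eq; lra.
      * unfold scal; simpl; unfold mult; simpl. unfold Rdiv. do 2 f_equal. ring.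
  - apply is_series_ext with (fun j => scal (2 * q) (q ^ j)).
    + intros j. rewrite !Rabs_mult, pow_1_abs, Rmult_1_l, (Rabs_pos_eq 2), Rabs_pos_eq; try lra.
      * change (2 * q * q ^ j = 2 * q ^ S j). simpl; ring.
      * apply pow_le; lra.
    + apply @is_series_scal. apply is_series_geom. rewrite Rabs_pos_eq; lra.
Qed.

(** Each partial fraction is a geometric series in q_m = (x / (2 pi m))^2, and exchanging the
    summations collects the values zeta(2j + 2). The bound x <= 1 keeps q_m below 1/4, so the
    absolute double series is dominated by the sum of 1/m^2. *)
Lemma coth_pseries (x : R) : 0 < x <= 1 ->
  is_series (fun j => 2 * (-1) ^ j * zeta_even (S j) / (2 * PI) ^ (2 * S j) * (x ^ 2) ^ S j)
    (x / 2 * (cosh (x / 2) / sinh (x / 2)) - 1).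
Proof.
  intros Hx.
  pose proof PI_RGT_0 as Hpi. pose proof PI2_1 as Hpi2.
  set (Q := x ^ 2 / (2 * PI) ^ 2).
  assert (HQ : 0 < Q <= / 4).
  { unfold Q. split; [apply Rdiv_lt_0_compat; apply pow_lt; lra|].
    apply (fun H => proj2 (Rle_div_l _ _ _ H)); [apply pow_lt; lra|]. nra. }
  set (q := fun i => Q * / INR (S i) ^ 2).
  assert (Hi : forall i, 0 < / INR (S i) ^ 2 <= 1).
  { intros i. pose proof (INR_S_ge1 i). split; [apply Rinv_0_lt_compat, pow_lt; lra|].
    rewrite <- Rinv_1. apply Rinv_le_contravar; [lra|]. nra. }
  assert (Hq : forall i, 0 < q i <= / 4) by (intros i; specialize (Hi i); unfold q; nra).
  set (a := fun i j => 2 * ((-1) ^ j * q i ^ S j)).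
  assert (Hg : forall i, is_series (a i) (2 * q i / (1 + q i)) /\
     is_series (fun j => Rabs (a i j)) (2 * q i / (1 - q i))).
  { intros i. apply is_series_geom_alternating. specialize (Hq i). lra. }
  destruct (fubini a) as (_ & _ & _ & HF).
  { intros i. eexists. apply (proj2 (Hg i)). }
  { apply ex_series_Rle with (2 := ex_series_inv_sq). intros i.
    rewrite (is_series_unique _ _ (proj2 (Hg i))).
    assert (0 < 2 * q i / (1 - q i)) by (apply Rdiv_lt_0_compat; specialize (Hq i); lra).
    rewrite Rabs_pos_eq by lra.
    apply (fun H => proj2 (Rle_div_l _ _ _ H)); [specialize (Hq i); lra|].
    assert (q i <= / 4 * / INR (S i) ^ 2) by (unfold q; apply Rmult_le_compat_r; [apply Rlt_le, Hi|lra]).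
    specialize (Hq i); specialize (Hi i). nra. }
  replace (Series (fun i => Series (a i))) with (x / 2 * (cosh (x / 2) / sinh (x / 2)) - 1) in HF.
  - revert HF. apply is_series_ext. intros j. unfold a, zeta_even.
    rewrite (Series_ext _ (fun i => (2 * (-1) ^ j * Q ^ S j) * / INR (S i) ^ (2 * S j))).
    + rewrite Series_scal_l. change (Series (fun n => / INR (S n) ^ (2 * S j))) with (zetaR (2 * S j)).
      assert (Q ^ S j = (x ^ 2) ^ S j * / (2 * PI) ^ (2 * S j)) as ->.
      { unfold Q, Rdiv. rewrite Rpow_mult_distr, pow_inv, <- (pow_mult (2 * PI)). reflexivity. }
      eqR. unfold Rdiv; ring.
    + intros i. unfold q. rewrite Rpow_mult_distr, pow_inv, <- pow_mult. ring.
  - symmetry. apply is_series_unique.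
    replace (x / 2 * (cosh (x / 2) / sinh (x / 2)) - 1) with
      (scal (x / 2) (cosh (x / 2) / sinh (x / 2) - / (x / 2))).
    2:{ unfold scal; simpl; unfold mult; simpl.
        pose proof (sinh_ge (x / 2)). field. lra. }
    apply is_series_ext with (fun i => scal (x / 2) (coth_term (x / 2) (S i))).
    + intros i. rewrite (is_series_unique _ _ (proj1 (Hg i))).
      unfold q, Q, coth_term. unfold scal; simpl AbsRing.sort; unfold mult; simpl AbsRing.sort.
      change (x / 2 * (2 * (x / 2) / ((x / 2) ^ 2 + (PI * INR (S i)) ^ 2)) =
       2 * (x ^ 2 / (2 * PI) ^ 2 * / INR (S i) ^ 2) / (1 + x ^ 2 / (2 * PI) ^ 2 * / INR (S i) ^ 2)).
      pose proof (INR_S_pos i).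
      assert (0 < PI * INR (S i)) by nra.
      field. repeat split; try lra; nra.
    + apply @is_series_scal. apply coth_series. lra.
Qed.

(* The Taylor coefficients of x / (e^x - 1). *)
Definition bern_coef (n : nat) : R :=
  if Nat.even n then (-1) ^ S (n / 2) * 2 * zeta_even (n / 2) / (2 * PI) ^ n
  else if Nat.eqb n 1 then - (1 / 2) else 0.

Lemma bern_coef_even (k : nat) :
  bern_coef (2 * k) = (-1) ^ S k * 2 * zeta_even k / (2 * PI) ^ (2 * k).
Proof.
  unfold bern_coef. rewrite Nat.even_mul. simpl (Nat.even 2 || _)%bool.
  replace (2 * k / 2)%nat with k; [reflexivity|].
  rewrite Nat.mul_comm, Nat.div_mul; lia.
Qed.

Lemma bern_coef_odd (k : nat) :
  bern_coef (2 * k + 1) = if Nat.eqb k 0 then - (1 / 2) else 0.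
Proof.
  unfold bern_coef. rewrite Nat.even_add, Nat.even_mul.
  destruct k; [reflexivity|]. cbn [Nat.even orb Bool.eqb].
  destruct (Nat.eqb_spec (2 * S k + 1) 1); [lia|reflexivity].
Qed.

Lemma bern_gen_pos (x : R) : 0 < x <= 1 ->
  is_series (fun k => bern_coef (2 * k) * (x ^ 2) ^ k)
    (x / 2 * (cosh (x / 2) / sinh (x / 2))).
Proof.
  intros Hx.
  replace (x / 2 * (cosh (x / 2) / sinh (x / 2))) with
    (plus (x / 2 * (cosh (x / 2) / sinh (x / 2)) - 1) (bern_coef (2 * 0) * (x ^ 2) ^ 0)).
  2:{ rewrite bern_coef_even. unfold plus; simpl. lra. }
  apply @is_series_decr_1. unfold plus, opp; simpl.
  match goal with |- is_series _ ?l => replace l with (x / 2 * (cosh (x / 2) / sinh (x / 2)) - 1) by ring end.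
  eapply is_series_ext; [|apply coth_pseries, Hx].
  intros j. change (2 * (-1) ^ j * zeta_even (S j) / (2 * PI) ^ (2 * S j) * (x ^ 2) ^ S j
    = bern_coef (2 * S j) * (x ^ 2) ^ S j).
  rewrite bern_coef_even. simpl ((-1) ^ S (S j)). unfold Rdiv; ring.
Qed.

Lemma sinh_exp (x : R) : 2 * sinh (x / 2) * exp (x / 2) = exp x - 1.
Proof.
  unfold sinh. replace x with (x / 2 + x / 2) at 4 by field.
  rewrite exp_plus.
  assert (exp (x / 2) * exp (- (x / 2)) = 1) by (rewrite <- exp_plus, Rplus_opp_r; apply exp_0).
  nra.
Qed.

(** x / (e^x - 1) = (x/2) coth(x/2) - x/2: the even part is the series just found, extended to x < 0
    by parity, and the odd part is the single coefficient -1/2. *)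
Lemma bern_gen (x : R) : x <> 0 -> Rabs x <= 1 ->
  is_pseries bern_coef x (x / (exp x - 1)).
Proof.
  intros Hx Hx1.
  assert (Hs : sinh (x / 2) <> 0).
  { intros E. apply Hx.
    destruct (Rtotal_order x 0) as [H|[H|H]]; auto.
    - pose proof (sinh_ge (- x / 2)). replace (- x / 2) with (- (x / 2)) in H0 by field.
      assert (sinh (- (x / 2)) = - sinh (x / 2)) by (unfold sinh; rewrite Ropp_involutive; field). lra.
    - pose proof (sinh_ge (x / 2)). lra. }
  replace (x / (exp x - 1)) with
    (x / 2 * (cosh (x / 2) / sinh (x / 2)) + x * (- (1 / 2))).
  2:{ rewrite <- sinh_exp. pose proof (exp_pos (x / 2)).
      transitivity (x / 2 * (exp (- (x / 2)) / sinh (x / 2))).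
      - assert (cosh (x / 2) = sinh (x / 2) + exp (- (x / 2))) as -> by (unfold sinh, cosh; field).
        field. exact Hs.
      - rewrite exp_Ropp. field. lra. }
  apply is_pseries_odd_even.
  - apply is_pseries_R.
    destruct (Rlt_le_dec 0 x) as [H|H].
    + apply bern_gen_pos. rewrite Rabs_pos_eq in Hx1; lra.
    + rewrite Rabs_left1 in Hx1 by lra.
      replace (x ^ 2) with ((- x) ^ 2) by ring.
      replace (x / 2 * (cosh (x / 2) / sinh (x / 2))) with
        (- x / 2 * (cosh (- x / 2) / sinh (- x / 2))).
      * apply bern_gen_pos. lra.
      * replace (- x / 2) with (- (x / 2)) by field.
        assert (sinh (- (x / 2)) = - sinh (x / 2)) as -> by (unfold sinh; rewrite Ropp_involutive; field).
        assert (cosh (- (x / 2)) = cosh (x / 2)) as -> by (unfold cosh; rewrite Ropp_involutive; field).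
        field. exact Hs.
  - apply is_pseries_R.
    replace (- (1 / 2)) with (plus 0 (bern_coef (2 * 0 + 1) * (x ^ 2) ^ 0)).
    2:{ rewrite bern_coef_odd. unfold plus; simpl. ring. }
    apply @is_series_decr_1.
    rewrite bern_coef_odd. unfold plus, opp; simpl.
    match goal with |- is_series _ ?l => replace l with 0 by ring end.
    apply (is_series_zero (K := R_AbsRing) (V := R_NormedModule)). intros n.
    change (bern_coef (2 * S n + 1) * (x ^ 2) ^ S n = 0). rewrite bern_coef_odd.
    simpl Nat.eqb. cbv iota. ring.
Qed.

Lemma CV_radius_ge (a : nat -> R) (x : R) : ex_pseries a x -> Rbar_le (Rabs x) (CV_radius a).
Proof.
  intros H. apply Rbar_not_lt_le. intros Hlt.
  apply (CV_disk_outside a x Hlt). apply ex_series_lim_0. now apply ex_pseries_R.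
Qed.

(** The Cauchy product with the series of (e^x - 1)/x is the constant 1; its coefficient of positive
    degree N vanishes. *)
Lemma bern_convolution (N : nat) : (1 <= N)%nat ->
  sum_f_R0 (fun j => bern_coef j * / INR (fact (S (N - j)))) N = 0.
Proof.
  intros HN.
  set (e := fun j => / INR (fact (S j))).
  assert (Hb : Rbar_le 1 (CV_radius bern_coef)).
  { replace 1 with (Rabs 1) by (rewrite Rabs_pos_eq; lra). apply CV_radius_ge.
    eexists. apply bern_gen; [lra|]. rewrite Rabs_pos_eq; lra. }
  assert (Hexp : forall x, x <> 0 -> is_pseries e x ((exp x - 1) / x)).
  { intros x Hx. pose proof (is_exp_Reals x) as H.
    apply (is_pseries_decr_1 (fun n => / INR (fact n)) x (/ x)) in H.
    - unfold PS_decr_1 in H. unfold e.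
      replace ((exp x - 1) / x) with (scal (/ x) (plus (exp x) (opp (/ INR (fact 0))))); [exact H|].
      unfold scal, plus, opp; simpl; unfold mult; simpl. field. exact Hx.
    - unfold mult, one; simpl. now rewrite Rinv_l. }
  assert (He : Rbar_le 1 (CV_radius e)).
  { replace 1 with (Rabs 1) by (rewrite Rabs_pos_eq; lra). apply CV_radius_ge.
    eexists. apply Hexp. lra. }
  assert (Hin : forall (a : nat -> R) x, Rbar_le 1 (CV_radius a) -> Rabs x < 1 -> Rbar_lt (Rabs x) (CV_radius a)).
  { intros a x Ha Hx. apply Rbar_lt_le_trans with (Finite 1); [exact Hx|exact Ha]. }
  assert (Hmul : forall x, x <> 0 -> Rabs x < 1 -> is_pseries (PS_mult bern_coef e) x 1).
  { intros x Hx Hx1.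
    replace 1 with (x / (exp x - 1) * ((exp x - 1) / x)).
    - apply is_pseries_mult; [apply bern_gen; lra|now apply Hexp|now apply Hin|now apply Hin].
    - assert (exp x - 1 <> 0).
      { intros E. destruct (Rtotal_order x 0) as [H|[H|H]]; [|lra|].
        - assert (exp x < 1) by (rewrite <- exp_0; now apply exp_increasing). lra.
        - assert (1 < exp x) by (rewrite <- exp_0; now apply exp_increasing). lra. }
      field. split; auto. }
  set (d := fun n : nat => if Nat.eqb n 0 then 1 else 0).
  assert (Hd : forall x, is_pseries d x 1).
  { intros x. apply is_pseries_R.
    replace 1 with (plus 0 (d O * x ^ 0)) by (unfold plus, d; simpl; ring).
    apply @is_series_decr_1. unfold plus, opp, d; simpl.
    match goal with |- is_series _ ?l => replace l with 0 by ring end.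
    apply (is_series_zero (K := R_AbsRing) (V := R_NormedModule)). intros n.
    change (0 * x ^ S n = 0). ring. }
  assert (E : PS_mult bern_coef e N = d N).
  { apply PSeries_ext_recip.
    - apply Rbar_lt_le_trans with (Finite (/ 2)); [simpl; lra|].
      replace (/ 2) with (Rabs (/ 2)) by (rewrite Rabs_pos_eq; lra). apply CV_radius_ge.
      exists 1. apply Hmul; [lra|]. rewrite Rabs_pos_eq; lra.
    - apply Rbar_lt_le_trans with (Finite 1); [simpl; lra|].
      replace 1 with (Rabs 1) by (rewrite Rabs_pos_eq; lra). apply CV_radius_ge.
      exists 1. apply Hd.
    - exists (mkposreal 1 Rlt_0_1). intros x Hx.
      (* At x = 0 the quotients lose their meaning, so the constant coefficients are compared
         directly. *)
      destruct (Req_dec x 0) as [->|Hx0].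
      + rewrite !PSeries_0. unfold PS_mult, d, e. simpl.
        change O with (2 * 0)%nat at 1. rewrite bern_coef_even. simpl. field.
      + rewrite (is_pseries_unique _ _ _ (Hd x)). apply is_pseries_unique, Hmul; auto.
        unfold ball in Hx; simpl in Hx; unfold AbsRing_ball in Hx; simpl in Hx.
        unfold abs, minus, plus, opp in Hx; simpl in Hx. now rewrite Ropp_0, Rplus_0_r in Hx. }
  unfold PS_mult, d, e in E. rewrite E. destruct N; [lia|reflexivity].
Qed.

(** Both sides obey one recursion: the convolution of order m + 1, multiplied by (m + 2)!, is
    [bernoulli_S]. *)
Lemma bernoulli_coef (n : nat) : bernoulli n = INR (fact n) * bern_coef n.
Proof.
  induction n as [n IH] using lt_wf_ind.
  destruct n as [|m].
  - rewrite bernoulli_0. change O with (2 * 0)%nat at 2. rewrite bern_coef_even. simpl. field.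
  - rewrite bernoulli_S.
    pose proof (bern_convolution (S m) ltac:(lia)) as H.
    rewrite tech5, Nat.sub_diag in H.
    rewrite (sum_eq _ (fun j => bern_coef j * / INR (fact (S (S m - j))) * INR (fact (m + 2)))).
    + rewrite <- scal_sum.
      replace (sum_f_R0 _ m) with (- (bern_coef (S m) * / INR (fact 1))) by lra.
      replace (m + 2)%nat with (S (S m)) by lia.
      rewrite (fact_simpl (S m)), mult_INR. simpl (INR (fact 1)).
      field. apply not_0_INR; lia.
    + intros j Hj. rewrite IH by lia. unfold Binomial.C.
      replace (m + 2 - j)%nat with (S (S m - j)) by lia.
      field. split; apply INR_fact_neq_0.
Qed.

Lemma bernoulli_even (k : nat) :
  bernoulli (2 * k) = INR (fact (2 * k)) * ((-1) ^ S k * 2 * zeta_even k / (2 * PI) ^ (2 * k)).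
Proof. now rewrite bernoulli_coef, bern_coef_even. Qed.

Lemma bernoulli_odd (n : nat) : (1 < n)%nat -> Nat.Odd n -> bernoulli n = 0.
Proof.
  intros Hn [k ->]. rewrite bernoulli_coef, bern_coef_odd.
  destruct k; [lia|]. simpl. ring.
Qed.

(** * Lambert series and reciprocity *)

Lemma is_series_finite {K : AbsRing} {V : NormedModule K} (a : nat -> V) (N : nat) :
  (forall i, (N < i)%nat -> a i = zero) -> is_series a (sum_n a N).
Proof.
  intros Ha. apply filterlim_ext_loc with (fun _ => sum_n a N); [|apply filterlim_const].
  exists N. intros n Hn. induction Hn as [|n Hn IH]; [reflexivity|].
  rewrite sum_Sn, <- IH, Ha by lia. now rewrite plus_zero_r.
Qed.

(** A partial sum up to index N is a geometric sum in q^(d+1) with as many terms as there are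
    multiples of d + 1 up to N + 1, namely the integer quotient of N + 1 by d + 1. *)
Lemma geom_multiples (q : R) (d : nat) : 0 < q < 1 ->
  is_series (fun k => if Nat.eqb (S k mod S d) 0 then q ^ S k else 0)
    (q ^ S d / (1 - q ^ S d)).
Proof.
  intros Hq. set (Q := q ^ S d).
  assert (HQ : 0 < Q < 1).
  { unfold Q; split; [apply pow_lt; lra|]. rewrite <- (pow1 (S d)).
    rewrite pow1. apply pow_lt_1_compat; [lra|lia]. }
  assert (Hs : forall N, sum_n (fun k => if Nat.eqb (S k mod S d) 0 then q ^ S k else 0) N =
    (Q - Q ^ S (S N / S d)) / (1 - Q)).
  { assert (Hstep : forall N, (if Nat.eqb (S N mod S d) 0 then q ^ S N else 0) =
      (Q ^ S (N / S d) - Q ^ S (S N / S d)) / (1 - Q)).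
    { intros N. destruct (Nat.eqb_spec (S N mod S d) 0) as [E|E].
      - pose proof (Nat.div_mod_eq (S N) (S d)) as H1.
        pose proof (Nat.div_mod_eq N (S d)) as H2.
        pose proof (Nat.mod_upper_bound N (S d) ltac:(lia)) as H3.
        rewrite E in H1.
        assert (H4 : (S N / S d = S (N / S d))%nat) by nia.
        rewrite H4. replace (q ^ S N) with (Q ^ S (N / S d)).
        + simpl. field. lra.
        + unfold Q. rewrite <- pow_mult. f_equal. nia.
      - pose proof (Nat.div_mod_eq (S N) (S d)) as H1.
        pose proof (Nat.div_mod_eq N (S d)) as H2.
        pose proof (Nat.mod_upper_bound N (S d) ltac:(lia)) as H3.
        pose proof (Nat.mod_upper_bound (S N) (S d) ltac:(lia)) as H5.
        assert (H4 : (S N / S d = N / S d)%nat) by nia.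
        rewrite H4. field. lra. }
    induction N as [|N IH].
    - rewrite sum_O, Hstep. rewrite (Nat.div_small 0 (S d)) by lia. rewrite pow_1. reflexivity.
    - rewrite sum_Sn, IH, Hstep. eqR. change (@plus R_AbelianMonoid) with Rplus. field. lra. }
  change (is_lim_seq (sum_n (fun k => if Nat.eqb (S k mod S d) 0 then q ^ S k else 0)) (Q / (1 - Q))).
  apply is_lim_seq_ext with (1 := fun N => eq_sym (Hs N)).
  replace (Q / (1 - Q)) with ((Q - 0) / (1 - Q)) by (unfold Rminus; now rewrite Ropp_0, Rplus_0_r).
  apply is_lim_seq_div'; [|apply is_lim_seq_const|lra].
  apply is_lim_seq_minus'; [apply is_lim_seq_const|].
  apply (is_lim_seq_subseq (fun m => Q ^ m) 0 (fun N => S (S N / S d))).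
  - intros P [M HM]. exists (M * S d)%nat. intros N HN. apply HM.
    apply Nat.le_trans with (S N / S d)%nat; [|lia].
    apply Nat.div_le_lower_bound; lia.
  - apply is_lim_seq_geom. rewrite Rabs_pos_eq; lra.
Qed.

Definition sigma_inv (n k : nat) : R :=
  sum_n_m (fun d => if Nat.eqb (k mod d) 0 then / INR d ^ n else 0) 1 k.

Definition coth_pi (t : R) : R := cosh (PI * t) / sinh (PI * t).

Lemma coth_pi_exp (t : R) : 0 < t ->
  coth_pi t = 1 + 2 * (exp (- (2 * PI * t)) / (1 - exp (- (2 * PI * t)))).
Proof.
  intros Ht. assert (Hp : 0 < PI * t) by (apply Rmult_lt_0_compat; [apply PI_RGT_0|auto]).
  unfold coth_pi, cosh, sinh.
  replace (- (2 * PI * t)) with (- (PI * t) + - (PI * t)) by ring. rewrite exp_plus, exp_Ropp.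
  assert (1 < exp (PI * t)) by (rewrite <- exp_0; now apply exp_increasing).
  set (e := exp (PI * t)) in *. assert (1 < e * e) by nra. field. repeat split; lra.
Qed.

Lemma coth_pi_series (t : R) : 0 < t ->
  is_series (fun m => 2 * t / (t ^ 2 + INR (S m) ^ 2)) (PI * coth_pi t - / t).
Proof.
  intros Ht. pose proof PI_RGT_0 as HPI.
  assert (Hp : 0 < PI * t) by nra.
  replace (PI * coth_pi t - / t) with (scal PI (cosh (PI * t) / sinh (PI * t) - / (PI * t))).
  - apply is_series_ext with (fun m => scal PI (coth_term (PI * t) (S m))).
    + intros m. change (PI * (2 * (PI * t) / ((PI * t) ^ 2 + (PI * INR (S m)) ^ 2)) =
        2 * t / (t ^ 2 + INR (S m) ^ 2)).
      pose proof (INR_S_pos m). field. split; nra.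
    + apply @is_series_scal. now apply coth_series.
  - change (PI * (cosh (PI * t) / sinh (PI * t) - / (PI * t)) = PI * coth_pi t - / t).
    unfold coth_pi. pose proof (sinh_ge (PI * t)). field. lra.
Qed.

(** The array carries q^k / d^n at the pairs with d dividing k. Its rows are geometric and give
    (coth(pi d y) - 1) / (2 d^n); its columns are finite and give sigma_{-n}(k) q^k. *)
Lemma lambert_series (n : nat) (y : R) : (2 <= n)%nat -> 0 < y ->
  ex_series (fun d => coth_pi (INR (S d) * y) / INR (S d) ^ n) /\
  is_series (fun k => sigma_inv n (S k) * exp (- (2 * PI * y)) ^ S k)
    ((Series (fun d => coth_pi (INR (S d) * y) / INR (S d) ^ n) - zetaR n) / 2).
Proof.
  intros Hn Hy. pose proof PI_RGT_0 as HPI.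
  set (q := exp (- (2 * PI * y))).
  assert (Hq : 0 < q < 1).
  { unfold q; split; [apply exp_pos|]. rewrite <- exp_0. apply exp_increasing. nra. }
  set (a := fun d k : nat => if Nat.eqb (S k mod S d) 0 then / INR (S d) ^ n * q ^ S k else 0).
  assert (Hd : forall d, 0 < / INR (S d) ^ n).
  { intros d. apply Rinv_0_lt_compat, pow_lt, INR_S_pos. }
  assert (Hqp : forall k, 0 < q ^ k) by (intros; apply pow_lt; lra).
  assert (Hqd : forall d, 0 < q ^ S d <= q).
  { intros d. split; auto. simpl.     assert (q ^ d <= 1) by (rewrite <- (pow1 d); apply pow_incr; lra). nra. }
  assert (Hrow : forall d, is_series (a d) (/ INR (S d) ^ n * (q ^ S d / (1 - q ^ S d)))).
  { intros d. apply is_series_ext with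
      (fun k => scal (/ INR (S d) ^ n) (if Nat.eqb (S k mod S d) 0 then q ^ S k else 0)).
    - intros k. unfold a. destruct (Nat.eqb _ _); [reflexivity|].
      change (/ INR (S d) ^ n * 0 = 0). ring.
    - apply @is_series_scal. now apply geom_multiples. }
  assert (Erow : forall d, Series (a d) = (coth_pi (INR (S d) * y) / INR (S d) ^ n - / INR (S d) ^ n) / 2).
  { intros d. rewrite (is_series_unique _ _ (Hrow d)).
    pose proof (INR_S_pos d).
    rewrite coth_pi_exp by nra.
    replace (exp (- (2 * PI * (INR (S d) * y)))) with (q ^ S d).
    - specialize (Hqd d). field. split; [apply pow_nonzero|]; lra.
    - unfold q. rewrite <- (Rpower_pow (S d)) by apply exp_pos. unfold Rpower. rewrite ln_exp.
      f_equal. ring. }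
  assert (Hex : ex_series (fun d => Series (a d))).
  { apply ex_series_Rle with (fun d => q / (1 - q) * / INR (S d) ^ n).
    - intros d. rewrite (is_series_unique _ _ (Hrow d)).
      specialize (Hqd d). specialize (Hd d).
      assert (0 < q ^ S d / (1 - q ^ S d) <= q / (1 - q)).
      { split; [apply Rdiv_lt_0_compat; lra|].
        apply Rmult_le_compat; try lra; [left; apply Rinv_0_lt_compat; lra|].
        apply Rinv_le_contravar; lra. }
      rewrite Rabs_pos_eq by nra. nra.
    - apply (@ex_series_scal R_AbsRing R_NormedModule (q / (1 - q)) (fun d => / INR (S d) ^ n)).
      now apply ex_series_inv_pow. }
  destruct (fubini_pos a) as [_ HF].
  { intros d k. unfold a. destruct (Nat.eqb _ _); [|lra].
    specialize (Hd d). specialize (Hqp (S k)). nra. }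
  { intros d. eexists. apply Hrow. }
  { exact Hex. }
  assert (Hcoth : ex_series (fun d => coth_pi (INR (S d) * y) / INR (S d) ^ n)).
  { apply ex_series_ext with (fun d => plus (scal 2 (Series (a d))) (/ INR (S d) ^ n)).
    - intros d. rewrite Erow.
      change (2 * ((coth_pi (INR (S d) * y) / INR (S d) ^ n - / INR (S d) ^ n) / 2) + / INR (S d) ^ n
        = coth_pi (INR (S d) * y) / INR (S d) ^ n). field. apply pow_nonzero. pose proof (INR_S_pos d); lra.
    - apply @ex_series_plus; [apply @ex_series_scal, Hex|now apply ex_series_inv_pow]. }
  split; [exact Hcoth|].
  replace ((Series (fun d => coth_pi (INR (S d) * y) / INR (S d) ^ n) - zetaR n) / 2)
    with (Series (fun d => Series (a d))).
  - revert HF. apply is_series_ext. intros k.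
    apply is_series_unique.
    replace (sigma_inv n (S k) * q ^ S k) with (sum_n (fun d => a d k) k).
    + apply (is_series_finite (K := R_AbsRing) (V := R_NormedModule)).
      intros d Hdk. unfold a. rewrite Nat.mod_small by lia. reflexivity.
    + unfold sigma_inv. rewrite <- sum_n_m_S. unfold sum_n.
      rewrite (sum_n_m_ext _ (fun d => mult (if Nat.eqb (S k mod S d) 0 then / INR (S d) ^ n else 0) (q ^ S k))).
      * now rewrite sum_n_m_mult_r.
      * intros d. unfold a. destruct (Nat.eqb _ _); [reflexivity|].
        change (0 = 0 * q ^ S k). ring.
  - rewrite (Series_ext _ _ Erow). unfold Rdiv at 1. rewrite Series_scal_r.
    rewrite Series_minus; [reflexivity|exact Hcoth|now apply ex_series_inv_pow].
Qed.

Lemma pow_diff_sum (x z : R) (q : nat) :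
  x ^ S q - z ^ S q = (x - z) * sum_n (fun i => z ^ i * x ^ (q - i)) q.
Proof.
  induction q as [|q IH]; [rewrite sum_O; simpl; ring|].
  rewrite sum_Sn. change (@plus R_AbelianMonoid) with Rplus.
  rewrite (sum_n_ext_loc _ (fun i => mult (z ^ i * x ^ (q - i)) x)).
  - unfold sum_n at 1. rewrite sum_n_m_mult_r.
    pose (s := sum_n (fun i => z ^ i * x ^ (q - i)) q : R).
    change (x ^ S (S q) - z ^ S (S q) = (x - z) * (s * x + z ^ S q * x ^ (S q - S q))).
    change (x ^ S q - z ^ S q = (x - z) * s) in IH.
    rewrite Nat.sub_diag, Rmult_plus_distr_l, <- Rmult_assoc, <- IH. simpl. ring.
  - intros i Hi. replace (S q - i)%nat with (S (q - i)) by lia.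
    change (z ^ i * x ^ S (q - i) = z ^ i * x ^ (q - i) * x). simpl; ring.
Qed.

Lemma is_series_inv_even (k : nat) : (1 <= k)%nat ->
  is_series (fun m => (/ INR (S m) ^ 2) ^ k) (zetaR (2 * k)).
Proof.
  intros Hk. apply is_series_ext with (fun m => / INR (S m) ^ (2 * k)).
  - intros m. now rewrite pow_inv, <- pow_mult.
  - apply Series_correct, ex_series_inv_pow. lia.
Qed.

(* After expanding coth into partial fractions and swapping the double series of the
   second term, the summand is a finite geometric sum in separated variables. *)
Lemma coth_pi_reciprocity (q : nat) (y : R) : 0 < y ->
  let r := S q in
  Series (fun d => coth_pi (INR (S d) * y) / INR (S d) ^ (2 * r + 1))
  - (- y ^ 2) ^ r * Series (fun d => coth_pi (INR (S d) * / y) / INR (S d) ^ (2 * r + 1))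
  = / PI * (zetaR (2 * r + 2) * / y - (- y ^ 2) ^ r * y * zetaR (2 * r + 2)
     + 2 * y * sum_n (fun i => (- y ^ 2) ^ i * zetaR (2 * (S (q - i))) * zetaR (2 * S i)) q).
Proof.
  intros Hy r. pose proof PI_RGT_0 as HPI.
  assert (Hr : (2 <= 2 * r + 1)%nat) by (unfold r; lia).
  assert (Hy' : 0 < / y) by now apply Rinv_0_lt_compat.
  set (X := fun d => / INR (S d) ^ 2).
  assert (HX : forall d, 0 < X d) by (intros; apply Rinv_0_lt_compat, pow_lt, INR_S_pos).
  (* Up to the index shift, K(d, m) = 2y / (d^2 y^2 + m^2). Summed over the second argument it
     yields coth at d y, summed over the first one coth at m / y, so both partial fraction
     expansions come from one kernel. *)
  set (K := fun d m => 2 * y / ((INR (S d) * y) ^ 2 + INR (S m) ^ 2)).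
  assert (HK : forall d m, 0 < K d m).
  { intros d m. unfold K. apply Rdiv_lt_0_compat; [lra|].
    apply Rplus_lt_0_compat; apply pow_lt; [apply Rmult_lt_0_compat|]; auto using INR_S_pos. }
  assert (HXp : forall d, X d ^ r = / INR (S d) ^ (2 * r)).
  { intros d. unfold X. now rewrite pow_inv, <- pow_mult. }
  assert (H1 : forall d, is_series (fun m => X d ^ r * K d m)
     (PI * (coth_pi (INR (S d) * y) / INR (S d) ^ (2 * r + 1)) - X d ^ S r * / y)).
  { intros d. pose proof (INR_S_pos d) as Hd.
    replace (PI * (coth_pi (INR (S d) * y) / INR (S d) ^ (2 * r + 1)) - X d ^ S r * / y)
      with (scal (/ INR (S d) ^ (2 * r + 1)) (PI * coth_pi (INR (S d) * y) - / (INR (S d) * y))).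
    - apply is_series_ext with (fun m => scal (/ INR (S d) ^ (2 * r + 1))
        (2 * (INR (S d) * y) / ((INR (S d) * y) ^ 2 + INR (S m) ^ 2))).
      + intros m. change (/ INR (S d) ^ (2 * r + 1) * (2 * (INR (S d) * y) /
          ((INR (S d) * y) ^ 2 + INR (S m) ^ 2)) = X d ^ r * K d m).
        rewrite HXp, pow_add, pow_1. unfold K. pose proof (INR_S_pos m).
        field. repeat split; try apply pow_nonzero; try nra.
      + apply @is_series_scal. apply coth_pi_series. nra.
    - change (/ INR (S d) ^ (2 * r + 1) * (PI * coth_pi (INR (S d) * y) - / (INR (S d) * y)) =
        PI * (coth_pi (INR (S d) * y) / INR (S d) ^ (2 * r + 1)) - X d ^ S r * / y).
      change (X d ^ S r) with (X d * X d ^ r). rewrite HXp, pow_add, pow_1. unfold X.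
      field. repeat split; try apply pow_nonzero; lra. }
  assert (H2 : forall d, is_series (fun m => X d ^ r * K m d)
     (PI * (coth_pi (INR (S d) * / y) / INR (S d) ^ (2 * r + 1)) - X d ^ S r * y)).
  { intros d. pose proof (INR_S_pos d) as Hd.
    replace (PI * (coth_pi (INR (S d) * / y) / INR (S d) ^ (2 * r + 1)) - X d ^ S r * y)
      with (scal (/ INR (S d) ^ (2 * r + 1)) (PI * coth_pi (INR (S d) * / y) - / (INR (S d) * / y))).
    - apply is_series_ext with (fun m => scal (/ INR (S d) ^ (2 * r + 1))
        (2 * (INR (S d) * / y) / ((INR (S d) * / y) ^ 2 + INR (S m) ^ 2))).
      + intros m. change (/ INR (S d) ^ (2 * r + 1) * (2 * (INR (S d) * / y) /
          ((INR (S d) * / y) ^ 2 + INR (S m) ^ 2)) = X d ^ r * K m d).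
        rewrite HXp, pow_add, pow_1. unfold K. pose proof (INR_S_pos m).
        assert (0 < INR (S m) * y) by nra.
        field. repeat split; try apply pow_nonzero; try nra.
      + apply @is_series_scal. apply coth_pi_series. nra.
    - change (/ INR (S d) ^ (2 * r + 1) * (PI * coth_pi (INR (S d) * / y) - / (INR (S d) * / y)) =
        PI * (coth_pi (INR (S d) * / y) / INR (S d) ^ (2 * r + 1)) - X d ^ S r * y).
      change (X d ^ S r) with (X d * X d ^ r). rewrite HXp, pow_add, pow_1. unfold X.
      field. repeat split; try apply pow_nonzero; lra. }
  assert (Hz : is_series (fun d => X d ^ S r) (zetaR (2 * r + 2))).
  { replace (2 * r + 2)%nat with (2 * S r)%nat by lia. apply is_series_inv_even. lia. }
  destruct (lambert_series (2 * r + 1) y Hr Hy) as [C1 _].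
  destruct (lambert_series (2 * r + 1) (/ y) Hr Hy') as [C2 _].
  set (S1 := Series (fun d => coth_pi (INR (S d) * y) / INR (S d) ^ (2 * r + 1))) in *.
  set (S2 := Series (fun d => coth_pi (INR (S d) * / y) / INR (S d) ^ (2 * r + 1))) in *.
  assert (G : forall (c : nat -> R) w s, is_series c s ->
     is_series (fun d => PI * c d - X d ^ S r * w) (PI * s - zetaR (2 * r + 2) * w)).
  { intros c w s Hc.
    replace (PI * s - zetaR (2 * r + 2) * w) with (plus (scal PI s) (scal (- w) (zetaR (2 * r + 2)))).
    - apply is_series_ext with (fun d => plus (scal PI (c d)) (scal (- w) (X d ^ S r))).
      + intros d. change (PI * c d + - w * X d ^ S r = PI * c d - X d ^ S r * w). ring.
      + apply @is_series_plus; apply @is_series_scal; assumption.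
    - change (PI * s + - w * zetaR (2 * r + 2) = PI * s - zetaR (2 * r + 2) * w). ring. }
  pose proof (G _ (/ y) S1 (Series_correct _ C1)) as T1. cbv beta in T1.
  pose proof (G _ y S2 (Series_correct _ C2)) as T2. cbv beta in T2.
  (* Reorders the second term so that in both terms the outer index is the first argument of K.
     Positivity suffices for this exchange. *)
  destruct (fubini_pos (fun d m => X d ^ r * K m d)) as [F1 F2].
  { intros d m. apply Rmult_le_pos; [apply pow_le|]; left; auto. }
  { intros d. eexists. apply H2. }
  { eexists. eapply is_series_ext; [|exact T2].
    intros d. symmetry. apply is_series_unique, H2. }
  rewrite (Series_ext (fun i => Series (fun j => X i ^ r * K j i)) _
    (fun d => is_series_unique _ _ (H2 d))), (is_series_unique _ _ T2) in F2.
  set (a := - y ^ 2) in *.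
  assert (Hfin : forall d m, X d ^ r * K d m - a ^ r * (X m ^ r * K d m) =
     sum_n (fun i => 2 * y * a ^ i * X d ^ S (q - i) * X m ^ S i) q).
  { intros d m.
    replace (X d ^ r * K d m - a ^ r * (X m ^ r * K d m)) with ((X d ^ r - (a * X m) ^ r) * K d m).
    2:{ rewrite Rpow_mult_distr. ring. }
    unfold r. rewrite pow_diff_sum.
    replace ((X d - a * X m) * sum_n (fun i => (a * X m) ^ i * X d ^ (q - i)) q * K d m) with
      (@mult R_Ring (2 * y * X d * X m) (sum_n (fun i => (a * X m) ^ i * X d ^ (q - i)) q)).
    - unfold sum_n. eapply eq_trans; [symmetry; apply (@sum_n_m_mult_l R_Ring)|]. apply sum_n_m_ext. intros i.
      change (2 * y * X d * X m * ((a * X m) ^ i * X d ^ (q - i)) =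
       2 * y * a ^ i * X d ^ S (q - i) * X m ^ S i).
      rewrite Rpow_mult_distr. simpl. ring.
    - change (@mult R_Ring) with Rmult.
      (* X d + y^2 X m is the denominator of K divided by the product of the two squares. This
         factor of the difference of r-th powers therefore cancels the denominator and leaves
         separated variables. *)
      set (s := sum_n _ q). assert (E : (X d - a * X m) * K d m = 2 * y * X d * X m).
      { unfold X, K, a. pose proof (INR_S_pos d). pose proof (INR_S_pos m). field.
        repeat split; nra. }
      eqR. rewrite <- E. ring. }
  assert (R1 : forall d, Series (fun m => X d ^ r * K d m) - a ^ r * Series (fun m => X m ^ r * K d m)
     = sum_n (fun i => 2 * y * a ^ i * X d ^ S (q - i) * zetaR (2 * S i)) q).
  { intros d.
    rewrite <- Series_scal_l, <- Series_minus.
    - rewrite (Series_ext _ _ (Hfin d)). apply is_series_unique.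
      replace (sum_n (fun i => 2 * y * a ^ i * X d ^ S (q - i) * zetaR (2 * S i)) q) with
        (sum_n (fun i => Series (fun m => 2 * y * a ^ i * X d ^ S (q - i) * X m ^ S i)) q).
      + apply sum_n_Series. intros i. apply (@ex_series_scal R_AbsRing R_NormedModule).
        eexists. apply is_series_inv_even. lia.
      + apply sum_n_ext. intros i. rewrite Series_scal_l. f_equal.
        apply is_series_unique, is_series_inv_even. lia.
    - eexists; apply H1.
    - apply (@ex_series_scal R_AbsRing R_NormedModule), F1. }
  assert (R2 : is_series (fun d => Series (fun m => X d ^ r * K d m) - a ^ r * Series (fun m => X m ^ r * K d m))
    (PI * S1 - zetaR (2 * r + 2) * / y - a ^ r * (PI * S2 - zetaR (2 * r + 2) * y))).
  { apply is_series_ext with (fun d => plus (Series (fun m => X d ^ r * K d m))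
      (scal (- a ^ r) (Series (fun m => X m ^ r * K d m)))).
    - intros d. change (Series (fun m => X d ^ r * K d m) + - a ^ r * Series (fun m => X m ^ r * K d m)
       = Series (fun m => X d ^ r * K d m) - a ^ r * Series (fun m => X m ^ r * K d m)). ring.
    - replace (PI * S1 - zetaR (2 * r + 2) * / y - a ^ r * (PI * S2 - zetaR (2 * r + 2) * y)) with
       (plus (PI * S1 - zetaR (2 * r + 2) * / y) (scal (- a ^ r) (PI * S2 - zetaR (2 * r + 2) * y))).
      + apply @is_series_plus; [|apply @is_series_scal; exact F2].
        eapply is_series_ext; [|exact T1]. intros d. symmetry. apply is_series_unique, H1.
      + change (PI * S1 - zetaR (2 * r + 2) * / y + - a ^ r * (PI * S2 - zetaR (2 * r + 2) * y) =
         PI * S1 - zetaR (2 * r + 2) * / y - a ^ r * (PI * S2 - zetaR (2 * r + 2) * y)). ring. }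
  assert (R3 : is_series (fun d => sum_n (fun i => 2 * y * a ^ i * X d ^ S (q - i) * zetaR (2 * S i)) q)
    (2 * y * sum_n (fun i => a ^ i * zetaR (2 * S (q - i)) * zetaR (2 * S i)) q)).
  { replace (2 * y * sum_n (fun i => a ^ i * zetaR (2 * S (q - i)) * zetaR (2 * S i)) q) with
      (sum_n (fun i => Series (fun d => 2 * y * a ^ i * X d ^ S (q - i) * zetaR (2 * S i))) q).
    - apply sum_n_Series. intros i.
      apply ex_series_scal_r. apply (@ex_series_scal R_AbsRing R_NormedModule).
      eexists. apply is_series_inv_even. lia.
    - change (2 * y * sum_n (fun i => a ^ i * zetaR (2 * S (q - i)) * zetaR (2 * S i)) q)
        with (@mult R_Ring (2 * y) (sum_n (fun i => a ^ i * zetaR (2 * S (q - i)) * zetaR (2 * S i)) q)).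
      unfold sum_n. symmetry. eapply eq_trans; [symmetry; apply (@sum_n_m_mult_l R_Ring)|]. apply sum_n_m_ext. intros i.
      rewrite Series_scal_r, Series_scal_l.
      assert (Series (fun n => X n ^ S (q - i)) = zetaR (2 * S (q - i))) as ->
        by (apply is_series_unique, is_series_inv_even; lia).
      change (2 * y * (a ^ i * zetaR (2 * S (q - i)) * zetaR (2 * S i)) =
        2 * y * a ^ i * zetaR (2 * S (q - i)) * zetaR (2 * S i)). ring. }
  pose proof (is_series_unique _ _ R2) as U2. rewrite (Series_ext _ _ R1) in U2.
  rewrite (is_series_unique _ _ R3) in U2.
  rewrite U2. field. lra.
Qed.

Open Scope C_scope.

(** * Complex series *)

(** Sums over canonical structures leave equalities at a carrier that [ring] and [field] do not
    recognise; this restores the type C. *)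
Ltac eqC := match goal with |- @eq _ ?x ?y => change (@eq C x y) end.

Definition is_cs (u : nat -> C) (l : C) : Prop := @is_series C_AbsRing C_NormedModule u l.

(** A total sum taken by components, through which results on the real [Series] transfer. On
    convergent series it agrees with the [iota]-based [Cseries], see [is_cs_unique] and
    [Cseries_is_cs]. *)
Definition CSeries (u : nat -> C) : C :=
  (Series (fun n => Re (u n)), Series (fun n => Im (u n))).

Lemma sum_n_C (u : nat -> C) (n : nat) :
  @sum_n C_AbelianMonoid u n = (sum_n (fun k => Re (u k)) n, sum_n (fun k => Im (u k)) n).
Proof.
  induction n as [|n IH]; [rewrite !sum_O; now destruct (u O)|].
  now rewrite !sum_Sn, IH.
Qed.

Lemma is_cs_components (u : nat -> C) (l : C) :
  is_cs u l <-> is_series (fun n => Re (u n)) (Re l) /\ is_series (fun n => Im (u n)) (Im l).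
Proof.
  split.
  - intros H. split; intros P [eps HP].
    + assert (HQ : locally (T := C_NormedModule) l (fun y : C => P (Re y))).
      { exists eps. intros y [Hy _]. now apply HP. }
      destruct (H _ HQ) as [N HN]. exists N. intros n Hn. specialize (HN n Hn).
      change (P (Re (@sum_n C_AbelianMonoid u n))) in HN. rewrite (sum_n_C u n) in HN. exact HN.
    + assert (HQ : locally (T := C_NormedModule) l (fun y : C => P (Im y))).
      { exists eps. intros y [_ Hy]. now apply HP. }
      destruct (H _ HQ) as [N HN]. exists N. intros n Hn. specialize (HN n Hn).
      change (P (Im (@sum_n C_AbelianMonoid u n))) in HN. rewrite (sum_n_C u n) in HN. exact HN.
  - intros [H1 H2] P [eps HP].
    destruct (H1 (fun y => ball (Re l) eps y)) as [N1 HN1]; [now exists eps|].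
    destruct (H2 (fun y => ball (Im l) eps y)) as [N2 HN2]; [now exists eps|].
    exists (N1 + N2)%nat. intros n Hn.
    change (P (@sum_n C_AbelianMonoid u n)). rewrite (sum_n_C u n).
    apply HP. split; [apply HN1|apply HN2]; lia.
Qed.

Lemma is_cs_unique (u : nat -> C) (l : C) : is_cs u l -> CSeries u = l.
Proof.
  intros H. apply is_cs_components in H as [H1 H2]. unfold CSeries.
  rewrite (is_series_unique _ _ H1), (is_series_unique _ _ H2). now destruct l.
Qed.

Lemma is_cs_ext (u v : nat -> C) (l : C) : (forall n, u n = v n) -> is_cs u l -> is_cs v l.
Proof. apply is_series_ext. Qed.

Lemma CSeries_ext (u v : nat -> C) : (forall n, u n = v n) -> CSeries u = CSeries v.
Proof. intros H. unfold CSeries. f_equal; apply Series_ext; intros n; now rewrite H. Qed.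

Lemma im_le_Cmod (c : C) : (Rabs (Im c) <= Cmod c)%R.
Proof. eapply Rle_trans; [apply Rmax_r|apply Rmax_Cmod]. Qed.

Lemma CSeries_correct (u : nat -> C) (b : nat -> R) :
  (forall n, Cmod (u n) <= b n)%R -> ex_series b -> is_cs u (CSeries u).
Proof.
  intros H Hb. apply is_cs_components; split; apply Series_correct;
    apply ex_series_Rle with b; auto; intros n;
    [apply Rle_trans with (1 := re_le_Cmod _)|apply Rle_trans with (1 := im_le_Cmod _)]; auto.
Qed.

Lemma Cmod_sum_n (u : nat -> C) (n : nat) :
  (Cmod (@sum_n C_AbelianMonoid u n) <= sum_n (fun k => Cmod (u k)) n)%R.
Proof.
  induction n as [|n IH]; [rewrite !sum_O; apply Rle_refl|].
  rewrite !sum_Sn. eapply Rle_trans; [apply Cmod_triangle|].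
  apply Rplus_le_compat_r, IH.
Qed.

Lemma is_cs_Cmod_le (u : nat -> C) (l : C) (b : nat -> R) :
  is_cs u l -> (forall n, Cmod (u n) <= b n)%R -> ex_series b -> (Cmod l <= Series b)%R.
Proof.
  intros Hu Hb Hex.
  assert (H : forall n, (Cmod (@sum_n C_AbelianMonoid u n) <= Series b)%R).
  { intros n. eapply Rle_trans; [apply Cmod_sum_n|].
    apply Rle_trans with (sum_n b n).
    - unfold sum_n. apply sum_n_m_le. auto.
    - apply sum_n_le_Series; auto. intros i. eapply Rle_trans; [apply Cmod_ge_0|apply Hb]. }
  apply (is_lim_seq_le (fun n => Cmod (@sum_n C_AbelianMonoid u n)) (fun _ => Series b) (Cmod l) (Series b));
    [exact H| |apply is_lim_seq_const].
  pose proof (filterlim_norm (K := C_AbsRing) (V := C_NormedModule) l) as Hn.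
  exact (filterlim_comp _ _ _ _ _ _ _ _ Hu Hn).
Qed.

Lemma is_cs_plus (u v : nat -> C) (l m : C) :
  is_cs u l -> is_cs v m -> is_cs (fun n => u n + v n) (l + m).
Proof. apply @is_series_plus. Qed.

Lemma is_cs_scal (c : C) (u : nat -> C) (l : C) :
  is_cs u l -> is_cs (fun n => c * u n) (c * l).
Proof. apply @is_series_scal. Qed.

Lemma is_cs_decr (u : nat -> C) (l : C) :
  is_cs (fun n => u (S n)) (l - u O) -> is_cs u l.
Proof. apply @is_series_decr_1. Qed.

Lemma is_cs_zero (u : nat -> C) : (forall n, u n = 0) -> is_cs u 0.
Proof. apply (is_series_zero (K := C_AbsRing) (V := C_NormedModule)). Qed.

Lemma is_cs_single (u : nat -> C) (j : nat) :
  (forall i, i <> j -> u i = 0) -> is_cs u (u j).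
Proof.
  revert u; induction j as [|j IH]; intros u Hu; apply is_cs_decr.
  - replace (u O - u O) with (RtoC 0) by ring. apply is_cs_zero. intros; apply Hu; lia.
  - rewrite (Hu O) by lia. replace (u (S j) - 0) with (u (S j)) by ring.
    apply (IH (fun n => u (S n))). intros i Hi. apply Hu; lia.
Qed.

Lemma is_cs_RtoC (u : nat -> R) (l : R) : is_series u l -> is_cs (fun n => RtoC (u n)) (RtoC l).
Proof.
  intros H. apply is_cs_components; split; [exact H|].
  apply (is_series_zero (K := R_AbsRing) (V := R_NormedModule)). reflexivity.
Qed.

(** The real theorem is applied to real and imaginary parts, both dominated by the modulus. *)
Lemma cfubini (a : nat -> nat -> C) :
  (forall k, ex_series (fun j => Cmod (a k j))) ->
  ex_series (fun k => Series (fun j => Cmod (a k j))) ->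
  (forall j, ex_series (fun k => Cmod (a k j))) /\
  is_series (fun j => Series (fun k => Cmod (a k j))) (Series (fun k => Series (fun j => Cmod (a k j)))) /\
  is_cs (fun j => CSeries (fun k => a k j)) (CSeries (fun k => CSeries (a k))).
Proof.
  intros H1 H2.
  destruct (fubini_pos (fun k j => Cmod (a k j))) as [H3 H4]; auto.
  { intros; apply Cmod_ge_0. }
  split; [exact H3|]. split; [exact H4|].
  assert (G : forall f : C -> R, (forall c, Rabs (f c) <= Cmod c)%R ->
     is_series (fun j => Series (fun k => f (a k j))) (Series (fun k => Series (fun j => f (a k j))))).
  { intros f Hf. apply (fubini (fun k j => f (a k j))).
    - intros k. apply ex_series_Rle with (2 := H1 k). intros j. rewrite Rabs_Rabsolu. apply Hf.
    - apply ex_series_Rle with (2 := H2). intros k.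
      rewrite Rabs_pos_eq.
      + apply Series_le; [|apply H1]. intros j; split; [apply Rabs_pos|apply Hf].
      + apply Series_pos; [intros; apply Rabs_pos|].
        apply ex_series_Rle with (2 := H1 k). intros j. rewrite Rabs_Rabsolu. apply Hf. }
  apply is_cs_components. split; [apply (G Re re_le_Cmod)|apply (G Im im_le_Cmod)].
Qed.

(** * Majorised power series *)

(* [maj f s0 r N]: on the closed disc |h| <= r, f(s0 + h) is a power series in h
   whose coefficients satisfy sum |a_j| r^j <= N. *)
Definition maj_coef (a : nat -> C) (f : C -> C) (s0 : C) (r N : R) : Prop :=
  ex_series (fun j => Cmod (a j) * r ^ j)%R /\
  (Series (fun j => Cmod (a j) * r ^ j) <= N)%R /\
  forall h, (Cmod h <= r)%R -> is_cs (fun j => a j * h ^ j) (f (s0 + h)).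

Definition maj (f : C -> C) (s0 : C) (r N : R) : Prop := exists a, maj_coef a f s0 r N.

Lemma Cmod_term_le (a h : C) (r : R) (j : nat) :
  (Cmod h <= r)%R -> (Cmod (a * h ^ j) <= Cmod a * r ^ j)%R.
Proof.
  intros H. rewrite Cmod_mult, Cmod_pow. apply Rmult_le_compat_l; [apply Cmod_ge_0|].
  apply pow_incr. split; [apply Cmod_ge_0|exact H].
Qed.

Lemma maj_bound (f : C -> C) (s0 h : C) (r N : R) :
  maj f s0 r N -> (Cmod h <= r)%R -> (Cmod (f (s0 + h)%C) <= N)%R.
Proof.
  intros [a [H1 [H2 H3]]] Hh. eapply Rle_trans; [|exact H2].
  apply is_cs_Cmod_le with (1 := H3 h Hh); auto.
  intros n. now apply Cmod_term_le.
Qed.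

Lemma maj_weaken (f : C -> C) (s0 : C) (r r' N N' : R) :
  (0 <= r' <= r)%R -> (N <= N')%R -> maj f s0 r N -> maj f s0 r' N'.
Proof.
  intros Hr HN [a [H1 [H2 H3]]]. exists a.
  assert (H : forall j, (0 <= Cmod (a j) * r' ^ j <= Cmod (a j) * r ^ j)%R).
  { intros j. pose proof (Cmod_ge_0 (a j)). split.
    - apply Rmult_le_pos; [auto|apply pow_le; lra].
    - apply Rmult_le_compat_l; [auto|apply pow_incr; lra]. }
  split; [|split].
  - apply ex_series_Rle with (2 := H1). intros j. rewrite Rabs_pos_eq; apply H.
  - eapply Rle_trans; [apply Series_le; [exact H|exact H1]|]. lra.
  - intros h Hh. apply H3. lra.
Qed.

Lemma maj_ext (f g : C -> C) (s0 : C) (r N : R) :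
  (forall s, f s = g s) -> maj f s0 r N -> maj g s0 r N.
Proof.
  intros H [a [H1 [H2 H3]]]. exists a. repeat split; auto.
  intros h Hh. rewrite <- H. auto.
Qed.

Lemma maj_const (c s0 : C) (r : R) : maj (fun _ => c) s0 r (Cmod c).
Proof.
  exists (fun j => match j with O => c | S _ => RtoC 0 end).
  assert (H : is_series (fun j => Cmod (match j with O => c | S _ => RtoC 0 end) * r ^ j)%R (Cmod c)).
  { replace (Cmod c) with (sum_n (fun j => Cmod (match j with O => c | S _ => RtoC 0 end) * r ^ j)%R 0).
    - apply (is_series_finite (K := R_AbsRing) (V := R_NormedModule)).
      intros [|i] Hi; [lia|]. rewrite Cmod_0. apply Rmult_0_l.
    - rewrite sum_O. simpl. eqR. ring. }
  split; [|split].
  - now exists (Cmod c).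
  - rewrite (is_series_unique _ _ H). lra.
  - intros h _.
    pose (u := fun j => match j with O => c | S _ => RtoC 0 end * h ^ j).
    replace c with (u O) at 1 by (unfold u; simpl; ring).
    apply (is_cs_single u). intros [|i] Hi; [easy|]. unfold u. ring.
Qed.

Lemma maj_plus (f g : C -> C) (s0 : C) (r N M : R) : (0 <= r)%R ->
  maj f s0 r N -> maj g s0 r M -> maj (fun s => f s + g s) s0 r (N + M).
Proof.
  intros Hr [a [A1 [A2 A3]]] [b [B1 [B2 B3]]]. exists (fun j => a j + b j).
  assert (H : forall j, (0 <= Cmod (a j + b j) * r ^ j <= Cmod (a j) * r ^ j + Cmod (b j) * r ^ j)%R).
  { intros j. pose proof (pow_le r j Hr). split; [apply Rmult_le_pos; [apply Cmod_ge_0|auto]|].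
    rewrite <- Rmult_plus_distr_r. apply Rmult_le_compat_r; [auto|apply Cmod_triangle]. }
  assert (E : ex_series (fun j => Cmod (a j) * r ^ j + Cmod (b j) * r ^ j)%R)
    by (apply @ex_series_plus; auto).
  split; [|split].
  - apply ex_series_Rle with (2 := E). intros j. rewrite Rabs_pos_eq; apply H.
  - eapply Rle_trans; [apply Series_le; [exact H|exact E]|]. rewrite Series_plus by auto. lra.
  - intros h Hh. apply is_cs_ext with (fun j => a j * h ^ j + b j * h ^ j); [intros; ring|].
    apply is_cs_plus; auto.
Qed.

(** With s = s0 + h the factor is c + be h, where c is its value at s0: the coefficients are scaled
    by c and added to their shift scaled by be, and the shift multiplies the l^1 norm by r. *)
Lemma maj_lin (f : C -> C) (s0 al be : C) (r N : R) : (0 <= r)%R ->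
  maj f s0 r N ->
  maj (fun s => (al + be * s) * f s) s0 r ((Cmod (al + be * s0) + Cmod be * r) * N).
Proof.
  intros Hr [a [A1 [A2 A3]]].
  set (c := al + be * s0).
  set (b := fun j => match j with O => RtoC 0 | S i => a i end).
  assert (B : is_series (fun j => Cmod (b j) * r ^ j)%R (r * Series (fun j => Cmod (a j) * r ^ j))%R).
  { apply @is_series_decr_1.
    match goal with |- is_series _ ?l => replace l with (r * Series (fun j => Cmod (a j) * r ^ j))%R end.
    2:{ unfold b. rewrite Cmod_0. unfold plus, opp; simpl. eqR. ring. }
    apply is_series_ext with (fun j => scal r (Cmod (a j) * r ^ j)%R).
    - intros j. change (r * (Cmod (a j) * r ^ j) = Cmod (a j) * (r * r ^ j))%R. ring.
    - apply @is_series_scal. now apply Series_correct. }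
  assert (H : forall j, (0 <= Cmod (c * a j + be * b j) * r ^ j <=
     Cmod c * (Cmod (a j) * r ^ j) + Cmod be * (Cmod (b j) * r ^ j))%R).
  { intros j. pose proof (pow_le r j Hr). split; [apply Rmult_le_pos; [apply Cmod_ge_0|auto]|].
    rewrite <- !Rmult_assoc, <- Rmult_plus_distr_r. apply Rmult_le_compat_r; [auto|].
    rewrite <- !Cmod_mult. apply Cmod_triangle. }
  assert (E : is_series (fun j => Cmod c * (Cmod (a j) * r ^ j) + Cmod be * (Cmod (b j) * r ^ j))%R
    (Cmod c * Series (fun j => Cmod (a j) * r ^ j) + Cmod be * (r * Series (fun j => Cmod (a j) * r ^ j)))%R).
  { apply @is_series_plus; apply @is_series_scal; auto. now apply Series_correct. }
  exists (fun j => c * a j + be * b j).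
  split; [|split].
  - apply ex_series_Rle with (2 := ex_intro _ _ E). intros j. rewrite Rabs_pos_eq; apply H.
  - eapply Rle_trans; [apply Series_le; [exact H|eexists; exact E]|].
    rewrite (is_series_unique _ _ E).
    replace (Cmod c * Series (fun j => Cmod (a j) * r ^ j) + Cmod be * (r * Series (fun j => Cmod (a j) * r ^ j)))%R
      with ((Cmod c + Cmod be * r) * Series (fun j => Cmod (a j) * r ^ j))%R by ring.
    apply Rmult_le_compat_l; [|exact A2].
    pose proof (Cmod_ge_0 c). pose proof (Cmod_ge_0 be). nra.
  - intros h Hh.
    replace ((al + be * (s0 + h)) * f (s0 + h)) with (c * f (s0 + h) + be * (h * f (s0 + h)))
      by (unfold c; ring).
    apply is_cs_ext with (fun j => c * (a j * h ^ j) + be * (b j * h ^ j)); [intros; ring|].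
    apply is_cs_plus; apply is_cs_scal; auto.
    apply is_cs_decr. replace (h * f (s0 + h) - b O * h ^ 0) with (h * f (s0 + h)) by (unfold b; simpl; ring).
    apply is_cs_ext with (fun j => h * (a j * h ^ j)); [intros j; unfold b; simpl; ring|].
    now apply is_cs_scal, A3.
Qed.

Lemma maj_scal (c : C) (f : C -> C) (s0 : C) (r N : R) : (0 <= r)%R ->
  maj f s0 r N -> maj (fun s => c * f s) s0 r (Cmod c * N).
Proof.
  intros Hr H. apply (maj_lin f s0 c 0 r N Hr) in H.
  replace (c + 0 * s0) with c in H by ring. rewrite Cmod_0, Rmult_0_l, Rplus_0_r in H.
  revert H. apply maj_ext. intros s. ring.
Qed.

Lemma maj_shift (f : C -> C) (c s0 : C) (r N : R) :
  maj f (s0 + c) r N -> maj (fun s => f (s + c)) s0 r N.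
Proof.
  intros [a [A1 [A2 A3]]]. exists a. repeat split; auto.
  intros h Hh. replace (s0 + h + c) with (s0 + c + h) by ring. auto.
Qed.

(** Weierstrass' theorem on the level of coefficients: the double series over functions and degrees
    converges absolutely at radius r, hence can be rearranged by degree for every h in the disc. *)
Lemma maj_series (f : nat -> C -> C) (s0 : C) (r : R) (N : nat -> R) : (0 < r)%R ->
  (forall k, maj (f k) s0 r (N k)) -> ex_series N ->
  maj (fun s => CSeries (fun k => f k s)) s0 r (Series N).
Proof.
  intros Hr Hf HN.
  (* The coefficient sequences of all the functions have to be chosen simultaneously. *)
  pose (w := fun k => constructive_indefinite_description _ (Hf k)).
  pose (a := fun k => proj1_sig (w k)).
  assert (Ha : forall k, maj_coef (a k) (f k) s0 r (N k)) by (intros k; apply (proj2_sig (w k))).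
  clearbody a. clear w.
  assert (HN0 : forall k, (0 <= Series (fun j => Cmod (a k j) * r ^ j) <= N k)%R).
  { intros k. destruct (Ha k) as [A1 [A2 A3]]. split; [|exact A2].
    apply Series_pos; [|exact A1]. intros j. apply Rmult_le_pos; [apply Cmod_ge_0|apply pow_le; lra]. }
  assert (F : forall h, (Cmod h <= r)%R ->
    (forall k, ex_series (fun j => Cmod (a k j * h ^ j))) /\
    ex_series (fun k => Series (fun j => Cmod (a k j * h ^ j)))).
  { intros h Hh.
    assert (G : forall k, ex_series (fun j => Cmod (a k j * h ^ j))).
    { intros k. destruct (Ha k) as [A1 _]. apply ex_series_Rle with (2 := A1).
      intros j. rewrite Rabs_pos_eq by apply Cmod_ge_0. now apply Cmod_term_le. }
    split; [exact G|].
    apply ex_series_Rle with (2 := HN). intros k.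
    destruct (Ha k) as [A1 [A2 _]].
    rewrite Rabs_pos_eq by (apply Series_pos; [intros; apply Cmod_ge_0|auto]).
    eapply Rle_trans; [|exact A2]. apply Series_le; [|exact A1].
    intros j; split; [apply Cmod_ge_0|]. now apply Cmod_term_le. }
  assert (Er : forall k j, Cmod (a k j * RtoC r ^ j) = (Cmod (a k j) * r ^ j)%R).
  { intros k j. rewrite Cmod_mult, Cmod_pow, Cmod_R, Rabs_pos_eq by lra. reflexivity. }
  destruct (F (RtoC r)) as [F1 F2].
  { rewrite Cmod_R, Rabs_pos_eq; lra. }
  destruct (cfubini (fun k j => a k j * RtoC r ^ j) F1 F2) as [F3 [F4 _]].
  set (b := fun j => CSeries (fun k => a k j)).
  assert (Hcol : forall j, ex_series (fun k => Cmod (a k j))).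
  { intros j. pose proof (pow_lt r j Hr) as Hp.
    apply ex_series_ext with (fun k => scal (/ r ^ j)%R (Cmod (a k j * RtoC r ^ j))).
    - intros k. rewrite Er. change (/ r ^ j * (Cmod (a k j) * r ^ j) = Cmod (a k j))%R. field. lra.
    - apply @ex_series_scal, F3. }
  assert (Hb : forall j, is_cs (fun k => a k j) (b j)).
  { intros j. apply CSeries_correct with (fun k => Cmod (a k j)); auto. intros; apply Rle_refl. }
  assert (Hbr : forall j, (0 <= Cmod (b j) * r ^ j <= Series (fun k => Cmod (a k j * RtoC r ^ j)))%R).
  { intros j. pose proof (pow_lt r j Hr) as Hp.
    split; [apply Rmult_le_pos; [apply Cmod_ge_0|lra]|].
    rewrite (Series_ext _ (fun k => Cmod (a k j) * r ^ j)%R) by (intros; apply Er).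
    rewrite Series_scal_r. apply Rmult_le_compat_r; [lra|].
    apply is_cs_Cmod_le with (1 := Hb j); auto. intros; apply Rle_refl. }
  exists b. split; [|split].
  - apply ex_series_Rle with (2 := ex_intro _ _ F4). intros j. rewrite Rabs_pos_eq; apply Hbr.
  - eapply Rle_trans; [apply Series_le; [exact Hbr|eexists; exact F4]|].
    rewrite (is_series_unique _ _ F4). apply Series_le; [|exact HN].
    intros k. rewrite (Series_ext _ (fun j => Cmod (a k j) * r ^ j)%R) by (intros; apply Er). auto.
  - intros h Hh. destruct (F h Hh) as [G1 G2].
    destruct (cfubini (fun k j => a k j * h ^ j) G1 G2) as [_ [_ G3]].
    rewrite (CSeries_ext _ (fun k => CSeries (fun j => a k j * h ^ j))).
    + revert G3. apply is_cs_ext. intros j. apply is_cs_unique.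
      rewrite Cmult_comm. apply is_cs_ext with (fun k => h ^ j * a k j); [intros; ring|].
      apply is_cs_scal, Hb.
    + intros k. symmetry. apply is_cs_unique. now apply (Ha k).
Qed.

Lemma maj_series_correct (f : nat -> C -> C) (s0 : C) (r : R) (N : nat -> R) :
  (forall k, maj (f k) s0 r (N k)) -> ex_series N ->
  forall h, (Cmod h <= r)%R -> is_cs (fun k => f k (s0 + h)) (CSeries (fun k => f k (s0 + h))).
Proof.
  intros Hf HN h Hh. apply CSeries_correct with (2 := HN).
  intros k. now apply maj_bound with r.
Qed.

Lemma pow_n_Cpow (h : C) (k : nat) : @pow_n C_AbsRing h k = h ^ k.
Proof. induction k as [|k IH]; [reflexivity|]. simpl. now rewrite IH. Qed.

Lemma is_pseries_C (a : nat -> C) (h l : C) :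
  @is_pseries C_AbsRing C_NormedModule a h l <-> is_cs (fun j => a j * h ^ j) l.
Proof.
  assert (E : forall n, @scal C_AbsRing C_NormedModule (@pow_n C_AbsRing h n) (a n) = a n * h ^ n).
  { intros n. change (@pow_n C_AbsRing h n * a n = a n * h ^ n). rewrite pow_n_Cpow. ring. }
  unfold is_pseries, is_cs. split; intros H; refine (is_series_ext _ _ _ _ H); intros n;
    [apply E|symmetry; apply E].
Qed.

Lemma maj_analytic (f : C -> C) (s0 : C) (r N : R) : (0 < r)%R -> maj f s0 r N -> analytic_at f s0.
Proof.
  intros Hr [a [_ [_ A3]]]. exists a, (mkposreal r Hr). intros z Hz. simpl in Hz.
  apply is_pseries_C. assert (f z = f (s0 + (z - s0))) as -> by (f_equal; ring). apply A3. lra.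
Qed.

(** Convergence at the one point p = 3r/4 bounds |a_j| p^j; at radius r/2 the coefficients are then
    dominated by a geometric series of ratio 2/3. *)
Lemma analytic_maj (f : C -> C) (s0 : C) :
  analytic_at f s0 -> exists r N, (0 < r)%R /\ maj f s0 r N.
Proof.
  intros [a [r Ha]]. pose proof (cond_pos r) as Hr.
  set (p := (3 / 4 * r)%R).
  assert (Hp : is_cs (fun j => a j * RtoC p ^ j) (f (s0 + RtoC p))).
  { apply is_pseries_C. pose proof (Ha (s0 + RtoC p)) as H.
    replace (s0 + RtoC p - s0) with (RtoC p) in H by ring. apply H.
    rewrite Cmod_R, Rabs_pos_eq; unfold p; lra. }
  assert (Hbd : exists B, forall j, (Cmod (a j) * p ^ j <= B)%R).
  { apply is_cs_components in Hp as [P1 P2].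
    destruct (ex_series_lim_0 _ (ex_intro _ _ P1) (fun y => Rabs y <= 1)%R) as [N1 H1].
    { exists (mkposreal 1 Rlt_0_1). intros y Hy. unfold ball in Hy; simpl in Hy; unfold AbsRing_ball in Hy; simpl in Hy.
      unfold abs, minus, plus, opp in Hy; simpl in Hy. rewrite Ropp_0, Rplus_0_r in Hy. lra. }
    destruct (ex_series_lim_0 _ (ex_intro _ _ P2) (fun y => Rabs y <= 1)%R) as [N2 H2].
    { exists (mkposreal 1 Rlt_0_1). intros y Hy. unfold ball in Hy; simpl in Hy; unfold AbsRing_ball in Hy; simpl in Hy.
      unfold abs, minus, plus, opp in Hy; simpl in Hy. rewrite Ropp_0, Rplus_0_r in Hy. lra. }
    set (w := fun j => (Cmod (a j) * p ^ j)%R).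
    assert (Hw : forall j, (0 <= w j)%R).
    { intros j. apply Rmult_le_pos; [apply Cmod_ge_0|apply pow_le; unfold p; lra]. }
    exists (sum_n w (N1 + N2) + 2)%R. intros j. fold (w j).
    destruct (le_lt_dec j (N1 + N2)) as [Hj|Hj].
    - enough (w j <= sum_n w (N1 + N2))%R by lra.
      clear -Hj Hw. induction Hj as [|m Hm IH].
      + destruct j; [rewrite sum_O; lra|]. rewrite sum_Sn. unfold plus; simpl.
        enough (0 <= sum_n w j)%R by lra. rewrite sum_n_Reals. apply cond_pos_sum; auto.
      + rewrite sum_Sn. unfold plus; simpl. specialize (Hw (S m)). lra.
    - assert (0 <= sum_n w (N1 + N2))%R by (rewrite sum_n_Reals; apply cond_pos_sum; auto).
      enough (w j <= 2)%R by lra.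
      assert (E : w j = Cmod (a j * RtoC p ^ j)).
      { unfold w. rewrite Cmod_mult, Cmod_pow, Cmod_R, (Rabs_pos_eq p); [reflexivity|unfold p; lra]. }
      rewrite E. specialize (H1 j ltac:(lia)). specialize (H2 j ltac:(lia)). cbv beta in H1, H2.
      pose proof (Cmod2_alt (a j * RtoC p ^ j)) as HC.
      apply Rabs_le_between in H1, H2.
      pose proof (Cmod_ge_0 (a j * RtoC p ^ j)). nra. }
  destruct Hbd as [B HB].
  assert (HE : ex_series (fun j => Cmod (a j) * (r / 2) ^ j)%R).
  { apply ex_series_Rle with (fun j => B * (2 / 3) ^ j)%R.
    - intros j. assert (0 <= (r / 2) ^ j)%R by (apply pow_le; lra).
      rewrite Rabs_pos_eq by (apply Rmult_le_pos; [apply Cmod_ge_0|auto]).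
      replace (r / 2)%R with (p * (2 / 3))%R by (unfold p; field).
      rewrite Rpow_mult_distr, <- Rmult_assoc. apply Rmult_le_compat_r; [apply pow_le; lra|apply HB].
    - apply (@ex_series_scal R_AbsRing R_NormedModule B). apply ex_series_geom. rewrite Rabs_pos_eq; lra. }
  exists (r / 2)%R, (Series (fun j => Cmod (a j) * (r / 2) ^ j)%R). split; [lra|].
  exists a. split; [exact HE|split; [lra|]].
  intros h Hh. apply is_pseries_C. pose proof (Ha (s0 + h)) as H.
  replace (s0 + h - s0) with h in H by ring. apply H. lra.
Qed.

Lemma analytic_plus (f g : C -> C) (s0 : C) :
  analytic_at f s0 -> analytic_at g s0 -> analytic_at (fun s => f s + g s) s0.
Proof.
  intros Hf Hg. destruct (analytic_maj _ _ Hf) as [r [N [Hr HN]]].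
  destruct (analytic_maj _ _ Hg) as [r' [M [Hr' HM]]].
  assert (Hm : (0 < Rmin r r')%R) by (apply Rmin_glb_lt; auto).
  apply maj_analytic with (Rmin r r') (N + M)%R; auto. apply maj_plus; [lra| |].
  - apply maj_weaken with (3 := HN); [|lra]. split; [lra|apply Rmin_l].
  - apply maj_weaken with (3 := HM); [|lra]. split; [lra|apply Rmin_r].
Qed.

Lemma analytic_lin (f : C -> C) (s0 al be : C) :
  analytic_at f s0 -> analytic_at (fun s => (al + be * s) * f s) s0.
Proof.
  intros Hf. destruct (analytic_maj _ _ Hf) as [r [N [Hr HN]]].
  eapply maj_analytic; [exact Hr|]. apply maj_lin; [lra|exact HN].
Qed.

Lemma analytic_const (c s0 : C) : analytic_at (fun _ => c) s0.
Proof. apply maj_analytic with 1%R (Cmod c); [lra|apply maj_const]. Qed.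

Lemma analytic_ext (f g : C -> C) (s0 : C) :
  (forall s, f s = g s) -> analytic_at f s0 -> analytic_at g s0.
Proof.
  intros H [a [r Ha]]. exists a, r. intros z Hz. rewrite <- H. auto.
Qed.

Lemma analytic_scal (c : C) (f : C -> C) (s0 : C) :
  analytic_at f s0 -> analytic_at (fun s => c * f s) s0.
Proof.
  intros H. apply analytic_ext with (fun s => (c + 0 * s) * f s); [intros; ring|].
  now apply analytic_lin.
Qed.

Lemma analytic_shift (f : C -> C) (c s0 : C) :
  analytic_at f (s0 + c) -> analytic_at (fun s => f (s + c)) s0.
Proof.
  intros Hf. destruct (analytic_maj _ _ Hf) as [r [N [Hr HN]]].
  apply maj_analytic with r N; auto. now apply maj_shift.
Qed.

Lemma analytic_sum (f : nat -> C -> C) (s0 : C) (n m : nat) :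
  (forall k, analytic_at (f k) s0) ->
  analytic_at (fun s => @sum_n_m C_AbelianMonoid (fun k => f k s) n m) s0.
Proof.
  intros H. induction m as [|m IH].
  - destruct n as [|n].
    + apply analytic_ext with (f O); [|apply H]. intros s. now rewrite sum_n_n.
    + apply analytic_ext with (fun _ => RtoC 0); [|apply analytic_const].
      intros s. rewrite sum_n_m_zero by lia. reflexivity.
  - destruct (le_lt_dec n (S m)) as [Hn|Hn].
    + apply analytic_ext with (fun s => @sum_n_m C_AbelianMonoid (fun k => f k s) n m + f (S m) s).
      * intros s. now rewrite sum_n_Sm by auto.
      * now apply analytic_plus.
    + apply analytic_ext with (fun _ => RtoC 0); [|apply analytic_const].
      intros s. rewrite sum_n_m_zero by lia. reflexivity.
Qed.

Lemma analytic_pow (s0 : C) (n : nat) : analytic_at (fun s => s ^ n) s0.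
Proof.
  induction n as [|n IH]; [exact (analytic_const 1 s0)|].
  apply analytic_ext with (fun s => (0 + 1 * s) * s ^ n); [intros; simpl; ring|].
  now apply analytic_lin.
Qed.

(** * Identity theorem *)

(** If the coefficients below j vanish, a zero at h <> 0 forces |a_j| <= |h| N / r^(j+1). Since h
    can be taken arbitrarily small, a_j vanishes too. *)
Lemma maj_zero (f : C -> C) (s0 : C) (r N : R) : (0 < r)%R -> maj f s0 r N ->
  (forall eps, (0 < eps)%R -> exists h : C, h <> 0 /\ (Cmod h < eps)%R /\ f (s0 + h) = 0) ->
  forall h : C, (Cmod h <= r)%R -> f (s0 + h) = 0.
Proof.
  intros Hr [a [A1 [A2 A3]]] Hz.
  assert (Ha : forall j, a j = 0).
  { induction j as [j IH] using lt_wf_ind.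
    set (w := fun i => (Cmod (a i) * r ^ i)%R) in *.
    assert (HN : (0 <= N)%R).
    { eapply Rle_trans; [|exact A2]. apply Series_pos; [|exact A1].
      intros i. apply Rmult_le_pos; [apply Cmod_ge_0|apply pow_le; lra]. }
    assert (Hpr : (0 < r ^ S j)%R) by (apply pow_lt; lra).
    assert (key : forall h : C, h <> 0 -> (Cmod h <= r)%R -> f (s0 + h) = 0 ->
       (Cmod (a j) <= Cmod h * (N / r ^ S j))%R).
    { intros h Hh Hhr Hf.
      assert (Hh0 : (0 < Cmod h)%R) by exact (proj1 (Cmod_gt_0 h) Hh).
      pose (b := fun i => if Nat.eqb i j then a i * h ^ i else RtoC 0).
      pose (c := fun i => if Nat.leb i j then RtoC 0 else a i * h ^ i).
      assert (Hb : is_cs b (b j)).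
      { apply is_cs_single. intros i Hi. unfold b. now destruct (Nat.eqb_spec i j). }
      assert (Hc : is_cs c (0 + (-1) * b j)).
      { apply is_cs_ext with (fun i => a i * h ^ i + (-1) * b i).
        - intros i. unfold b, c. destruct (Nat.eqb_spec i j) as [->|Hi].
          + rewrite Nat.leb_refl. ring.
          + destruct (Nat.leb_spec i j); [rewrite IH by lia; ring|ring].
        - apply is_cs_plus; [rewrite <- Hf; now apply A3|now apply is_cs_scal]. }
      assert (Hbj : b j = a j * h ^ j) by (unfold b; now rewrite Nat.eqb_refl).
      assert (Hr1 : (0 < Cmod h / r <= 1)%R).
      { split; [apply Rdiv_lt_0_compat; lra|]. apply Rle_div_l; lra. }
      assert (Hle : (Cmod (a j) * Cmod h ^ j <= (Cmod h / r) ^ S j * N)%R).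
      { replace (Cmod (a j) * Cmod h ^ j)%R with (Cmod (0 + (-1) * b j)).
        2:{ replace (0 + (-1) * b j) with (- b j) by ring.
            now rewrite Cmod_opp, Hbj, Cmod_mult, Cmod_pow. }
        apply Rle_trans with (Series (fun i => (Cmod h / r) ^ S j * w i)%R).
        - apply is_cs_Cmod_le with (1 := Hc).
          + intros i. unfold c, w. pose proof (Cmod_ge_0 (a i)).
            destruct (Nat.leb_spec i j).
            * rewrite Cmod_0. apply Rmult_le_pos; [apply pow_le; lra|]. apply Rmult_le_pos; [auto|apply pow_le; lra].
            * rewrite Cmod_mult, Cmod_pow.
              replace (Cmod h ^ i)%R with ((Cmod h / r) ^ i * r ^ i)%R.
              -- rewrite <- Rmult_assoc, (Rmult_comm (Cmod (a i))), Rmult_assoc.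
                 apply Rmult_le_compat_r; [apply Rmult_le_pos; [auto|apply pow_le; lra]|].
                 replace i with (S j + (i - S j))%nat by lia. rewrite pow_add.
                 rewrite <- (Rmult_1_r ((Cmod h / r) ^ S j)) at 2.
                 apply Rmult_le_compat_l; [apply pow_le; lra|].
                 rewrite <- (pow1 (i - S j)). apply pow_incr; lra.
              -- rewrite <- Rpow_mult_distr. f_equal. field. lra.
          + apply (@ex_series_scal R_AbsRing R_NormedModule). exact A1.
        - rewrite Series_scal_l. apply Rmult_le_compat_l; [apply pow_le; lra|exact A2]. }
      assert (Hhj : (0 < Cmod h ^ j)%R) by now apply pow_lt.
      apply Rmult_le_reg_r with (1 := Hhj). eapply Rle_trans; [exact Hle|].
      right. unfold Rdiv. rewrite Rpow_mult_distr, pow_inv. simpl. ring. }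
    apply Cmod_eq_0. apply Rle_antisym; [|apply Cmod_ge_0].
    apply Rnot_lt_le. intros Hpos.
    set (D := (N / r ^ S j)%R) in *.
    assert (HD : (0 <= D)%R) by (apply Rle_div_r; lra).
    destruct (Hz (Rmin r (Cmod (a j) / (D + 1)))) as [h [Hh [Hhe Hf]]].
    { apply Rmin_glb_lt; [lra|]. apply Rdiv_lt_0_compat; lra. }
    pose proof (Rmin_l r (Cmod (a j) / (D + 1))).
    pose proof (Rmin_r r (Cmod (a j) / (D + 1))).
    specialize (key h Hh ltac:(lra) Hf).
    assert (Cmod h * (D + 1) < Cmod (a j))%R.
    { apply Rlt_div_r; lra. }
    pose proof (Cmod_ge_0 h). nra. }
  intros h Hh. rewrite <- (is_cs_unique _ _ (A3 h Hh)). apply is_cs_unique.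
  apply is_cs_zero. intros n. rewrite Ha. ring.
Qed.

Definition zero_near (f : C -> C) (s : C) : Prop :=
  exists eps, (0 < eps)%R /\ forall s', (Cmod (s' - s) < eps)%R -> f s' = 0.

Lemma analytic_zero_near (f : C -> C) (s0 : C) : analytic_at f s0 ->
  (forall eps, (0 < eps)%R -> exists h : C, h <> 0 /\ (Cmod h < eps)%R /\ f (s0 + h) = 0) ->
  zero_near f s0.
Proof.
  intros Hf Hz. destruct (analytic_maj _ _ Hf) as [r [N [Hr HN]]].
  exists r. split; [exact Hr|]. intros s Hs.
  assert (f s = f (s0 + (s - s0))) as -> by (f_equal; ring).
  apply maj_zero with r N; auto. lra.
Qed.

(** Connectedness of [0, 1]: T is the supremum of the parameters up to which f vanishes locally.
    Zeros just below T accumulate at g(T), so f vanishes near g(T) as well, and T < 1 would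
    contradict the choice of T. *)
Lemma identity_segment (f : C -> C) (p q : C) :
  (forall t, (0 <= t <= 1)%R -> analytic_at f (p + RtoC t * (q - p))) ->
  zero_near f p -> zero_near f q.
Proof.
  intros Hf Hp.
  destruct (classic (p = q)) as [<-|Hpq]; [exact Hp|].
  assert (Hd : (0 < Cmod (q - p))%R).
  { apply Cmod_gt_0. intros E. apply Hpq. symmetry. now apply Ceq_minus. }
  set (d := Cmod (q - p)) in *.
  set (g := fun t => p + RtoC t * (q - p)).
  assert (Hg : forall t u, Cmod (g t - g u) = (Rabs (t - u) * d)%R).
  { intros t u. unfold g. replace (p + t * (q - p) - (p + u * (q - p))) with (RtoC (t - u) * (q - p)).
    - now rewrite Cmod_mult, Cmod_R.
    - rewrite RtoC_minus. ring. }
  set (E := fun t => (0 <= t <= 1)%R /\ forall u, (0 <= u <= t)%R -> zero_near f (g u)).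
  assert (E0 : E 0%R).
  { split; [lra|]. intros u Hu. replace u with 0%R by lra. unfold g.
    replace (p + 0 * (q - p)) with p by ring. exact Hp. }
  destruct (completeness E) as [T [HT1 HT2]].
  { exists 1%R. intros t [Ht _]. lra. }
  { now exists 0%R. }
  assert (HT : (0 <= T <= 1)%R).
  { split; [now apply HT1|]. apply HT2. intros t [Ht _]. lra. }
  assert (Hopen : forall t eps, (forall s', (Cmod (s' - g t) < eps)%R -> f s' = 0) ->
     forall u, (Rabs (u - t) * d < eps)%R -> zero_near f (g u)).
  { intros t eps H u Hu. exists (eps - Rabs (u - t) * d)%R. split; [lra|].
    intros s' Hs'. apply H. replace (s' - g t) with ((s' - g u) + (g u - g t)) by ring.
    eapply Rle_lt_trans; [apply Cmod_triangle|]. rewrite Hg. lra. }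
  assert (Hbelow : forall t, (0 <= t < T)%R -> zero_near f (g t)).
  { intros t Ht. destruct (classic (exists u, E u /\ (t < u)%R)) as [[u [[Hu1 Hu2] Hu3]]|Hn].
    - apply Hu2. lra.
    - exfalso. apply (Rlt_irrefl t). apply Rlt_le_trans with T; [lra|].
      apply HT2. intros u Hu. apply Rnot_lt_le. intros Hlt. apply Hn. now exists u. }
  assert (HZ : zero_near f (g T)).
  { destruct (Req_dec T 0) as [->|HT0]; [apply E0; lra|].
    apply analytic_zero_near; [now apply Hf|].
    intros eps He.
    set (u := Rmin (T / 2) (eps / (2 * d))).
    assert (Hu : (0 < u)%R) by (apply Rmin_glb_lt; [lra|apply Rdiv_lt_0_compat; lra]).
    pose proof (Rmin_l (T / 2) (eps / (2 * d))) as Hu1. fold u in Hu1.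
    pose proof (Rmin_r (T / 2) (eps / (2 * d))) as Hu2. fold u in Hu2.
    assert (Hm : Cmod (g (T - u)%R - g T) = (u * d)%R).
    { rewrite Hg. replace (T - u - T)%R with (- u)%R by ring. rewrite Rabs_Ropp, Rabs_pos_eq; lra. }
    exists (g (T - u)%R - g T). split; [|split].
    - apply Cmod_gt_0. rewrite Hm. nra.
    - rewrite Hm. apply Rle_lt_trans with (eps / 2)%R; [|lra].
      replace (eps / 2)%R with (eps / (2 * d) * d)%R by (field; lra).
      apply Rmult_le_compat_r; lra.
    - replace (g T + (g (T - u)%R - g T)) with (g (T - u)%R) by ring.
      destruct (Hbelow (T - u)%R) as [e [He1 He2]]; [lra|].
      apply He2. replace (g (T - u)%R - g (T - u)%R) with (RtoC 0) by ring. rewrite Cmod_0. exact He1. }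
  assert (HT' : T = 1%R).
  { apply NNPP. intros HT'. destruct HZ as [eps [He HZ]].
    set (v := Rmin ((1 - T) / 2) (eps / (2 * d))).
    assert (Hv : (0 < v)%R) by (apply Rmin_glb_lt; [lra|apply Rdiv_lt_0_compat; lra]).
    pose proof (Rmin_l ((1 - T) / 2) (eps / (2 * d))) as Hv1. fold v in Hv1.
    pose proof (Rmin_r ((1 - T) / 2) (eps / (2 * d))) as Hv2. fold v in Hv2.
    assert (E (T + v)%R).
    { split; [lra|]. intros u Hu. destruct (Rlt_le_dec u T) as [HuT|HuT]; [apply Hbelow; lra|].
      apply (Hopen T eps HZ). rewrite Rabs_pos_eq by lra.
      apply Rle_lt_trans with (eps / 2)%R; [|lra].
      replace (eps / 2)%R with (eps / (2 * d) * d)%R by (field; lra).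
      apply Rmult_le_compat_r; lra. }
    apply HT1 in H. lra. }
  rewrite HT' in HZ. unfold g in HZ. replace (p + 1 * (q - p)) with q in HZ by ring. exact HZ.
Qed.

(** The zeros on the axis accumulate at i. Local vanishing is then carried from i to 1 and from 1 to
    z along segments, which stay in the domain because the slit plane is star-shaped about 1. *)
Lemma slit_plane_identity (f : C -> C) :
  (forall z, slit_plane z -> analytic_at f z) ->
  (forall y, (0 < y)%R -> f (Ci * RtoC y) = 0) ->
  forall z, slit_plane z -> f z = 0.
Proof.
  intros Hf Hy z Hz.
  assert (H1 : zero_near f Ci).
  { apply analytic_zero_near.
    - apply Hf. intros [E _]. simpl in E. lra.
    - intros eps He. exists (Ci * RtoC (eps / 2)). split; [|split].
      + apply Cmult_neq_0; [apply Ci_nz|]. intros E. apply RtoC_inj in E. lra.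
      + rewrite Cmod_mult, Cmod_Ci, Cmod_R, Rabs_pos_eq; lra.
      + replace (Ci + Ci * RtoC (eps / 2)) with (Ci * RtoC (1 + eps / 2)).
        * apply Hy. lra.
        * rewrite RtoC_plus. ring. }
  assert (H2 : zero_near f 1).
  { apply identity_segment with (2 := H1). intros t Ht. apply Hf. intros [E1 E2].
    simpl in E1, E2. lra. }
  assert (H3 : zero_near f z).
  { apply identity_segment with (2 := H2). intros t Ht. apply Hf. intros [E1 E2].
    simpl in E1, E2.
    assert (E3 : (t * Im z = 0)%R) by (unfold Im; lra).
    assert (E4 : (1 - t + t * Re z <= 0)%R) by (unfold Re; lra).
    apply Rmult_integral in E3 as [E3|E3]; [subst; lra|].
    apply Hz. split; [exact E3|]. nra. }
  destruct H3 as [e [He H3]]. apply H3. replace (z - z) with (RtoC 0) by ring. now rewrite Cmod_0.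
Qed.

(** * Exponential and binomial series *)

Lemma Cexp_plus (z w : C) : Cexp (z + w) = Cexp z * Cexp w.
Proof.
  unfold Cexp. rewrite re_plus. change (Im (z + w)) with (Im z + Im w)%R.
  rewrite exp_plus, cos_plus, sin_plus. unfold Cmult. simpl. f_equal; ring.
Qed.

Lemma Cexp_RtoC (x : R) : Cexp (RtoC x) = RtoC (exp x).
Proof. unfold Cexp. simpl. rewrite cos_0, sin_0. unfold RtoC. f_equal; ring. Qed.

Lemma Cmod_Cexp (z : C) : Cmod (Cexp z) = exp (Re z).
Proof.
  unfold Cexp, Cmod. simpl fst; simpl snd.
  replace ((exp (Re z) * cos (Im z)) ^ 2 + (exp (Re z) * sin (Im z)) ^ 2)%R with (exp (Re z) ^ 2)%R.
  - rewrite <- Rsqr_pow2. apply sqrt_Rsqr. left; apply exp_pos.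
  - pose proof (sin2_cos2 (Im z)). unfold Rsqr in H.
    transitivity (exp (Re z) ^ 2 * (sin (Im z) * sin (Im z) + cos (Im z) * cos (Im z)))%R; [rewrite H|]; ring.
Qed.

(** For w = u + iv the equations say w' = (a + ib) phi' w. The functions [p] and [q] are the real
    and imaginary parts of w exp(-(a + ib) phi), whose derivative is zero. Exponential and binomial
    series are both instances. *)
Lemma linear_ode_exp (a b X : R) (phi phi' u v : R -> R) : X <> 0%R ->
  (forall x, (Rmin 0 X <= x <= Rmax 0 X)%R ->
     is_derive phi x (phi' x) /\
     is_derive u x ((a * u x - b * v x) * phi' x)%R /\
     is_derive v x ((a * v x + b * u x) * phi' x)%R) ->
  phi 0%R = 0%R -> u 0%R = 1%R -> v 0%R = 0%R ->
  (u X, v X) = Cexp ((a, b) * RtoC (phi X)).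
Proof.
  intros HX H Hphi Hu Hv.
  set (p := fun x => (exp (- a * phi x) * (u x * cos (b * phi x) + v x * sin (b * phi x)))%R).
  set (q := fun x => (exp (- a * phi x) * (v x * cos (b * phi x) - u x * sin (b * phi x)))%R).
  assert (Dp : forall x, (Rmin 0 X <= x <= Rmax 0 X)%R -> is_derive p x zero /\ is_derive q x zero).
  { intros x Hx. destruct (H x Hx) as [D1 [D2 D3]].
    pose proof (is_derive_unique (fun x : R => phi x) x _ D1) as E1; change (Derive (fun x : R => phi x) x = phi' x) in E1.
    pose proof (is_derive_unique (fun x : R => u x) x _ D2) as E2; change (Derive (fun x : R => u x) x = ((a * u x - b * v x) * phi' x)%R) in E2.
    pose proof (is_derive_unique (fun x : R => v x) x _ D3) as E3; change (Derive (fun x : R => v x) x = ((a * v x + b * u x) * phi' x)%R) in E3.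
    split; unfold p, q; auto_derive.
    - repeat split; eexists; eauto.
    - rewrite E1, E2, E3.
      eqR. change (@zero R_AbelianMonoid) with 0%R. change (zero : R) with 0%R. ring.
    - repeat split; eexists; eauto.
    - rewrite E1, E2, E3.
      eqR. change (zero : R) with 0%R. ring. }
  assert (Hpq : p X = 1%R /\ q X = 0%R).
  { assert (P0 : p 0%R = 1%R). { unfold p. rewrite Hphi, Hu, Hv, !Rmult_0_r, cos_0, exp_0. ring. }
    assert (Q0 : q 0%R = 0%R). { unfold q. rewrite Hphi, Hu, Hv, !Rmult_0_r, cos_0, sin_0. ring. }
    enough (Hc : p X = p 0%R /\ q X = q 0%R) by (destruct Hc as [-> ->]; auto).
    destruct (Rlt_le_dec 0 X) as [HX0|HX0].
    - rewrite Rmin_left, Rmax_right in Dp by lra.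
      split; symmetry; apply (eq_is_derive (V := R_NormedModule)); auto; intros; now apply Dp.
    - rewrite Rmin_right, Rmax_left in Dp by lra.
      split; apply (eq_is_derive (V := R_NormedModule)); try lra; intros; now apply Dp. }
  destruct Hpq as [P Q]. unfold p, q in P, Q.
  unfold Cexp. simpl Re; simpl Im.
  replace (a * phi X - b * 0)%R with (a * phi X)%R by ring.
  replace (a * 0 + b * phi X)%R with (b * phi X)%R by ring.
  replace (- a * phi X)%R with (- (a * phi X))%R in P, Q by ring.
  rewrite exp_Ropp in P, Q. pose proof (exp_pos (a * phi X)) as He.
  set (e := exp (a * phi X)) in *. set (c := cos (b * phi X)) in *. set (s := sin (b * phi X)) in *.
  assert (Hcs : (s * s + c * c = 1)%R) by apply (sin2_cos2 (b * phi X)).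
  assert (P' : (u X * c + v X * s = e)%R) by (apply Rmult_eq_reg_l with (/ e)%R; [rewrite P; field; lra|apply Rinv_neq_0_compat; lra]).
  assert (Q' : (v X * c - u X * s = 0)%R) by (apply Rmult_eq_reg_l with (/ e)%R; [rewrite Q; ring|apply Rinv_neq_0_compat; lra]).
  f_equal.
  - transitivity ((u X * c + v X * s) * c - (v X * c - u X * s) * s)%R; [|rewrite P', Q'; ring].
    transitivity (u X * (s * s + c * c))%R; [rewrite Hcs; ring|ring].
  - transitivity ((u X * c + v X * s) * s + (v X * c - u X * s) * c)%R; [|rewrite P', Q'; ring].
    transitivity (v X * (s * s + c * c))%R; [rewrite Hcs; ring|ring].
Qed.

Lemma coef_CV_radius (c : nat -> C) (rho : R)
  (c_summable : ex_series (fun j => Cmod (c j) * rho ^ j)%R) (rho_pos : (0 < rho)%R) (f : C -> R) :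
  (forall w, Rabs (f w) <= Cmod w)%R ->
  forall x, (Rabs x < rho)%R -> Rbar_lt (Rabs x) (CV_radius (fun j => f (c j))).
Proof.
  intros Hf x Hx. apply Rbar_lt_le_trans with (Finite rho); [exact Hx|].
  replace rho with (Rabs rho) by (apply Rabs_pos_eq; lra). apply CV_radius_ge.
  apply ex_pseries_R. apply ex_series_Rle with (2 := c_summable). intros j.
  rewrite Rabs_mult, (Rabs_pos_eq (rho ^ j)) by (apply pow_le; lra).
  apply Rmult_le_compat_r; [apply pow_le; lra|apply Hf].
Qed.

Lemma coef_is_cs (c : nat -> C) (rho : R)
  (c_summable : ex_series (fun j => Cmod (c j) * rho ^ j)%R) (rho_pos : (0 < rho)%R) (x : R) :
  (Rabs x < rho)%R ->
  is_cs (fun j => c j * RtoC (x ^ j)) (PSeries (fun j => Re (c j)) x, PSeries (fun j => Im (c j)) x).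
Proof.
  set (U := fun j => Re (c j)). set (V := fun j => Im (c j)).
  intros Hx. apply is_cs_components. split.
  - apply is_series_ext with (fun j => U j * x ^ j)%R; [intros j; symmetry; apply re_scal_r|].
    apply is_pseries_R, PSeries_correct, CV_radius_inside, (coef_CV_radius c rho c_summable rho_pos Re re_le_Cmod x Hx).
  - apply is_series_ext with (fun j => V j * x ^ j)%R; [intros j; symmetry; apply im_scal_r|].
    apply is_pseries_R, PSeries_correct, CV_radius_inside, (coef_CV_radius c rho c_summable rho_pos Im im_le_Cmod x Hx).
Qed.

(* The recursion (j+1) c_(j+1) + k j c_j = (a + ib) c_j encodes the equation
   (1 + k x) w' = (a + ib) w. *)
Lemma coef_ode (c : nat -> C) (rho : R)
  (c_summable : ex_series (fun j => Cmod (c j) * rho ^ j)%R) (rho_pos : (0 < rho)%R) (al : C) (k : R) (phi : R -> R) (X : R) :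
  X <> 0%R -> (Rabs X < rho)%R -> c O = 1 ->
  (forall j, RtoC (INR (S j)) * c (S j) + RtoC (k * INR j) * c j = al * c j) ->
  phi 0%R = 0%R ->
  (forall x, (Rmin 0 X <= x <= Rmax 0 X)%R -> (1 + k * x <> 0)%R /\ is_derive phi x (/ (1 + k * x))%R) ->
  is_cs (fun j => c j * RtoC (X ^ j)) (Cexp (al * RtoC (phi X))).
Proof.
  intros HX0 HX Hc0 Hrec Hphi0 Hphi.
  set (U := fun j => Re (c j)). set (V := fun j => Im (c j)).
  destruct al as [a b].
  enough ((PSeries U X, PSeries V X) = Cexp ((a, b) * RtoC (phi X))) as <- by now apply coef_is_cs with rho.
  assert (Hin : forall x, (Rmin 0 X <= x <= Rmax 0 X)%R -> (Rabs x < rho)%R).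
  { intros x Hx. destruct (Rle_lt_dec 0 X).
    - rewrite Rmin_left, Rmax_right in Hx by lra. rewrite Rabs_pos_eq in * by lra. lra.
    - rewrite Rmin_right, Rmax_left in Hx by lra. rewrite Rabs_left1 in * by lra. lra. }
  assert (Hinc : forall (W : nat -> R) j, PS_incr_1 (PS_derive W) j = (INR j * W j)%R).
  { intros W [|j]; unfold PS_incr_1, PS_derive; [|reflexivity].
    change (0 = 0 * W O)%R. ring. }
  assert (HUrec : forall j, (PS_derive U j + k * PS_incr_1 (PS_derive U) j = a * U j + - b * V j)%R).
  { intros j. pose proof (f_equal Re (Hrec j)) as H.
    rewrite re_plus, !re_scal_l, re_mult in H.
    change (Re (a, b)) with a in H. change (Im (a, b)) with b in H.
    rewrite Hinc. unfold PS_derive, U, V. lra. }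
  assert (HVrec : forall j, (PS_derive V j + k * PS_incr_1 (PS_derive V) j = a * V j + b * U j)%R).
  { intros j. pose proof (f_equal Im (Hrec j)) as H.
    rewrite im_mult in H. change (Im (RtoC (INR (S j)) * c (S j) + RtoC (k * INR j) * c j))
      with (Im (RtoC (INR (S j)) * c (S j)) + Im (RtoC (k * INR j) * c j))%R in H.
    rewrite !im_scal_l in H.
    change (Re (a, b)) with a in H. change (Im (a, b)) with b in H.
    rewrite Hinc. unfold PS_derive, U, V. lra. }
  (* The coefficient recursion summed up: (1 + k x) D' = al A + be B. It is used once for the real
     part and once for the imaginary part of the equation. *)
  assert (G : forall A B D : nat -> R, forall al be x,
     Rbar_lt (Rabs x) (CV_radius A) -> Rbar_lt (Rabs x) (CV_radius B) -> Rbar_lt (Rabs x) (CV_radius D) ->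
     (forall j, PS_derive D j + k * PS_incr_1 (PS_derive D) j = al * A j + be * B j)%R ->
     (PSeries (PS_derive D) x * (1 + k * x) = al * PSeries A x + be * PSeries B x)%R).
  { intros A B D al be x HA HB HD Hj.
    rewrite <- !PSeries_scal, <- PSeries_plus.
    - rewrite (PSeries_ext (PS_plus (PS_scal al A) (PS_scal be B))
        (PS_plus (PS_derive D) (PS_scal k (PS_incr_1 (PS_derive D))))) by (intros j; symmetry; apply Hj).
      rewrite PSeries_plus, PSeries_scal, PSeries_incr_1; [ring| |].
      + now apply ex_pseries_derive.
      + apply ex_pseries_scal; [apply Rmult_comm|]. apply ex_pseries_incr_1. now apply ex_pseries_derive.
    - apply ex_pseries_scal; [apply Rmult_comm|]. now apply CV_radius_inside.
    - apply ex_pseries_scal; [apply Rmult_comm|]. now apply CV_radius_inside. }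
  apply linear_ode_exp with (phi' := fun x => (/ (1 + k * x))%R); auto.
  - intros x Hx. destruct (Hphi x Hx) as [P1 P2].
    assert (HU : Rbar_lt (Rabs x) (CV_radius U)) by (apply (coef_CV_radius c rho c_summable rho_pos Re re_le_Cmod); auto).
    assert (HV : Rbar_lt (Rabs x) (CV_radius V)) by (apply (coef_CV_radius c rho c_summable rho_pos Im im_le_Cmod); auto).
    split; [exact P2|]. split.
    + replace ((a * PSeries U x - b * PSeries V x) * / (1 + k * x))%R with (PSeries (PS_derive U) x).
      * now apply is_derive_PSeries.
      * apply Rmult_eq_reg_r with (1 + k * x)%R; [|exact P1].
        rewrite (G U V U a (- b)%R x HU HV HU HUrec). field. exact P1.
    + replace ((a * PSeries V x + b * PSeries U x) * / (1 + k * x))%R with (PSeries (PS_derive V) x).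
      * now apply is_derive_PSeries.
      * apply Rmult_eq_reg_r with (1 + k * x)%R; [|exact P1].
        rewrite (G V U V a b x HV HU HV HVrec). field. exact P1.
  - rewrite PSeries_0. unfold U. now rewrite Hc0.
  - rewrite PSeries_0. unfold V. now rewrite Hc0.
Qed.

Lemma ex_series_exp (y : R) : ex_series (fun j => y ^ j * / INR (fact j))%R.
Proof.
  exists (exp y). pose proof (proj1 (is_pseries_R _ _ _) (is_exp_Reals y)) as H.
  revert H. apply is_series_ext. intros j. apply Rmult_comm.
Qed.

(** The case k = 0, phi(x) = x of [coef_ode], evaluated at X = 1 inside the radius 2. *)
Lemma Cexp_series (z : C) : is_cs (fun j => z ^ j * RtoC (/ INR (fact j))) (Cexp z).
Proof.
  pose proof (coef_ode (fun j => z ^ j * RtoC (/ INR (fact j))) 2) as H.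
  specialize (H) with (al := z) (k := 0%R) (phi := fun x => x) (X := 1%R).
  cbv beta in H. rewrite Cmult_1_r in H.
  eapply is_cs_ext; [|apply H].
  - intros n. simpl. rewrite pow1. ring.
  - apply ex_series_ext with (fun j => (Cmod z * 2) ^ j * / INR (fact j))%R; [|apply ex_series_exp].
    intros j. eqR. rewrite Cmod_mult, Cmod_pow, Cmod_R, Rabs_pos_eq.
    + rewrite Rpow_mult_distr. ring.
    + left. apply Rinv_0_lt_compat, INR_fact_lt_0.
  - lra.
  - lra.
  - rewrite Rabs_pos_eq; lra.
  - simpl. rewrite Rinv_1. ring.
  - intros j. rewrite Rmult_0_l. rewrite Cmult_0_l, Cplus_0_r.
    change (z ^ S j) with (z * z ^ j).
    transitivity (z * z ^ j * (RtoC (INR (S j)) * RtoC (/ INR (fact (S j))))); [ring|].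
    rewrite <- RtoC_mult. replace (INR (S j) * / INR (fact (S j)))%R with (/ INR (fact j))%R; [ring|].
    rewrite fact_simpl, mult_INR. field. split; [apply INR_fact_neq_0|]. apply not_0_INR; lia.
  - reflexivity.
  - intros x _. split; [lra|]. replace (/ (1 + 0 * x))%R with 1%R by (field; lra). apply @is_derive_id.
Qed.

Fixpoint Cbinom (al : C) (j : nat) : C :=
  match j with
  | O => 1
  | S i => (al - RtoC (INR i)) * Cbinom al i * RtoC (/ INR (S i))
  end.

(* The coefficients of (1 - x)^(-r), which dominate those of (1 + x)^al for |al| <= r. *)
Fixpoint asc (r : R) (j : nat) : R :=
  match j with
  | O => 1
  | S i => ((r + INR i) * asc r i * / INR (S i))%R
  end.

Lemma asc_pos (r : R) (j : nat) : (0 < r)%R -> (0 < asc r j)%R.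
Proof.
  intros Hr. induction j as [|j IH]; [simpl; lra|]. cbn [asc].
  pose proof (pos_INR j). pose proof (INR_S_pos j).
  apply Rmult_lt_0_compat; [apply Rmult_lt_0_compat; lra|now apply Rinv_0_lt_compat].
Qed.

Lemma Cbinom_le_asc (al : C) (r : R) (j : nat) :
  (Cmod al <= r)%R -> (0 < r)%R -> (Cmod (Cbinom al j) <= asc r j)%R.
Proof.
  intros H Hr. induction j as [|j IH]; [simpl; rewrite Cmod_1; lra|]. cbn [asc Cbinom].
  rewrite !Cmod_mult, Cmod_R. pose proof (INR_S_pos j).
  assert (0 < / INR (S j))%R by now apply Rinv_0_lt_compat.
  rewrite (Rabs_pos_eq (/ INR (S j))) by lra.
  apply Rmult_le_compat_r; [lra|]. apply Rmult_le_compat; auto using Cmod_ge_0.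
  eapply Rle_trans; [apply Cmod_triangle|]. rewrite Cmod_opp, Cmod_R, Rabs_pos_eq by apply pos_INR. lra.
Qed.

Lemma ex_series_asc (r x : R) : (0 < r)%R -> (0 < x < 1)%R -> ex_series (fun j => asc r j * x ^ j)%R.
Proof.
  intros Hr Hx.
  assert (Hp : forall j, (0 < asc r j * x ^ j)%R).
  { intros j. apply Rmult_lt_0_compat; [now apply asc_pos|apply pow_lt; lra]. }
  apply ex_series_Rabs. apply ex_series_DAlembert with x; [lra| |].
  - intros n. specialize (Hp n). lra.
  - apply is_lim_seq_ext with (fun n => (1 + (r - 1) * / INR (S n)) * x)%R.
    + intros n. pose proof (Hp n). pose proof (Hp (S n)).
      rewrite Rabs_pos_eq by (left; now apply Rdiv_lt_0_compat).
      pose proof (asc_pos r n Hr). pose proof (pow_lt x n ltac:(lra)). pose proof (INR_S_pos n).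
      cbn [asc pow]. rewrite S_INR in *. field. repeat split; lra.
    + replace (Finite x) with (Finite ((1 + (r - 1) * 0) * x)) by (f_equal; ring).
      apply is_lim_seq_mult'; [|apply is_lim_seq_const].
      apply is_lim_seq_plus'; [apply is_lim_seq_const|].
      apply is_lim_seq_mult'; [apply is_lim_seq_const|].
      apply is_lim_seq_incr_1 with (u := fun n => (/ INR n)%R).
      replace (Finite 0) with (Rbar_inv p_infty) by reflexivity.
      apply is_lim_seq_inv; [apply is_lim_seq_INR|easy].
Qed.

(** The case k = 1, phi(x) = ln(1 + x) of [coef_ode]. The range |x| <= 1/2 is the one needed for x =
    1/(2K) with K a positive integer; 3/4 is a radius strictly between 1/2 and 1. *)
Lemma binomial_series (al : C) (x : R) : (Rabs x <= / 2)%R ->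
  is_cs (fun j => Cbinom al j * RtoC (x ^ j)) (Cexp (al * RtoC (ln (1 + x)))).
Proof.
  intros Hx.
  destruct (Req_dec x 0) as [->|Hx0].
  - rewrite Rplus_0_r, ln_1, Cmult_0_r.
    replace (Cexp 0) with (Cbinom al 0 * RtoC (0 ^ 0)).
    + apply (is_cs_single (fun j => Cbinom al j * RtoC (0 ^ j))). intros [|i] Hi; [easy|].
      simpl pow. rewrite Rmult_0_l. ring.
    + rewrite Cexp_RtoC, exp_0. simpl. ring.
  - assert (Hb : forall y, (Rmin 0 x <= y <= Rmax 0 x)%R -> (/ 2 <= 1 + y)%R).
    { intros y [Hy _]. apply Rabs_le_between in Hx.
      pose proof (Rmin_glb 0 x (- / 2)). lra. }
    apply coef_ode with (rho := (3 / 4)%R) (k := 1%R) (phi := fun y => ln (1 + y)).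
    + apply ex_series_Rle with (2 := ex_series_asc (Cmod al + 1) (3 / 4)%R ltac:(pose proof (Cmod_ge_0 al); lra) ltac:(lra)).
      intros j. assert (0 <= (3 / 4) ^ j)%R by (apply pow_le; lra).
      rewrite Rabs_pos_eq by (apply Rmult_le_pos; auto using Cmod_ge_0).
      apply Rmult_le_compat_r; auto. apply Cbinom_le_asc; pose proof (Cmod_ge_0 al); lra.
    + lra.
    + exact Hx0.
    + lra.
    + reflexivity.
    + intros j. cbn [Cbinom]. rewrite Rmult_1_l.
      transitivity ((al - INR j) * Cbinom al j * (RtoC (INR (S j)) * RtoC (/ INR (S j))) + INR j * Cbinom al j); [ring|].
      rewrite <- RtoC_mult, Rinv_r by (apply not_0_INR; lia). ring.
    + rewrite Rplus_0_r. apply ln_1.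
    + intros y Hy. specialize (Hb y Hy). split; [lra|]. auto_derive; [lra|]. field. lra.
Qed.

(** * Powers of positive reals, zeta at integers, manipulation of complex series *)

Lemma Cpower_pos (x : R) (s : C) : (0 < x)%R -> Cpower (RtoC x) s = Cexp (s * RtoC (ln x)).
Proof.
  intros Hx. unfold Cpower, Clog, Carg. rewrite Cmod_R, Rabs_pos_eq by lra.
  simpl Im. unfold Rdiv. rewrite Rmult_0_l, atan_0, Rmult_0_r. reflexivity.
Qed.

Lemma Cexp_ln_pow (x : R) (n : nat) : (0 < x)%R -> Cexp (RtoC (INR n) * RtoC (ln x)) = RtoC (x ^ n).
Proof.
  intros Hx. rewrite <- RtoC_mult, Cexp_RtoC. f_equal.
  rewrite <- (Rpower_pow n x Hx). reflexivity.
Qed.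

Lemma Cexp_opp (z : C) : Cexp z * Cexp (- z) = 1.
Proof.
  rewrite <- Cexp_plus. replace (z + - z) with (RtoC 0) by ring. now rewrite Cexp_RtoC, exp_0.
Qed.

Lemma Cexp_ln_pow_inv (x : R) (n : nat) : (0 < x)%R -> Cexp (- RtoC (INR n) * RtoC (ln x)) = RtoC (/ x ^ n).
Proof.
  intros Hx. pose proof (Cexp_opp (RtoC (INR n) * RtoC (ln x))) as H.
  rewrite Cexp_ln_pow in H by auto.
  assert (Hp : (x ^ n <> 0)%R) by (apply pow_nonzero; lra).
  rewrite RtoC_inv by auto.
  replace (- RtoC (INR n) * RtoC (ln x)) with (- (RtoC (INR n) * RtoC (ln x))) by ring.
  assert (RtoC (x ^ n) <> 0) by (intros E; now apply RtoC_inj in E).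
  set (w := Cexp _) in *. transitivity (/ RtoC (x ^ n) * (RtoC (x ^ n) * w)); [field; auto|].
  rewrite H. ring.
Qed.

Lemma zeta_nat (zeta : C -> C) (p : nat) : is_riemann_zeta zeta -> (2 <= p)%nat ->
  zeta (RtoC (INR p)) = RtoC (zetaR p).
Proof.
  intros [_ Hz] Hp. assert (H2 : (2 <= INR p)%R) by (apply (le_INR 2); auto).
  specialize (Hz (RtoC (INR p)) ltac:(simpl; lra)).
  rewrite <- (is_cs_unique _ _ Hz). apply is_cs_unique.
  apply is_cs_ext with (fun k => RtoC (/ INR (S k) ^ p)).
  - intros k. rewrite Cpower_pos by apply INR_S_pos. symmetry. apply Cexp_ln_pow_inv, INR_S_pos.
  - apply is_cs_RtoC, Series_correct, ex_series_inv_pow, Hp.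
Qed.

Lemma is_cs_odd (u : nat -> C) (l : C) : (forall i, u (2 * i)%nat = 0) -> is_cs u l ->
  is_cs (fun i => u (2 * i + 1)%nat) l.
Proof.
  intros Hu H P HP. destruct (H P HP) as [N HN]. exists N. intros n Hn.
  assert (E : @sum_n C_AbelianMonoid (fun i => u (2 * i + 1)%nat) n = @sum_n C_AbelianMonoid u (2 * n + 1)).
  { clear Hn. induction n as [|n IH].
    - rewrite sum_O. simpl (2 * 0 + 1)%nat. rewrite sum_Sn, sum_O. pose proof (Hu O) as H0. simpl in H0.
      rewrite H0. symmetry. apply (Cplus_0_l (u 1%nat)).
    - rewrite sum_Sn, IH. replace (2 * S n + 1)%nat with (S (S (2 * n + 1))) by lia.
      rewrite !sum_Sn. replace (S (2 * n + 1)) with (2 * S n)%nat by lia. rewrite Hu.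
      eqC. change (@plus C_AbelianMonoid) with Cplus. ring. }
  specialize (HN (2 * n + 1)%nat ltac:(lia)).
  change (P (@sum_n C_AbelianMonoid u (2 * n + 1))) in HN. rewrite <- E in HN. exact HN.
Qed.

Lemma is_cs_sum (u : nat -> nat -> C) (l : nat -> C) (n : nat) :
  (forall i, is_cs (u i) (l i)) ->
  is_cs (fun k => @sum_n C_AbelianMonoid (fun i => u i k) n) (@sum_n C_AbelianMonoid l n).
Proof.
  intros H. induction n as [|n IH].
  - rewrite sum_O. apply is_cs_ext with (u O); [intros k; now rewrite sum_O|apply H].
  - rewrite sum_Sn. eapply is_cs_ext; [|apply is_cs_plus; [exact IH|apply (H (S n))]].
    intros k. now rewrite sum_Sn.
Qed.

Lemma is_cs_split (u : nat -> C) (l : C) (n : nat) : is_cs u l ->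
  is_cs (fun i => u (S n + i)%nat) (l - @sum_n C_AbelianMonoid u n).
Proof.
  intros H. apply (@is_series_incr_n C_AbsRing C_NormedModule u (S n) (l - @sum_n C_AbelianMonoid u n)); [lia|].
  match goal with |- is_series _ ?x => replace x with l; [exact H|] end.
  change (l = l - @sum_n C_AbelianMonoid u n + @sum_n C_AbelianMonoid u n). ring.
Qed.

Lemma is_cs_lim (u : nat -> C) (l : C) :
  is_lim_seq (fun n => Cmod (@sum_n C_AbelianMonoid u n - l)) 0 -> is_cs u l.
Proof.
  intros H P [eps HP].
  destruct (H (fun x => x < eps)%R) as [N HN].
  { exists eps. intros y Hy. unfold ball in Hy; simpl in Hy; unfold AbsRing_ball in Hy; simpl in Hy.
    unfold abs, minus, plus, opp in Hy; simpl in Hy. rewrite Ropp_0, Rplus_0_r in Hy.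
    eapply Rle_lt_trans; [apply Rle_abs|exact Hy]. }
  exists N. intros n Hn. apply HP. apply C_NormedModule_mixin_compat1. now apply HN.
Qed.

(** * Continuation of zeta to the left half-plane *)

Definition binom_pow (j k : nat) (s : C) : C :=
  Cbinom (1 - s) j * Cexp ((1 - s) * RtoC (ln (INR (S k)))).

(** With K = k + 1, this is twice the term of degree 2i + 1 in x = 1/(2K) of K^(1-s) (1 + x)^(1-s).
    Even degrees cancel in (K + 1/2)^(1-s) - (K - 1/2)^(1-s) and odd ones double. *)
Definition zterm (i k : nat) (s : C) : C :=
  RtoC (2 * (/ (2 * INR (S k))) ^ (2 * i + 1)) * binom_pow (2 * i + 1) k s.

Definition zcoef (i : nat) (s : C) : C := RtoC (/ 4 ^ i) * Cbinom (1 - s) (2 * i + 1).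

(** 2 (2K)^(-2i-1) K^(1-s) = 4^(-i) K^(-s-2i), so that for Re s > 1 the sum over k at fixed i is a
    multiple of zeta(s + 2i). *)
Lemma zterm_dirichlet (i k : nat) (s : C) :
  zterm i k s = zcoef i s * Cpower (INR (S k)) (- (s + RtoC (2 * INR i))).
Proof.
  pose proof (INR_S_pos k) as Hk. rewrite Cpower_pos by auto.
  set (L := RtoC (ln (INR (S k)))).
  replace (- (s + RtoC (2 * INR i)) * L) with ((1 - s) * L + - RtoC (INR (2 * i + 1)) * L).
  2:{ rewrite plus_INR, mult_INR, !RtoC_plus, !RtoC_mult. simpl INR. rewrite !RtoC_plus. ring. }
  rewrite Cexp_plus. unfold L. rewrite Cexp_ln_pow_inv by auto. fold L.
  unfold zterm, zcoef, binom_pow. fold L.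
  replace (2 * (/ (2 * INR (S k))) ^ (2 * i + 1))%R with (/ 4 ^ i * / INR (S k) ^ (2 * i + 1))%R.
  - rewrite RtoC_mult. ring.
  - rewrite pow_inv, Rpow_mult_distr, !pow_add, !pow_1, (pow_mult 2 2 i).
    replace (2 ^ 2)%R with 4%R by ring. field.
    repeat split; try apply pow_nonzero; lra.
Qed.

Lemma zterm_sum (k : nat) (s : C) :
  is_cs (fun i => zterm i k s)
    (Cexp ((1 - s) * RtoC (ln (INR (S k) + / 2))) - Cexp ((1 - s) * RtoC (ln (INR k + / 2)))).
Proof.
  pose proof (INR_S_ge1 k) as Hk. set (x := (/ (2 * INR (S k)))%R).
  assert (Hx : (0 < x <= / 2)%R).
  { split; [apply Rinv_0_lt_compat; lra|]. apply Rinv_le_contravar; lra. }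
  pose proof (binomial_series (1 - s) x ltac:(rewrite Rabs_pos_eq; lra)) as H1.
  pose proof (binomial_series (1 - s) (- x) ltac:(rewrite Rabs_Ropp, Rabs_pos_eq; lra)) as H2.
  set (E := Cexp ((1 - s) * RtoC (ln (INR (S k))))).
  pose proof (is_cs_scal E _ _ (is_cs_plus _ _ _ _ H1 (is_cs_scal (-1) _ _ H2))) as H3.
  cbv beta in H3.
  apply is_cs_odd in H3.
  - replace (Cexp ((1 - s) * RtoC (ln (INR (S k) + / 2))) - Cexp ((1 - s) * RtoC (ln (INR k + / 2))))
      with (E * (Cexp ((1 - s) * RtoC (ln (1 + x))) + -1 * Cexp ((1 - s) * RtoC (ln (1 + - x))))).
    + revert H3. apply is_cs_ext. intros i. unfold zterm, binom_pow. fold E. fold x.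
      replace ((- x) ^ (2 * i + 1))%R with (- x ^ (2 * i + 1))%R.
      * rewrite RtoC_opp, RtoC_mult. ring.
      * rewrite !pow_add, !pow_1, !pow_mult. replace ((- x) ^ 2)%R with (x ^ 2)%R by ring. ring.
    + replace (E * (Cexp ((1 - s) * RtoC (ln (1 + x))) + -1 * Cexp ((1 - s) * RtoC (ln (1 + - x)))))
       with (E * Cexp ((1 - s) * RtoC (ln (1 + x))) - E * Cexp ((1 - s) * RtoC (ln (1 + - x)))) by ring.
      unfold E. rewrite <- !Cexp_plus, <- !Cmult_plus_distr_l, <- !RtoC_plus, <- !ln_mult by lra.
      assert (INR (S k) * (1 + x) = INR (S k) + / 2)%R as -> by (unfold x; field; lra).
      assert (INR (S k) * (1 + - x) = INR k + / 2)%R as ->; [|reflexivity].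
      replace (INR k) with (INR (S k) - 1)%R by (rewrite S_INR; ring). unfold x; field; lra.
  - intros i. replace ((- x) ^ (2 * i))%R with (x ^ (2 * i))%R; [ring|].
    rewrite !pow_mult. f_equal. ring.
Qed.

Lemma half_powers_telescope (s : C) : (1 < Re s)%R ->
  is_cs (fun k => Cexp ((1 - s) * RtoC (ln (INR (S k) + / 2))) - Cexp ((1 - s) * RtoC (ln (INR k + / 2))))
    (- Cexp ((1 - s) * RtoC (ln (/ 2)))).
Proof.
  intros Hs. apply is_cs_lim.
  apply is_lim_seq_ext with (fun n => exp ((1 - Re s) * ln (INR (S n) + / 2))).
  - intros n.
    assert (E : @sum_n C_AbelianMonoid (fun k => Cexp ((1 - s) * RtoC (ln (INR (S k) + / 2))) - Cexp ((1 - s) * RtoC (ln (INR k + / 2)))) n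
      = Cexp ((1 - s) * RtoC (ln (INR (S n) + / 2))) - Cexp ((1 - s) * RtoC (ln (/ 2)))).
    { induction n as [|n IH].
      - rewrite sum_O. simpl (INR 0). now rewrite Rplus_0_l.
      - rewrite sum_Sn, IH. change (@plus C_AbelianMonoid) with Cplus. eqC. ring. }
    rewrite E.
    match goal with |- _ = Cmod ?w => replace w with (Cexp ((1 - s) * RtoC (ln (INR (S n) + / 2)))) by ring end.
    rewrite Cmod_Cexp, re_scal_r. f_equal.
  - apply is_lim_seq_incr_1 with (u := fun n => exp ((1 - Re s) * ln (INR n + / 2))).
    apply is_lim_comp_seq with (f := exp) (x := m_infty).
    + apply is_lim_exp_m.
    + now exists O.
    + replace m_infty with (Rbar_mult (1 - Re s)%R p_infty).
      * apply is_lim_seq_scal_l.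
        apply is_lim_comp_seq with (f := ln) (x := p_infty).
        -- apply is_lim_ln_p.
        -- now exists O.
        -- apply is_lim_seq_plus with p_infty (/ 2)%R; [apply is_lim_seq_INR|apply is_lim_seq_const|easy].
      * simpl. destruct (Rle_dec 0 (1 - Re s)) as [Hr|Hr]; [|reflexivity].
        exfalso; lra.
Qed.

Lemma maj_Cexp (s0 : C) (L : R) :
  maj (fun s => Cexp ((1 - s) * RtoC L)) s0 1 (exp ((1 - Re s0) * L + Rabs L)).
Proof.
  set (E := Cexp ((1 - s0) * RtoC L)).
  exists (fun j => E * (RtoC (- L) ^ j * RtoC (/ INR (fact j)))).
  assert (H : is_series (fun j => Cmod (E * (RtoC (- L) ^ j * RtoC (/ INR (fact j)))) * 1 ^ j)%R
     (exp ((1 - Re s0) * L + Rabs L))).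
  { rewrite exp_plus.
    apply is_series_ext with (fun j => scal (Cmod E) (Rabs L ^ j * / INR (fact j))%R).
    - intros j. rewrite pow1, Rmult_1_r, !Cmod_mult, Cmod_pow, !Cmod_R, Rabs_Ropp.
      rewrite (Rabs_pos_eq (/ _)) by (left; apply Rinv_0_lt_compat, INR_fact_lt_0). reflexivity.
    - replace (exp ((1 - Re s0) * L)) with (Cmod E).
      + apply @is_series_scal. pose proof (proj1 (is_pseries_R _ _ _) (is_exp_Reals (Rabs L))) as H.
        revert H. apply is_series_ext. intros j. apply Rmult_comm.
      + unfold E. rewrite Cmod_Cexp, re_scal_r. reflexivity. }
  split; [|split].
  - eexists; exact H.
  - rewrite (is_series_unique _ _ H). lra.
  - intros h _.
    replace ((1 - (s0 + h)) * RtoC L) with ((1 - s0) * RtoC L + RtoC (- L) * h) by (rewrite RtoC_opp; ring).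
    rewrite Cexp_plus. fold E.
    eapply is_cs_ext; [|apply is_cs_scal, Cexp_series].
    intros j. cbv beta. rewrite Cpow_mult_l. ring.
Qed.

(** On the unit disc about s0 one has |1 - s - j| <= |1 - s0| + 1 + j, which are the factors of
    [asc]. The disc also raises the exponent of the power of k + 1 from 1 - Re s0 to 2 - Re s0. *)
Lemma maj_binom_pow (j k : nat) (s0 : C) :
  maj (binom_pow j k) s0 1 (asc (Cmod (1 - s0) + 1) j * exp ((2 - Re s0) * ln (INR (S k)))).
Proof.
  assert (HL : (0 <= ln (INR (S k)))%R).
  { rewrite <- ln_1. apply ln_le; [lra|apply INR_S_ge1]. }
  induction j as [|j IH].
  - apply maj_ext with (fun s => Cexp ((1 - s) * RtoC (ln (INR (S k))))).
    + intros s. unfold binom_pow. simpl. ring.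
    + simpl asc. rewrite Rmult_1_l. pose proof (maj_Cexp s0 (ln (INR (S k)))) as H.
      rewrite Rabs_pos_eq in H by auto.
      replace ((2 - Re s0) * ln (INR (S k)))%R with ((1 - Re s0) * ln (INR (S k)) + ln (INR (S k)))%R by ring.
      exact H.
  - apply (maj_lin _ _ (1 - RtoC (INR j)) (-1)) in IH; [|lra].
    apply (maj_scal (RtoC (/ INR (S j)))) in IH; [|lra].
    apply maj_ext with (g := binom_pow (S j) k) in IH.
    + apply maj_weaken with (3 := IH); [lra|].
      pose proof (INR_S_pos j). assert (0 < / INR (S j))%R by now apply Rinv_0_lt_compat.
      rewrite Cmod_R, (Rabs_pos_eq (/ _)) by lra. cbn [asc].
      set (A := asc _ j). set (X := exp _).
      replace ((Cmod (1 - s0) + 1 + INR j) * A * / INR (S j) * X)%R with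
        (/ INR (S j) * ((Cmod (1 - s0) + 1 + INR j) * (A * X)))%R by ring.
      apply Rmult_le_compat_l; [lra|]. apply Rmult_le_compat_r.
      * apply Rmult_le_pos; [left; apply asc_pos; pose proof (Cmod_ge_0 (1 - s0)); lra|left; apply exp_pos].
      * rewrite Cmod_R. replace (Rabs (-1)) with 1%R by (rewrite Rabs_left; lra).
        replace (1 - RtoC (INR j) + -1 * s0) with ((1 - s0) + - RtoC (INR j)) by ring.
        pose proof (Cmod_triangle (1 - s0) (- RtoC (INR j))).
        rewrite Cmod_opp, Cmod_R, (Rabs_pos_eq (INR j)) in H1 by apply pos_INR. lra.
    + intros s. unfold binom_pow. cbn [Cbinom]. ring.
Qed.

Lemma ex_series_arith_subseq (a : nat -> R) (c : nat) : (forall j, 0 <= a j)%R -> ex_series a ->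
  ex_series (fun i => a (2 * i + c)%nat).
Proof.
  intros Ha He. apply ex_series_bounded with (Series a); [intros; apply Ha|].
  intros n. apply Rle_trans with (sum_n a (2 * n + c)); [|now apply sum_n_le_Series].
  induction n as [|n IH].
  - rewrite sum_O. simpl Nat.mul. rewrite Nat.add_0_l. destruct c; [rewrite sum_O; lra|].
    rewrite sum_Sn. unfold plus; simpl.
    enough (0 <= sum_n a c)%R by lra. rewrite sum_n_Reals. apply cond_pos_sum; auto.
  - assert (E : (2 * S n + c = S (S (2 * n + c)))%nat) by lia. rewrite E, !sum_Sn, <- E.
    apply Rplus_le_compat_r. apply Rle_trans with (1 := IH).
    rewrite <- (Rplus_0_r (sum_n a (2 * n + c))) at 1. apply Rplus_le_compat_l, Ha.
Qed.

Definition zterm_bound (rho sigma : R) (i k : nat) : R :=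
  (2 * (/ (2 * INR (S k))) ^ (2 * i + 1) * (asc rho (2 * i + 1) * exp ((2 - sigma) * ln (INR (S k)))))%R.

Lemma maj_zterm (i k : nat) (s0 : C) :
  maj (zterm i k) s0 1 (zterm_bound (Cmod (1 - s0) + 1) (Re s0) i k).
Proof.
  pose proof (maj_scal (RtoC (2 * (/ (2 * INR (S k))) ^ (2 * i + 1))) _ _ _ _ Rle_0_1
    (maj_binom_pow (2 * i + 1) k s0)) as H.
  pose proof (INR_S_pos k).
  rewrite Cmod_R, Rabs_pos_eq in H; [exact H|].
  apply Rmult_le_pos; [lra|]. apply pow_le. left; apply Rinv_0_lt_compat; lra.
Qed.

(** With K = k + 1, a degree of at least 2n + 3 in 1/K against a growth of at most K^(2n+1) leaves
    K^(-2), and the powers of 1/2 make the [asc] coefficients summable. The bound 1 - 2n on the real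
    part originates here. *)
Lemma zterm_bound_le (rho sigma : R) (n i k : nat) : (0 < rho)%R ->
  (1 - 2 * INR n <= sigma)%R ->
  (0 <= zterm_bound rho sigma (S n + i) k <=
   / INR (S k) ^ 2 * (2 * (asc rho (2 * i + (2 * n + 3)) * (/ 2) ^ (2 * i + (2 * n + 3)))))%R.
Proof.
  intros Hrho Hs. pose proof (INR_S_ge1 k) as Hk. unfold zterm_bound.
  replace (2 * (S n + i) + 1)%nat with (2 * i + (2 * n + 3))%nat by lia.
  set (j := (2 * i + (2 * n + 3))%nat).
  pose proof (asc_pos rho j Hrho) as Ha.
  assert (HL : (0 <= ln (INR (S k)))%R) by (rewrite <- ln_1; apply ln_le; lra).
  set (K := INR (S k)) in *.
  assert (HX : (exp ((2 - sigma) * ln K) <= K ^ (2 * n + 1))%R).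
  { rewrite <- (Rpower_pow (2 * n + 1)) by lra. unfold Rpower.
    assert (H : ((2 - sigma) * ln K <= INR (2 * n + 1) * ln K)%R).
    { apply Rmult_le_compat_r; auto. rewrite plus_INR, mult_INR. simpl INR. lra. }
    destruct H as [H|H]; [left; now apply exp_increasing|right; now rewrite H]. }
  assert (HX0 : (0 < exp ((2 - sigma) * ln K))%R) by apply exp_pos.
  set (X := exp _) in *.
  assert (H2 : (0 < (/ 2) ^ j)%R) by (apply pow_lt; lra).
  assert (HKj : (0 < / K ^ j)%R) by (apply Rinv_0_lt_compat, pow_lt; lra).
  assert (Ex : ((/ (2 * K)) ^ j = (/ 2) ^ j * / K ^ j)%R).
  { rewrite Rinv_mult, Rpow_mult_distr, (pow_inv K). reflexivity. }
  rewrite Ex.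
  assert (HK : (/ K ^ j * X <= / K ^ 2)%R).
  { apply Rle_trans with (/ K ^ (2 * n + 3) * K ^ (2 * n + 1))%R.
    - apply Rmult_le_compat; try lra.
      apply Rinv_le_contravar; [apply pow_lt; lra|]. apply Rle_pow; [lra|unfold j; lia].
    - right. replace (2 * n + 3)%nat with ((2 * n + 1) + 2)%nat by lia. rewrite pow_add.
      field. repeat split; try (apply pow_nonzero); lra. }
  split.
  - repeat apply Rmult_le_pos; lra.
  - replace (2 * ((/ 2) ^ j * / K ^ j) * (asc rho j * X))%R with
      ((/ K ^ j * X) * (2 * (asc rho j * (/ 2) ^ j)))%R by ring.
    apply Rmult_le_compat_r; [|exact HK]. nra.
Qed.

Definition zeta_tail (n : nat) (s : C) : C :=
  CSeries (fun k => CSeries (fun i => zterm (S n + i) k s)).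

(** [maj_series] is applied twice, over i at fixed k and then over k. *)
Lemma maj_zeta_tail (n : nat) (s0 : C) : (1 - 2 * INR n <= Re s0)%R ->
  (exists N, maj (zeta_tail n) s0 1 N) /\
  is_cs (fun k => CSeries (fun i => zterm (S n + i) k s0)) (zeta_tail n s0).
Proof.
  intros Hs. set (rho := (Cmod (1 - s0) + 1)%R).
  assert (Hrho : (0 < rho)%R) by (unfold rho; pose proof (Cmod_ge_0 (1 - s0)); lra).
  set (A := fun i => (2 * (asc rho (2 * i + (2 * n + 3)) * (/ 2) ^ (2 * i + (2 * n + 3))))%R).
  assert (HA : ex_series A).
  { apply (@ex_series_scal R_AbsRing R_NormedModule 2).
    apply (ex_series_arith_subseq (fun j => asc rho j * (/ 2) ^ j)%R).
    - intros j. apply Rmult_le_pos; [left; now apply asc_pos|apply pow_le; lra].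
    - apply ex_series_asc; lra. }
  set (b := fun k i => zterm_bound rho (Re s0) (S n + i) k).
  assert (Hb : forall k i, (0 <= b k i <= / INR (S k) ^ 2 * A i)%R).
  { intros k i. apply zterm_bound_le; auto. }
  assert (HbA : forall k, ex_series (fun i => / INR (S k) ^ 2 * A i)%R).
  { intros k. now apply (@ex_series_scal R_AbsRing R_NormedModule (/ INR (S k) ^ 2)%R). }
  assert (Hbk : forall k, ex_series (b k)).
  { intros k. apply ex_series_Rle with (2 := HbA k). intros i. rewrite Rabs_pos_eq; apply Hb. }
  assert (Hbs : ex_series (fun k => Series (b k))).
  { apply ex_series_Rle with (fun k => / INR (S k) ^ 2 * Series A)%R.
    - intros k. rewrite Rabs_pos_eq by (apply Series_pos; [apply Hb|auto]).
      rewrite <- Series_scal_l. apply Series_le; auto.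
    - apply ex_series_scal_r, ex_series_inv_sq. }
  assert (Hin : forall k, maj (fun s => CSeries (fun i => zterm (S n + i) k s)) s0 1 (Series (b k))).
  { intros k. apply (maj_series (fun i => zterm (S n + i) k)); [lra| |auto].
    intros i. apply maj_zterm. }
  split.
  - exists (Series (fun k => Series (b k))).
    apply (maj_series (fun k s => CSeries (fun i => zterm (S n + i) k s))); [lra|auto|auto].
  - pose proof (maj_series_correct _ _ _ _ Hin Hbs 0 ltac:(rewrite Cmod_0; lra)) as H.
    cbv beta in H. replace (s0 + 0) with s0 in H by ring. exact H.
Qed.

(** The exponential is 2^(s-1), moved to the left so that the relation becomes the vanishing of a
    function to which the identity theorem applies. *)
Definition zeta_relation (zeta : C -> C) (n : nat) (s : C) : C :=
  @sum_n_m C_AbelianMonoid (fun i => zcoef i s * zeta (s + RtoC (2 * INR i))) 0 n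
  + (zeta_tail n s + Cexp ((1 - s) * RtoC (ln (/ 2)))).

(** At fixed k, the terms with i <= n and the tail add up to the difference of half-integer powers,
    and these differences telescope over k. Only finitely many values of i take part in the exchange
    with the sum over k. *)
Lemma zeta_relation_half_plane (zeta : C -> C) (n : nat) (s : C) :
  is_riemann_zeta zeta -> (1 < Re s)%R -> zeta_relation zeta n s = 0.
Proof.
  intros [_ Hz] Hs.
  assert (H1 : forall i, is_cs (fun k => zterm i k s) (zcoef i s * zeta (s + RtoC (2 * INR i)))).
  { intros i. eapply is_cs_ext; [|apply is_cs_scal, Hz].
    - intros k. symmetry. apply zterm_dirichlet.
    - rewrite re_plus, re_RtoC. pose proof (pos_INR i). lra. }
  destruct (maj_zeta_tail n s) as [_ H2].
  { pose proof (pos_INR n). lra. }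
  pose proof (is_cs_plus _ _ _ _ (is_cs_sum _ _ n H1) H2) as H3.
  pose proof (half_powers_telescope s Hs) as H4.
  assert (E : @sum_n C_AbelianMonoid (fun i => zcoef i s * zeta (s + RtoC (2 * INR i))) n + zeta_tail n s
     = - Cexp ((1 - s) * RtoC (ln (/ 2)))).
  { rewrite <- (is_cs_unique _ _ H3), <- (is_cs_unique _ _ H4). apply CSeries_ext. intros k.
    rewrite (is_cs_unique _ _ (is_cs_split _ _ n (zterm_sum k s))).
    match goal with |- ?x + (?y - ?x') = ?y => change x' with x; ring end. }
  unfold zeta_relation, sum_n in *. rewrite Cplus_assoc, E. ring.
Qed.

Lemma analytic_Cbinom (f : C -> C) (j : nat) (s0 : C) :
  analytic_at f s0 -> analytic_at (fun s => Cbinom (1 - s) j * f s) s0.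
Proof.
  intros Hf. induction j as [|j IH].
  - apply analytic_ext with f; [intros; simpl; ring|exact Hf].
  - apply (analytic_lin _ _ (1 - RtoC (INR j)) (-1)) in IH.
    apply (analytic_scal (RtoC (/ INR (S j)))) in IH.
    revert IH. apply analytic_ext. intros s. cbn [Cbinom]. ring.
Qed.

Lemma zeta_relation_analytic (zeta : C -> C) (n : nat) (s0 : C) :
  is_riemann_zeta zeta -> (1 - 2 * INR n <= Re s0)%R ->
  (forall i, s0 + RtoC (2 * INR i) <> 1) -> analytic_at (zeta_relation zeta n) s0.
Proof.
  intros [Hz _] Hs Hi.
  apply (analytic_plus
    (fun s => @sum_n_m C_AbelianMonoid (fun i => zcoef i s * zeta (s + RtoC (2 * INR i))) 0 n)
    (fun s => zeta_tail n s + Cexp ((1 - s) * RtoC (ln (/ 2)))));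
    [|apply (analytic_plus (zeta_tail n) (fun s => Cexp ((1 - s) * RtoC (ln (/ 2)))))].
  - apply (analytic_sum (fun i s => zcoef i s * zeta (s + RtoC (2 * INR i)))).
    intros i.
    apply analytic_ext with (fun s => RtoC (/ 4 ^ i) * (Cbinom (1 - s) (2 * i + 1) * zeta (s + RtoC (2 * INR i)))).
    + intros s. unfold zcoef. ring.
    + apply analytic_scal, (analytic_Cbinom (fun s => zeta (s + RtoC (2 * INR i)))).
      apply analytic_shift, Hz, Hi.
  - destruct (maj_zeta_tail n s0 Hs) as [[N HN] _]. apply maj_analytic with 1%R N; [lra|exact HN].
  - apply maj_analytic with (2 := maj_Cexp s0 (ln (/ 2))). lra.
Qed.

Lemma Cbinom_nat (N j : nat) : (j <= N)%nat -> Cbinom (RtoC (INR N)) j = RtoC (Binomial.C N j).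
Proof.
  induction j as [|j IH]; intros Hj.
  - simpl. f_equal. unfold Binomial.C. rewrite Nat.sub_0_r. simpl. field. apply INR_fact_neq_0.
  - cbn [Cbinom]. rewrite IH by lia. rewrite <- RtoC_minus, <- !RtoC_mult. f_equal.
    unfold Binomial.C. replace (N - j)%nat with (S (N - S j)) by lia.
    rewrite !fact_simpl, !mult_INR, <- minus_INR by lia.
    replace (N - j)%nat with (S (N - S j)) by lia.
    pose proof (INR_fact_neq_0 j). pose proof (INR_fact_neq_0 (N - S j)).
    pose proof (INR_S_pos j). pose proof (INR_S_pos (N - S j)). field. lra.
Qed.

Lemma Cbinom_nat_zero (N j : nat) : (N < j)%nat -> Cbinom (RtoC (INR N)) j = 0.
Proof.
  induction 1 as [|j Hj IH]; cbn [Cbinom].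
  - replace (RtoC (INR N) - RtoC (INR N)) with (RtoC 0) by ring. ring.
  - rewrite IH. ring.
Qed.

Lemma sum_n_m_C_zero (f : nat -> C) (a b : nat) :
  (forall i, (a <= i <= b)%nat -> f i = 0) -> @sum_n_m C_AbelianMonoid f a b = RtoC 0.
Proof.
  intros H. rewrite (sum_n_m_ext_loc _ (fun _ => zero)) by exact H.
  exact (@sum_n_m_const_zero C_AbelianMonoid a b).
Qed.

(* The relation is singular at s = 1 - 2i; the line of direction 1 + i through -2J
   avoids all these points and enters the half-plane Re s > 1. *)
Lemma zeta_even_relation (zeta : C -> C) (J : nat) : is_riemann_zeta zeta ->
  @sum_n_m C_AbelianMonoid (fun i => RtoC (/ 4 ^ i) * Cbinom (RtoC (INR (2 * J + 1))) (2 * i + 1) *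
    zeta (RtoC (2 * INR i - 2 * INR J)%R)) 0 J = RtoC (- / 2 ^ (2 * J + 1)).
Proof.
  intros Hz. set (q := RtoC (- (2 * INR J))).
  (* This T gives Re p = 2, so the disc of radius 1/2 about p lies in Re s > 1. The relation is cut
     at J + 1, whose domain Re s >= -2J - 1 contains the whole segment. *)
  set (T := (2 * INR J + 2)%R). assert (HT : (2 <= T)%R) by (unfold T; pose proof (pos_INR J); lra).
  set (p := q + RtoC T * (1, 1)%R).
  assert (Hq : zeta_relation zeta (S J) q = 0).
  { destruct (identity_segment (zeta_relation zeta (S J)) p q) as [e [He H]].
    - intros t Ht.
      replace (p + RtoC t * (q - p)) with (q + RtoC ((1 - t) * T) * (1, 1)%R).
      2:{ unfold p. rewrite RtoC_mult, RtoC_minus. ring. }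
      set (u := ((1 - t) * T)%R). assert (Hu : (0 <= u)%R) by (unfold u; nra).
      apply zeta_relation_analytic; [exact Hz| |].
      + rewrite re_plus, re_scal_l. unfold q. rewrite re_RtoC. simpl Re. rewrite S_INR. lra.
      (* Meeting the pole forces u = 0 by the imaginary part, and then 2i = 2J + 1, which parity
         excludes. *)
      + intros i E. pose proof (f_equal Im E) as E2. pose proof (f_equal Re E) as E1.
        unfold q in E1, E2. simpl in E1, E2.
        assert (u = 0)%R by lra.
        assert (E3 : (2 * INR i = 1 + 2 * INR J)%R) by nra.
        assert (E4 : INR (2 * i) = INR (1 + 2 * J)) by (rewrite plus_INR, !mult_INR; simpl; lra).
        apply INR_eq in E4. lia.
    - exists (/ 2)%R. split; [lra|]. intros s Hs. apply zeta_relation_half_plane; auto.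
      pose proof (re_le_Cmod (s - p)) as H1.
      assert (H2 : Re p = 2%R).
      { unfold p, q. rewrite re_plus, re_RtoC, re_scal_l. simpl Re. unfold T. ring. }
      change (Re (s - p)) with (Re s + - Re p)%R in H1. rewrite H2 in H1.
      apply Rabs_le_between in H1. lra.
    - apply H. replace (q - q) with (RtoC 0) by ring. now rewrite Cmod_0. }
  assert (E1 : 1 - q = RtoC (INR (2 * J + 1))).
  { unfold q. rewrite <- RtoC_minus. f_equal. rewrite plus_INR, mult_INR. simpl. ring. }
  assert (Hzero : forall i, (J < i)%nat -> Cbinom (1 - q) (2 * i + 1) = 0).
  { intros i Hi. rewrite E1. apply Cbinom_nat_zero. lia. }
  assert (Htail : zeta_tail (S J) q = 0).
  { unfold zeta_tail. apply is_cs_unique, is_cs_zero. intros k.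
    apply is_cs_unique, is_cs_zero. intros i. unfold zterm, binom_pow.
    rewrite Hzero by lia. ring. }
  unfold zeta_relation in Hq. rewrite Htail, E1 in Hq.
  rewrite Cexp_ln_pow, pow_inv in Hq by lra.
  rewrite sum_n_Sm in Hq by lia.
  unfold zcoef in Hq at 2. rewrite (Hzero (S J)) in Hq by lia.
  rewrite RtoC_opp.
  match type of Hq with @plus _ ?x ?y + (?v + ?w) = _ =>
    assert (Hq' : x + w = 0) by (rewrite <- Hq; change (@plus C_AbelianMonoid x y) with (x + y); ring);
    set (X := x) in Hq' end.
  transitivity X.
  - unfold X. apply sum_n_m_ext. intros i. unfold zcoef. rewrite E1. do 2 f_equal.
    unfold q. rewrite <- RtoC_plus. f_equal. ring.
  - apply Ceq_minus. rewrite <- Hq'. ring.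
Qed.

Lemma zeta_0 (zeta : C -> C) : is_riemann_zeta zeta -> zeta 0 = RtoC (- (1 / 2)).
Proof.
  intros Hz. pose proof (zeta_even_relation zeta 0 Hz) as H.
  rewrite sum_n_n in H. simpl in H.
  replace (2 * 0 - 2 * 0)%R with 0%R in H by ring.
  rewrite !Rinv_1 in H.
  replace (- (1 / 2))%R with (- / (2 * 1))%R by field. rewrite <- H. ring.
Qed.

(** In the relation at -2J the terms with 0 < i < J vanish by induction, and the term i = J, with
    zeta(0) = -1/2, already equals the right-hand side. What remains is (2J + 1) zeta(-2J) = 0. *)
Lemma zeta_trivial_zeros (zeta : C -> C) (J : nat) : is_riemann_zeta zeta -> (1 <= J)%nat ->
  zeta (RtoC (- (2 * INR J))) = 0.
Proof.
  intros Hz. induction J as [J IH] using lt_wf_ind. intros HJ.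
  pose proof (zeta_even_relation zeta J Hz) as H.
  destruct J as [|J]; [lia|].
  rewrite sum_n_Sm in H by lia.
  rewrite sum_Sn_m in H by lia.
  rewrite sum_n_m_C_zero in H.
  2:{ intros i Hi. replace (2 * INR i - 2 * INR (S J))%R with (- (2 * INR (S J - i)))%R.
      - rewrite IH by lia. ring.
      - rewrite minus_INR by lia. ring. }
  replace (2 * INR (S J) - 2 * INR (S J))%R with 0%R in H by ring.
  rewrite (zeta_0 zeta Hz) in H.
  rewrite !Cbinom_nat in H by lia.
  replace (Binomial.C (2 * S J + 1) (2 * S J + 1)) with 1%R in H.
  2:{ unfold Binomial.C. rewrite Nat.sub_diag. simpl (INR (fact 0)). field. apply INR_fact_neq_0. }
  replace (Binomial.C (2 * S J + 1) (2 * 0 + 1)) with (INR (2 * S J + 1)) in H.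
  2:{ unfold Binomial.C. replace (2 * S J + 1)%nat with (S (2 * S J)) by lia.
      replace (S (2 * S J) - (2 * 0 + 1))%nat with (2 * S J)%nat by lia.
      rewrite (fact_simpl (2 * S J)), mult_INR. simpl (INR (fact (2 * 0 + 1))). field. apply INR_fact_neq_0. }
  replace (2 * INR 0 - 2 * INR (S J))%R with (- (2 * INR (S J)))%R in H by (simpl (INR 0); ring).
  set (Z := zeta _) in *.
  match type of H with @plus _ (@plus _ ?x ?v) ?y = ?w => change (x + v + y = w) in H end.
  simpl (4 ^ 0)%R in H. rewrite Rinv_1, Cplus_0_r, !Cmult_1_l in H.
  assert (E : (- / 2 ^ (2 * S J + 1) = / 4 ^ S J * 1 * - (1 / 2))%R).
  { rewrite pow_add, pow_mult, pow_1. replace (2 ^ 2)%R with 4%R by ring. field. apply pow_nonzero; lra. }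
  rewrite E, !RtoC_mult in H.
  assert (H' : RtoC (INR (2 * S J + 1)) * Z = 0).
  { apply (f_equal (fun w => w - RtoC (/ 4 ^ S J) * 1 * RtoC (- (1 / 2)))) in H.
    ring_simplify in H. rewrite <- H. ring. }
  destruct (classic (Z = 0)) as [HZ|HZ]; [exact HZ|].
  exfalso. apply (Cmult_neq_0 (RtoC (INR (2 * S J + 1))) Z); auto.
  intros E2. apply RtoC_inj in E2. revert E2. apply not_0_INR. lia.
Qed.

(** * Bernoulli sums *)

Lemma sum_even_C (f : nat -> C) (N : nat) :
  (forall k, (k < N)%nat -> f (2 * k + 1)%nat = 0) ->
  @sum_n_m C_AbelianMonoid f 0 (2 * N) = @sum_n_m C_AbelianMonoid (fun k => f (2 * k)%nat) 0 N.
Proof.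
  induction N as [|N IH]; intros Hf; [rewrite !sum_n_n; reflexivity|].
  rewrite (sum_n_Sm (fun k => f (2 * k)%nat)) by lia. rewrite <- IH by (intros; apply Hf; lia).
  replace (2 * S N)%nat with (S (S (2 * N))) by lia. rewrite !sum_n_Sm by lia.
  replace (S (2 * N)) with (2 * N + 1)%nat at 1 by lia. rewrite Hf by lia.
  f_equal. apply (Cplus_0_r (@sum_n_m C_AbelianMonoid f 0 (2 * N))).
Qed.

Lemma neg1_pow_mul (a b : nat) : ((-1) ^ a * (-1) ^ b = (-1) ^ (a + b))%R.
Proof. now rewrite pow_add. Qed.

(** The signs and the powers of 2 pi multiply to a quantity free of k, so the binomially weighted
    Bernoulli products become zeta products with one common constant. *)
Lemma bernoulli_product (r k : nat) : (k <= S r)%nat ->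
  (Binomial.C (2 * S r) (2 * k) * bernoulli (2 * k) * bernoulli (2 * (S r - k)) =
   INR (fact (2 * S r)) * ((-1) ^ S r * 4 / (2 * PI) ^ (2 * S r)) * (zeta_even k * zeta_even (S r - k)))%R.
Proof.
  intros Hk. rewrite !bernoulli_even. unfold Binomial.C.
  replace (2 * S r - 2 * k)%nat with (2 * (S r - k))%nat by lia.
  assert (E1 : ((2 * PI) ^ (2 * S r) = (2 * PI) ^ (2 * k) * (2 * PI) ^ (2 * (S r - k)))%R).
  { rewrite <- pow_add. f_equal. lia. }
  assert (E2 : ((-1) ^ S r = (-1) ^ S k * (-1) ^ S (S r - k))%R).
  { rewrite neg1_pow_mul. replace (S k + S (S r - k))%nat with (S (S (S r))) by lia. simpl; ring. }
  rewrite E1, E2. pose proof PI_RGT_0.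
  field. repeat split; try apply INR_fact_neq_0; try (apply pow_nonzero; lra); lra.
Qed.

(** The weight g stays arbitrary because the formulas for psi and for g_{-n} weight the same
    products differently. *)
Lemma bernoulli_sum (r : nat) (g : nat -> C) : (1 <= r)%nat ->
  let n := (2 * r + 1)%nat in
  @sum_n_m C_AbelianMonoid (fun m => RtoC (Binomial.C (n + 1) m) * RtoC (bernoulli m) *
     RtoC (bernoulli (n + 1 - m)) * g m) 0 (n + 1) =
  RtoC (INR (fact (n + 1)) * ((-1) ^ S r * 4 / (2 * PI) ^ (2 * S r))) *
   @sum_n_m C_AbelianMonoid (fun k => RtoC (zeta_even k * zeta_even (S r - k)) * g (2 * k)%nat) 0 (S r).
Proof.
  intros Hr n. replace (n + 1)%nat with (2 * S r)%nat by (unfold n; lia).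
  rewrite sum_even_C.
  - symmetry. eapply eq_trans; [symmetry; apply (@sum_n_m_mult_l C_Ring)|].
    apply sum_n_m_ext_loc. intros k Hk.
    replace (2 * S r - 2 * k)%nat with (2 * (S r - k))%nat by lia.
    rewrite <- !RtoC_mult, bernoulli_product by lia.
    match goal with |- @mult _ ?x ?y = ?w => change (x * y = w) end.
    rewrite !RtoC_mult. ring.
  (* B_1 does not vanish, but for m = 1 its partner is B_{2r+1}, which does because r >= 1. *)
  - intros k Hk. destruct k as [|k].
    + rewrite (bernoulli_odd (2 * S r - (2 * 0 + 1))); [ring|lia|]. exists r. lia.
    + rewrite (bernoulli_odd (2 * S k + 1)); [ring|lia|]. now exists (S k).
Qed.

Lemma Ci_sq : Ci * Ci = - (1).
Proof. unfold Ci, Cmult, Copp; simpl. apply injective_projections; simpl; ring. Qed.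

(** The passage between the prefactors of the Bernoulli sums and of the zeta sums, common to both
    formulas. The sign of i^(2r+1) = (-1)^r i meets (-1)^(r+1), so the result is free of r. *)
Lemma two_pi_i_const (r : nat) :
  (2 * PI * Ci) ^ (2 * r + 1) * RtoC ((-1) ^ S r * 4 / (2 * PI) ^ (2 * S r)) = - RtoC (2 / PI) * Ci.
Proof.
  rewrite Cpow_mult_l, !Cpow_add_r, Cpow_mult_r, (Cpow_mult_r Ci).
  replace (Ci ^ 2) with (RtoC (-1)) by (simpl; rewrite Cmult_1_r, Ci_sq; now rewrite <- RtoC_opp).
  rewrite <- RtoC_mult, <- !RtoC_pow, <- RtoC_mult. simpl (Ci ^ 1). rewrite Cmult_1_r.
  transitivity (RtoC (((2 * PI) ^ 2) ^ r * (2 * PI) ^ 1 * (-1) ^ r * ((-1) ^ S r * 4 / (2 * PI) ^ (2 * S r))) * Ci).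
  - rewrite !RtoC_mult. ring.
  - rewrite <- RtoC_opp. do 2 f_equal. pose proof PI_RGT_0.
    rewrite (pow_mult (2 * PI) 2 (S r)). change (((2 * PI) ^ 2) ^ S r)%R with ((2 * PI) ^ 2 * ((2 * PI) ^ 2) ^ r)%R.
    change ((-1) ^ S r)%R with (-1 * (-1) ^ r)%R.
    assert (Hs : ((-1) ^ r * (-1) ^ r = 1)%R).
    { rewrite neg1_pow_mul. replace (r + r)%nat with (2 * r)%nat by lia. rewrite pow_mult.
      replace ((-1) ^ 2)%R with 1%R by ring. apply pow1. }
    assert (Hp : (((2 * PI) ^ 2) ^ r <> 0)%R) by (apply pow_nonzero; nra).
    set (P := (((2 * PI) ^ 2) ^ r)%R) in *.
    transitivity (- (((-1) ^ r * (-1) ^ r) * 2 / PI))%R; [field|rewrite Hs; field]; repeat split; lra.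
Qed.

(** * The function g *)

Lemma Ccos_RtoC (x : R) : Ccos (RtoC x) = RtoC (cos x).
Proof.
  unfold Ccos, Cexp, RtoC, Ci. simpl.
  replace (0 * x - 1 * 0)%R with 0%R by ring. replace (0 * 0 + 1 * x)%R with x by ring.
  rewrite Ropp_0, exp_0, cos_neg, sin_neg.
  apply injective_projections; simpl; field.
Qed.

(** The improper integral is an [iota], so its value is obtained by exhibiting the limit: every
    integral over a bounded interval is 0. *)
Lemma vertical_integral_zero (c : R) (f : C -> C) :
  (forall t, f (c, t) = 0) -> vertical_integral c f = 0.
Proof.
  intros Hf. unfold vertical_integral.
  rewrite (is_RInt_gen_unique (V := C_R_CompleteNormedModule) _ (0 : C)); [ring|].
  intros P HP. unfold filtermapi. apply filter_forall. intros ab. exists (0 : C). split.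
  - apply (is_RInt_ext (V := C_R_NormedModule) (fun _ => RtoC 0)).
    + intros t _. now rewrite Hf.
    + pose proof (is_RInt_const (V := C_R_NormedModule) (fst ab) (snd ab) (RtoC 0)) as H.

      assert (E : @scal R_AbsRing C_R_NormedModule (snd ab - fst ab)%R (RtoC 0) = RtoC 0)
        by exact (scal_zero_r (K := R_AbsRing) (V := C_R_NormedModule) (snd ab - fst ab)%R).
      exact (eq_ind _ (fun l => is_RInt (V := C_R_NormedModule) (fun _ => RtoC 0) (fst ab) (snd ab) l) H _ E).
  - now apply locally_singleton.
Qed.

(** For a = -(2r + 1) the argument 1 - 2k - a of zeta in the finite sum is 2(r + 1 - k), an even
    integer that is positive, zero or negative according to k. *)
Lemma zeta_int (zeta : C -> C) (r k : nat) : is_riemann_zeta zeta ->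
  zeta (RtoC (2 * (INR (S r) - INR k))) = if Nat.leb k (S r) then RtoC (zeta_even (S r - k)) else 0.
Proof.
  intros Hz. destruct (Nat.leb_spec k (S r)) as [Hk|Hk].
  - rewrite <- minus_INR by lia.
    destruct (S r - k)%nat as [|j] eqn:E.
    + simpl INR. rewrite Rmult_0_r. now rewrite (zeta_0 zeta Hz).
    + replace (2 * INR (S j))%R with (INR (2 * S j)) by (rewrite mult_INR; reflexivity).
      rewrite zeta_nat by (auto; lia). reflexivity.
  - replace (2 * (INR (S r) - INR k))%R with (- (2 * INR (k - S r)))%R by (rewrite minus_INR by lia; ring).
    apply zeta_trivial_zeros; [auto|lia].
Qed.

Lemma period_g_value (zeta : C -> C) (r M : nat) (z : C) : is_riemann_zeta zeta -> (1 <= r)%nat ->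
  (S r <= M)%nat ->
  period_g zeta (- INR (2 * r + 1)) M z =
  - RtoC (2 / PI) * @sum_n_m C_AbelianMonoid (fun k => RtoC (zeta_even k * zeta_even (S r - k)) * z ^ (2 * k - 1)) 1 (S r).
Proof.
  intros Hz Hr HM. unfold period_g. pose proof PI_RGT_0 as HPI.
  rewrite vertical_integral_zero.
  2:{ intros t.
      (* -(2r + 1)/2 = (-r - 1) + 1/2 brings the argument into the form of the zeros of cosine. The
         numerator is then 0, and with it the integrand at every point of the line. *)
      replace (PI * - INR (2 * r + 1) / 2) with (RtoC (IZR (- Z.of_nat r - 1) * PI + PI / 2)).
      - rewrite Ccos_RtoC, cos_eq_0_1 by (eexists; reflexivity). unfold Cdiv. ring.
      - replace (IZR (- Z.of_nat r - 1) * PI + PI / 2)%R with (PI * - INR (2 * r + 1) / 2)%R.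
        + unfold Rdiv, Cdiv. rewrite !RtoC_mult, RtoC_opp, RtoC_inv by lra. reflexivity.
        + rewrite minus_IZR, opp_IZR, <- INR_IZR_INZ, plus_INR, mult_INR. simpl. field. }
  rewrite Cmult_0_r, Cplus_0_r.
  rewrite (sum_n_m_ext_loc _ (fun k => mult (- RtoC (/ PI))
     (if Nat.leb k (S r) then RtoC (zeta_even k * zeta_even (S r - k)) * z ^ (2 * k - 1) else RtoC 0))).
  - rewrite (@sum_n_m_mult_l C_Ring).
    (* Beyond k = r + 1 the zeta factor is a trivial zero, so the value is the same for all
       admissible M. *)
    rewrite (sum_n_m_Chasles _ 1 (S r) M) by lia.
    rewrite (sum_n_m_C_zero _ (S (S r)) M).
    + rewrite (sum_n_m_ext_loc _ (fun k => RtoC (zeta_even k * zeta_even (S r - k)) * z ^ (2 * k - 1))).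
      * match goal with |- _ * @mult _ ?a (@plus _ ?x ?y) = _ * ?w => change (RtoC 2 * (a * (x + y)) = - RtoC (2 / PI) * x); replace y with (RtoC 0) by reflexivity end.
        unfold Rdiv. rewrite RtoC_mult. ring.
      * intros k Hk. destruct (Nat.leb_spec k (S r)); [reflexivity|lia].
    + intros k Hk. destruct (Nat.leb_spec k (S r)); [lia|reflexivity].
  - intros k Hk.
    replace (1 - 2 * INR k - - INR (2 * r + 1)) with (RtoC (2 * (INR (S r) - INR k))).
    2:{ rewrite plus_INR, mult_INR, S_INR. simpl INR.
        rewrite !RtoC_mult, RtoC_minus, !RtoC_plus, !RtoC_mult, !RtoC_plus. ring. }
    rewrite zeta_int by auto.
    match goal with |- _ = @mult _ ?x ?y => change (@mult _ x y) with (x * y) end.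
    destruct (Nat.leb k (S r)); [|eqC; ring].
    rewrite bernoulli_even.
    replace (RtoC 2 * RtoC PI) with (RtoC (2 * PI)) by apply RtoC_mult. rewrite Cpow_mult_l.
    replace ((-1) ^ k) with (RtoC ((-1) ^ k)) by (rewrite RtoC_pow; reflexivity).
    rewrite <- RtoC_pow, <- RtoC_div, <- !RtoC_mult by apply INR_fact_neq_0.
    rewrite Cmult_assoc, <- RtoC_mult, <- RtoC_opp, Cmult_assoc, <- RtoC_mult. eqC. do 2 f_equal.
    replace ((2 * PI) ^ (2 * k))%R with (2 * PI * (2 * PI) ^ (2 * k - 1))%R.
    + assert (Hs : ((-1) ^ k * (-1) ^ k = 1)%R).
      { rewrite neg1_pow_mul. replace (k + k)%nat with (2 * k)%nat by lia. rewrite pow_mult.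
        replace ((-1) ^ 2)%R with 1%R by ring. apply pow1. }
      assert (Hp : ((2 * PI) ^ (2 * k - 1) <> 0)%R) by (apply pow_nonzero; lra).
      set (P := ((2 * PI) ^ (2 * k - 1))%R) in *. simpl ((-1) ^ S k)%R.
      transitivity (- (((-1) ^ k * (-1) ^ k) * / PI * (zeta_even k * zeta_even (S r - k))))%R; [field|rewrite Hs; ring].
      repeat split; auto; try lra. apply INR_fact_neq_0.
    + rewrite <- (pow_1 (2 * PI)) at 1. rewrite <- pow_add. f_equal. lia.
Qed.

Lemma period_g_odd (zeta : C -> C) (r M : nat) (z : C) : is_riemann_zeta zeta -> (1 <= r)%nat ->
  (S r <= M)%nat -> let n := (2 * r + 1)%nat in
  period_g zeta (- INR n) M z =
   (2 * PI * Ci) ^ n / (Ci * INR (fact (n + 1))) *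
        sum_n_m (fun m : nat =>
          Binomial.C (n + 1) (m + 1) * bernoulli (m + 1) * bernoulli (n - m)
          * z ^ m) 0 n.
Proof.
  intros Hz Hr HM n. unfold n at 1. rewrite period_g_value by auto. fold n.
  (* The weight is z^(j-1), replaced by 0 at j = 0: this removes the leading term of both sums and
     shifts the exponent by one. *)
  pose proof (bernoulli_sum r (fun j => match j with O => 0 | S i => z ^ i end) Hr) as H.
  cbv zeta in H. fold n in H.
  rewrite (sum_Sn_m _ 0 (n + 1)), (sum_Sn_m _ 0 (S r)) in H by lia.
  rewrite !Cmult_0_r in H.
  assert (aux : forall x c y : C, @plus C_AbelianMonoid (RtoC 0) x = c * @plus C_AbelianMonoid (RtoC 0) y -> x = c * y).
  { intros x c y E. change (0 + x = c * (0 + y)) in E. now rewrite !Cplus_0_l in E. }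
  apply aux in H. rename H into H'.
  replace (n + 1)%nat with (S n) in H' by lia.
  rewrite <- sum_n_m_S in H'.
  replace (n + 1)%nat with (S n) by lia.
  rewrite (sum_n_m_ext (fun m => RtoC (Binomial.C (S n) (m + 1)) * RtoC (bernoulli (m + 1)) *
           RtoC (bernoulli (n - m)) * z ^ m) (fun m => RtoC (Binomial.C (S n) (S m)) * RtoC (bernoulli (S m)) *
           RtoC (bernoulli (S n - S m)) * z ^ m)).
  2:{ intros m. replace (m + 1)%nat with (S m) by lia. reflexivity. }
  rewrite H'.
  rewrite (sum_n_m_ext_loc (fun k => RtoC (zeta_even k * zeta_even (S r - k)) * z ^ (2 * k - 1))
    (fun k => RtoC (zeta_even k * zeta_even (S r - k)) * match (2 * k)%nat with O => 0 | S i => z ^ i end)).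
  2:{ intros k Hk. destruct (2 * k)%nat as [|i] eqn:E; [lia|]. simpl (S i - 1)%nat. now rewrite Nat.sub_0_r. }
  set (X := sum_n_m _ 1 (S r)).
  assert (HF : RtoC (INR (fact (S n))) <> 0) by (intros E; apply RtoC_inj in E; now apply (INR_fact_neq_0 (S n))).
  pose proof (two_pi_i_const r) as Hc. fold n in Hc.
  rewrite RtoC_mult. set (P := (2 * PI * Ci) ^ n) in *. set (Q := RtoC ((-1) ^ S r * 4 / (2 * PI) ^ (2 * S r))) in *.
  transitivity (P * Q / Ci * X); [rewrite Hc; field; apply Ci_nz|].
  field. split; [exact HF|apply Ci_nz].
Qed.

(** * The period function on the imaginary axis *)

Lemma Cseries_is_cs (u : nat -> C) (l : C) : is_cs u l -> Cseries u = l.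
Proof.
  intros H. apply (iota_unique (V := C_CompleteNormedModule)); [|exact H].
  intros y Hy. rewrite <- (is_cs_unique u l H). symmetry. now apply is_cs_unique.
Qed.

Lemma sum_n_m_RtoC (f : nat -> R) (a b : nat) :
  @sum_n_m C_AbelianMonoid (fun k => RtoC (f k)) a b = RtoC (sum_n_m f a b).
Proof.
  induction b as [|b IH].
  - destruct a; [now rewrite !sum_n_n|]. now rewrite !sum_n_m_zero by lia.
  - destruct (le_lt_dec a (S b)) as [H|H].
    + rewrite !sum_n_Sm, IH by auto. symmetry. apply (RtoC_plus (sum_n_m f a b) (f (S b))).
    + now rewrite !sum_n_m_zero by lia.
Qed.

Lemma sigma_neg_nat (n k : nat) : Defs.sigma (- INR n) k = RtoC (sigma_inv n k).
Proof.
  unfold Defs.sigma, sigma_inv.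
  rewrite (sum_n_m_ext_loc _ (fun d => RtoC (if Nat.eqb (k mod d) 0 then / INR d ^ n else 0))).
  - apply sum_n_m_RtoC.
  - intros d Hd. destruct (Nat.eqb _ _); [|reflexivity].
    assert (0 < INR d)%R by (apply lt_0_INR; lia).
    rewrite Cpower_pos by auto. now apply Cexp_ln_pow_inv.
Qed.

(** The Lambert series contributes -zeta(n)/2, which the factor 2/zeta(n) turns into -1; this
    cancels the constant term of the Eisenstein series and leaves the coth sum alone. *)
Lemma eisenstein_imag (zeta : C -> C) (n : nat) (y : R) :
  is_riemann_zeta zeta -> (2 <= n)%nat -> (0 < y)%R ->
  eisenstein zeta (- INR n) (Ci * RtoC y) =
  RtoC (Series (fun d => coth_pi (INR (S d) * y) / INR (S d) ^ n)%R / zetaR n).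
Proof.
  intros Hz Hn Hy. unfold eisenstein.
  replace (- - RtoC (INR n)) with (RtoC (INR n)) by ring. rewrite zeta_nat by auto.
  destruct (lambert_series n y Hn Hy) as [_ H]. apply is_cs_RtoC in H.
  pose proof (zetaR_ge_1 n Hn).
  rewrite (Cseries_is_cs _ (RtoC ((Series (fun d => coth_pi (INR (S d) * y) / INR (S d) ^ n)%R - zetaR n) / 2))).
  - rewrite <- RtoC_div, <- RtoC_mult, <- RtoC_plus by lra. f_equal. field. lra.
  - revert H. apply is_cs_ext. intros k. rewrite RtoC_mult, sigma_neg_nat. f_equal.
    replace (2 * PI * Ci * INR (S k) * (Ci * y)) with (RtoC (INR (S k) * - (2 * PI * y))).
    + rewrite Cexp_RtoC, <- Rpower_pow by apply exp_pos. unfold Rpower. now rewrite ln_exp.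
    + transitivity ((Ci * Ci) * (RtoC 2 * RtoC PI * RtoC (INR (S k)) * RtoC y)); [|ring].
      rewrite Ci_sq, !RtoC_mult, RtoC_opp, !RtoC_mult. ring.
Qed.

Lemma Cexp_Clog_imag (y : R) : (0 < y)%R -> Cexp (Clog (Ci * RtoC y)) = Ci * RtoC y.
Proof.
  intros Hy. unfold Clog, Carg. rewrite Cmod_mult, Cmod_Ci, Cmod_R, Rabs_pos_eq, Rmult_1_l by lra.
  assert (E1 : Re (Ci * RtoC y) = 0%R) by (simpl; ring).
  assert (E2 : Im (Ci * RtoC y) = y) by (simpl; ring).
  rewrite E1, E2, Rplus_0_r. replace (y / y)%R with 1%R by (field; lra). rewrite atan_1.
  replace (2 * (PI / 4))%R with (PI / 2)%R by field.
  unfold Cexp. simpl. rewrite cos_PI2, sin_PI2, exp_ln by auto.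
  apply injective_projections; simpl; ring.
Qed.

Lemma Cexp_nat_mult (w : C) (n : nat) : Cexp (RtoC (INR n) * w) = Cexp w ^ n.
Proof.
  induction n as [|n IH].
  - simpl. rewrite Cmult_0_l, Cexp_RtoC, exp_0. reflexivity.
  - rewrite S_INR, RtoC_plus. replace ((INR n + 1) * w) with (RtoC (INR n) * w + w) by ring.
    rewrite Cexp_plus, IH. simpl. ring.
Qed.

Lemma Cexp_nz (w : C) : Cexp w <> 0.
Proof.
  intros E. pose proof (Cexp_opp w) as H. rewrite E, Cmult_0_l in H.
  apply RtoC_inj in H. lra.
Qed.

Lemma imag_sq (y : R) : (Ci * RtoC y) ^ 2 = RtoC (- y ^ 2).
Proof.
  transitivity ((Ci * Ci) * (RtoC y * RtoC y)); [simpl; ring|].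
  rewrite Ci_sq, <- RtoC_mult, RtoC_opp. replace (y * y)%R with (y ^ 2)%R by ring. ring.
Qed.

Lemma imag_pow_even (y : R) (k : nat) : (Ci * RtoC y) ^ (2 * k) = RtoC ((- y ^ 2) ^ k).
Proof. now rewrite Cpow_mult_r, imag_sq, RtoC_pow. Qed.

(** The weight a + 1 = -2r is an even integer, so the principal power reduces to an ordinary one,
    and (iy)^(2r) is real. *)
Lemma Cpower_imag (r : nat) (y : R) : (0 < y)%R ->
  1 / Cpower (Ci * RtoC y) (- INR (2 * r + 1) + 1) = RtoC ((- y ^ 2) ^ r).
Proof.
  intros Hy. rewrite <- imag_pow_even. unfold Cpower.
  set (w := Clog (Ci * RtoC y)).
  replace ((- INR (2 * r + 1) + 1) * w) with (- (RtoC (INR (2 * r)) * w)).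
  - pose proof (Cexp_opp (RtoC (INR (2 * r)) * w)) as H.
    rewrite Cexp_nat_mult in H. unfold w in H at 1. rewrite Cexp_Clog_imag in H by auto.
    pose proof (Cexp_nz (- (RtoC (INR (2 * r)) * w))) as Hnz.
    set (E := Cexp _) in *. rewrite <- H. field. exact Hnz.
  - rewrite plus_INR, RtoC_plus. simpl (INR 1). ring.
Qed.

(** The end terms carry zeta(0) = -1/2. At x = -y^2 they account for the two isolated terms of
    [coth_pi_reciprocity], and the interior terms for its finite sum. *)
Lemma zeta_even_sum (q : nat) (x : R) :
  sum_n_m (fun k => zeta_even k * zeta_even (S (S q) - k) * x ^ k)%R 0 (S (S q)) =
  (- (1 / 2) * zetaR (2 * S q + 2) + x * sum_n (fun i => x ^ i * zetaR (2 * (S (q - i))) * zetaR (2 * S i)) q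
    - 1 / 2 * (x ^ S (S q) * zetaR (2 * S q + 2)))%R.
Proof.
  rewrite sum_Sn_m, sum_n_Sm by lia. rewrite <- sum_n_m_S.
  rewrite (sum_n_m_ext_loc (fun n => zeta_even (S n) * zeta_even (S (S q) - S n) * x ^ S n)%R
     (fun i => mult x (x ^ i * zetaR (2 * (S (q - i))) * zetaR (2 * S i))%R)).
  - rewrite (@sum_n_m_mult_l R_Ring). rewrite Nat.sub_0_r, Nat.sub_diag.
    change (zeta_even (S (S q))) with (zetaR (2 * S (S q))). change (zeta_even 0) with (- (1 / 2))%R.
    replace (2 * S (S q))%nat with (2 * S q + 2)%nat by lia.
    fold (sum_n (fun i => x ^ i * zetaR (2 * (S (q - i))) * zetaR (2 * S i))%R q).
    set (S0 := sum_n _ q). eqR.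
    change (- (1 / 2) * zetaR (2 * S q + 2) * x ^ 0 + (x * S0 + zetaR (2 * S q + 2) * - (1 / 2) * x ^ S (S q)) =
      - (1 / 2) * zetaR (2 * S q + 2) + x * S0 - 1 / 2 * (x ^ S (S q) * zetaR (2 * S q + 2)))%R.
    simpl (x ^ 0)%R. ring.
  - intros i Hi. replace (S (S q) - S i)%nat with (S (q - i)) by lia.
    change (zetaR (2 * S i) * zetaR (2 * S (q - i)) * x ^ S i = x * (x ^ i * zetaR (2 * S (q - i)) * zetaR (2 * S i)))%R.
    simpl (x ^ S i)%R. ring.
Qed.

(** Since -1/(iy) = i/y, both Eisenstein values are real coth sums, and psi(iy) is the left side of
    the reciprocity divided by zeta(n). The factor iy clears the term in 1/z. *)
Lemma period_function_imag (zeta psi : C -> C) (q : nat) (y : R) :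
  let r := S q in let n := (2 * r + 1)%nat in
  is_riemann_zeta zeta -> is_period_function zeta (- INR n) psi -> (0 < y)%R ->
  Ci * RtoC y * psi (Ci * RtoC y) =
  - RtoC (2 / PI) * Ci / zeta (INR n) *
    @sum_n_m C_AbelianMonoid (fun k => RtoC (zeta_even k * zeta_even (S r - k)) * (Ci * RtoC y) ^ (2 * k)) 0 (S r).
Proof.
  intros r n Hz [_ Hpsi] Hy. pose proof PI_RGT_0 as HPI.
  assert (Hn : (2 <= n)%nat) by (unfold n, r; lia).
  rewrite Hpsi by (simpl; lra).
  replace (- (1 / (Ci * RtoC y))) with (Ci * RtoC (/ y)).
  2:{ rewrite RtoC_inv by lra.
      assert (RtoC y <> 0) by (intros E; apply RtoC_inj in E; lra).
      transitivity ((Ci * Ci) / (Ci * RtoC y)); [field; split; [auto|apply Ci_nz]|].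
      rewrite Ci_sq. field. split; [auto|apply Ci_nz]. }
  rewrite !eisenstein_imag by (auto; now apply Rinv_0_lt_compat).
  unfold n at 3. rewrite Cpower_imag by auto.
  rewrite zeta_nat by auto.
  rewrite (sum_n_m_ext _ (fun k => RtoC (zeta_even k * zeta_even (S r - k) * (- y ^ 2) ^ k))).
  2:{ intros k. rewrite imag_pow_even. symmetry. apply RtoC_mult. }
  rewrite sum_n_m_RtoC. unfold r. rewrite zeta_even_sum. fold r.
  pose proof (coth_pi_reciprocity q y Hy) as H. cbv zeta in H. fold r in H. fold n in H.
  set (S1 := Series (fun d => coth_pi (INR (S d) * y) / INR (S d) ^ n)%R) in *.
  set (S2 := Series (fun d => coth_pi (INR (S d) * / y) / INR (S d) ^ n)%R) in *.
  pose (A := sum_n (fun i => (- y ^ 2) ^ i * zetaR (2 * S (q - i)) * zetaR (2 * S i))%R q : R).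
  fold A in H. change (sum_n (fun i => (- y ^ 2) ^ i * zetaR (2 * S (q - i)) * zetaR (2 * S i))%R q) with A.
  pose proof (zetaR_ge_1 n Hn) as Hzr.
  rewrite <- RtoC_opp, <- RtoC_mult, <- RtoC_minus.
  assert (E : (S1 / zetaR n - (- y ^ 2) ^ r * (S2 / zetaR n) = (S1 - (- y ^ 2) ^ r * S2) / zetaR n)%R) by (field; lra).
  rewrite E, H.
  transitivity (Ci * RtoC (y * (/ PI * (zetaR (2 * r + 2) * / y - (- y ^ 2) ^ r * y * zetaR (2 * r + 2) + 2 * y * A) / zetaR n))).
  { rewrite RtoC_mult. ring. }
  match goal with |- _ = RtoC ?a * Ci / RtoC ?b * RtoC ?s =>
    transitivity (Ci * RtoC (a / b * s)); [|rewrite RtoC_mult, RtoC_div by lra; unfold Cdiv; ring] end.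
  do 2 f_equal. change ((- y ^ 2) ^ S r)%R with (- y ^ 2 * (- y ^ 2) ^ r)%R.
  field. lra.
Qed.

(** * Continuation to the slit plane, and the theorem *)

Lemma period_function_odd (zeta psi : C -> C) (q : nat) (z : C) :
  let r := S q in let n := (2 * r + 1)%nat in
  is_riemann_zeta zeta -> is_period_function zeta (- INR n) psi -> slit_plane z ->
  psi z =
    (2 * PI * Ci) ^ n / (zeta (INR n) * INR (fact (n + 1))) *
        sum_n_m (fun m : nat =>
          Binomial.C (n + 1) m * bernoulli m * bernoulli (n + 1 - m)
          * (z ^ m / z)) 0 (n + 1).
Proof.
  intros r n Hz Hpsi Hslit.
  assert (Hz0 : z <> 0) by (intros ->; apply Hslit; simpl; lra).
  assert (Hn : (2 <= n)%nat) by (unfold n, r; lia).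
  set (P := fun w : C => @sum_n_m C_AbelianMonoid (fun k => RtoC (zeta_even k * zeta_even (S r - k)) * w ^ (2 * k)) 0 (S r)).
  set (K := - RtoC (2 / PI) * Ci / zeta (INR n)).
  (* Multiplication by z turns the expected value of psi into the polynomial K P, so the function
     tested by the identity theorem is analytic on sight. *)
  assert (Hmain : z * psi z + (- K) * P z = 0).
  { apply (slit_plane_identity (fun w => w * psi w + (- K) * P w)); auto.
    - intros w Hw. apply (analytic_plus (fun w => w * psi w) (fun w => (- K) * P w)).
      + apply analytic_ext with (fun w => (0 + 1 * w) * psi w); [intros; ring|].
        apply analytic_lin. now apply (proj1 Hpsi).
      + apply analytic_scal. apply (analytic_sum (fun k w => RtoC (zeta_even k * zeta_even (S r - k)) * w ^ (2 * k))).
        intros k. apply analytic_scal, analytic_pow.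
    - intros y Hy. rewrite (period_function_imag zeta psi q y Hz Hpsi Hy). fold r. fold n. fold K.
      fold (P (Ci * RtoC y)). ring. }
  pose proof (bernoulli_sum r (fun m => z ^ m / z) ltac:(unfold r; lia)) as HB.
  cbv zeta in HB. fold n in HB. rewrite HB.
  rewrite (sum_n_m_ext _ (fun k => mult (RtoC (zeta_even k * zeta_even (S r - k)) * z ^ (2 * k)) (/ z))).
  2:{ intros k. apply Cmult_assoc. }
  rewrite (@sum_n_m_mult_r C_Ring).
  match goal with |- _ = _ * (_ * @mult _ ?x ?y) => change (@mult _ x y) with (P z * / z) end.
  pose proof (two_pi_i_const r) as Hc. fold n in Hc.
  assert (HF : RtoC (INR (fact (n + 1))) <> 0) by (intros E; apply RtoC_inj in E; now apply (INR_fact_neq_0 (n + 1))).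
  assert (HZ : zeta (INR n) <> 0).
  { rewrite zeta_nat by auto. intros E. apply RtoC_inj in E. pose proof (zetaR_ge_1 n Hn). lra. }
  rewrite RtoC_mult. set (W := (2 * PI * Ci) ^ n) in *. set (Q := RtoC ((-1) ^ S r * 4 / (2 * PI) ^ (2 * S r))) in *.
  transitivity (W * Q / zeta (INR n) * P z / z).
  - rewrite Hc. fold K.
    assert (E : z * psi z = K * P z) by (apply Ceq_minus; rewrite <- Hmain; ring).
    rewrite <- E. field. exact Hz0.
  - field. repeat split; auto.
Qed.

Theorem theorem3 :
  forall (zeta : C -> C), is_riemann_zeta zeta ->
  forall (n : nat), (1 < n)%nat -> Nat.Odd n ->
  forall (z : C), slit_plane z ->
    (forall (psi : C -> C), is_period_function zeta (- INR n) psi ->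
      psi z =
        (2 * PI * Ci) ^ n / (zeta (INR n) * INR (fact (n + 1))) *
        sum_n_m (fun m : nat =>
          Binomial.C (n + 1) m * bernoulli m * bernoulli (n + 1 - m)
          * (z ^ m / z)) 0 (n + 1))
    /\
    (forall (M : nat), (- (1 / 2) * Rmin 0 (Re (- INR n)) <= INR M)%R ->
      period_g zeta (- INR n) M z =
        (2 * PI * Ci) ^ n / (Ci * INR (fact (n + 1))) *
        sum_n_m (fun m : nat =>
          Binomial.C (n + 1) (m + 1) * bernoulli (m + 1) * bernoulli (n - m)
          * z ^ m) 0 n).
Proof.
  intros zeta Hz n Hn [r ->] z Hslit. destruct r as [|q]; [lia|]. split.
  - intros psi Hpsi. now apply period_function_odd.
  - intros M HM. apply period_g_odd; [exact Hz|lia|].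
    assert (E : Re (- RtoC (INR (2 * S q + 1))) = (- INR (2 * S q + 1))%R) by reflexivity.
    rewrite E in HM. rewrite Rmin_right in HM by (pose proof (pos_INR (2 * S q + 1)); lra).
    (* The condition on M reads n <= 2M. As n = 2q + 3 is odd, it gives q + 2 <= M, so the finite
       sum reaches the last nonzero term, the one containing zeta(0). *)
    assert (H : (INR (2 * S q + 1) <= INR (2 * M))%R) by (rewrite mult_INR; simpl (INR 2); lra).
    apply INR_le in H. lia.
Qed.
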